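(* Let $\Omega$ and $U$ be open and bounded subsets of $\mathbb{R}^N$ such that $\Omega \Subset U$. Let $k\in\mathbb{N}$ (where $k=0$ is allowed), $\alpha\in(0,1]$, and let $a : U \to [0,\infty)$ be of class $C^{k,\alpha}(U)$. Then there exist functions $\sigma, \omega : \Omega \to [0,\infty)$ such that $\sigma \in \mathcal{Z}^{k+\alpha}(\Omega)$, $\omega \in A_{k+\alpha+1}(\Omega) \cap L^\infty(\Omega)$ and $a = \sigma\omega$ on $\Omega$.
   Context: $\Omega \Subset U$ means that $\overline{\Omega}$ is a compact subset of $U$. For $k\in\{0,1,2,\dots\}$ and $\alpha\in(0,1]$, $a \in C^{k,\alpha}(U)$ means that $a$ has all derivatives up to order $k$ in $U$ and $\sup_{x,y\in U,\,x\neq y} \|D^k a(x)-D^k a(y)\|/|x-y|^\alpha < \infty$. For an open set $V\subseteq\mathbb{R}^N$ and $\varkappa>0$, a non-negative function $\sigma$ on $V$ belongs to $\mathcal{Z}^{\varkappa}(V)$ if there is a constant $C$ such that $\sigma(x) \le C\left(\sigma(y) + |x-y|^{\varkappa}\right)$ for all $x,y \in V$. For $r \in (1,\infty)$ and an open set $V\subseteq\mathbb{R}^N$, a function $\omega : V \to [0,\infty)$ belongs to the local Muckenhoupt class $A_r(V)$ if $$\sup_{B \subseteq V} \left(\frac{1}{|B|}\int_B \omega \,dz\right)\left(\frac{1}{|B|}\int_B \omega^{-\frac{1}{r-1}}\,dz\right)^{r-1} < \infty,$$ where the supremum is over all balls $B$ contained in $V$ (and $\omega^{-1/(r-1)}=+\infty$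 where $\omega=0$). *)

(* Defs.v *)
From HB Require Import structures.
From mathcomp Require Import all_boot all_order all_algebra.
From mathcomp Require Import all_classical all_reals all_analysis.
From mathcomp Require Import measurable_realfun.

Set Implicit Arguments.
Unset Strict Implicit.
Unset Printing Implicit Defensive.

Import Order.TTheory GRing.Theory Num.Theory.
Import numFieldNormedType.Exports.

Local Open Scope classical_set_scope.
Local Open Scope ring_scope.

(** R^n is the type ['rV[R]_n] of row vectors; its library norm [`| x |] is the
    sup norm, so the Euclidean norm and balls are defined separately. *)

Definition enorm (R : realType) (n : nat) (x : 'rV[R]_n) : R :=
  Num.sqrt (\sum_(i < n) x ord0 i ^+ 2).

Definition eball (R : realType) (n : nat) (x : 'rV[R]_n) (r : R) : set 'rV[R]_n :=
  [set y | enorm (y - x) < r].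

Definition compactly_contained (T : topologicalType) (V W : set T) : Prop :=
  compact (closure V) /\ closure V `<=` W.

(** [derivs a [:: v1; ...; vj] x] is D^j a(x)(v1, ..., vj). *)
Fixpoint derivs (R : realType) (n : nat) (a : 'rV[R]_n -> R)
    (vs : seq 'rV[R]_n) : 'rV[R]_n -> R :=
  if vs is v :: vs' then fun x => 'D_v (derivs a vs') x else a.

(** The operator norm of a j-linear form, with values in [\bar R]. *)
Definition opnorm (R : realType) (n j : nat) (T : j.-tuple 'rV[R]_n -> R) : \bar R :=
  ereal_sup [set `| T vs |%:E | vs in
    [set vs : j.-tuple 'rV[R]_n | forall v, v \in vs -> enorm v <= 1]].

(** D^j a is Fréchet differentiable at x iff all the functions D^j a(.)(vs) are. *)
Definition holder_class (R : realType) (n k : nat) (alpha : R) (V : set 'rV[R]_n)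
    (a : 'rV[R]_n -> R) : Prop :=
  (forall vs : seq 'rV[R]_n, (size vs < k)%N ->
     forall x, V x -> differentiable (derivs a vs) x) /\
  (ereal_sup
    [set (opnorm (fun vs : k.-tuple 'rV[R]_n => (derivs a vs p.1 - derivs a vs p.2)%R)
            * ((enorm (p.1 - p.2) `^ alpha)^-1)%:E)%E
     | p in [set p : 'rV[R]_n * 'rV[R]_n | [/\ V p.1, V p.2 & p.1 != p.2]]]
   < +oo)%E.

Definition Zclass (R : realType) (n : nat) (kappa : R) (V : set 'rV[R]_n)
    (s : 'rV[R]_n -> R) : Prop :=
  (forall x, V x -> 0 <= s x) /\
  exists C : R, forall x y, V x -> V y ->
    s x <= C * (s y + enorm (x - y) `^ kappa).

Definition rV_display : measure_display. Proof. exact: default_measure_display. Qed.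

Section borel_rV.
Context (R : realType) (n : nat).

Let rV_borel : set (set 'rV[R]_n) := <<s open >>.

Let rV_borel0 : rV_borel set0.
Proof. exact: sigma_algebra0. Qed.

Let rV_borelC A : rV_borel A -> rV_borel (~` A).
Proof. exact: sigma_algebraC. Qed.

Let rV_borel_bigcup (F : (set 'rV[R]_n)^nat) :
  (forall i, rV_borel (F i)) -> rV_borel (\bigcup_i F i).
Proof. exact: sigma_algebra_bigcup. Qed.

HB.instance Definition _ := @isMeasurable.Build
  rV_display 'rV[R]_n rV_borel rV_borel0 rV_borelC rV_borel_bigcup.

Lemma open_measurable_rV (A : set 'rV[R]_n) : open A -> measurable A.
Proof. by move=> oA; exact: sub_sigma_algebra. Qed.

End borel_rV.

Definition rV_cons (R : realType) (n : nat) (p : R * 'rV[R]_n) : 'rV[R]_n.+1 :=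
  row_mx p.1%:M p.2 : 'rV[R]_(1 + n).

Lemma rV_cons_ord0 (R : realType) n (p : R * 'rV[R]_n) : rV_cons p ord0 ord0 = p.1.
Proof.
rewrite /rV_cons mxE; case: splitP => [j|j] //=.
by rewrite ord1 mxE eqxx mulr1n.
Qed.

Lemma rV_cons_lift (R : realType) n (p : R * 'rV[R]_n) i :
  rV_cons p ord0 (lift ord0 i) = p.2 ord0 i.
Proof.
rewrite /rV_cons mxE; case: splitP => [j|j] /=; first by case: j => -[].
by rewrite /bump/= !add1n => -[] ij; congr (p.2 _ _); exact: val_inj.
Qed.

Lemma rV_ballE (R : realType) n (c v : 'rV[R]_n) (r : R) : 0 < r ->
  ball c r v <-> forall i, `| c ord0 i - v ord0 i | < r.
Proof.
by move=> r0; split=> [[_ h] i|h]; [exact: h|split=> // i j; rewrite ord1; exact: h].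
Qed.

(** An open set is the union of the countably many rational boxes it contains. *)
Lemma rV_open_bigcup (R : realType) n (O : set 'rV[R]_n) : open O ->
  O = \bigcup_(q : 'rV[rat]_n * nat)
        (if `[< ball (map_mx ratr q.1 : 'rV[R]_n) q.2.+1%:R^-1 `<=` O >]
         then ball (map_mx ratr q.1 : 'rV[R]_n) q.2.+1%:R^-1 else set0).
Proof.
move=> oO; apply/seteqP; split; last first.
  by move=> x [q _]; case: ifPn => // /asboolP; apply.
move=> x Ox.
have /nbhs_ballP[e /= e0 xeO] : nbhs x O by exact: open_nbhs_nbhs.
have [m me] : exists m : nat, m.+1%:R^-1 < e / 2.
  have := @near_infty_natSinv_lt R (PosNum (divr_gt0 e0 (@ltr0Sn R 1))).
  by case=> m _ /(_ m); move=> /(_ (leqnn _)) h; exists m.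
have m0 : 0 < m.+1%:R^-1 :> R by rewrite invr_gt0.
have hq i : exists q : rat, `| ratr q - x ord0 i | < m.+1%:R^-1 :> R.
  have [q] := @rat_in_itvoo R (x ord0 i - m.+1%:R^-1) (x ord0 i + m.+1%:R^-1)
    ltac:(by rewrite ltrD2l (lt_trans _ m0)// oppr_lt0).
  rewrite in_itv/= => /andP[q1 q2]; exists q.
  by rewrite ltr_distl q1 q2.
have [q qP] := choice hq.
have qx : ball (map_mx ratr (\row_i q i) : 'rV[R]_n) m.+1%:R^-1 x.
  by apply/rV_ballE => // i; rewrite !mxE.
exists (\row_i q i, m) => //=.
rewrite ifT//; apply/asboolP => y qy; apply: xeO.
have xc := le_ball (ltW me) (ball_sym qx).
have cy := le_ball (ltW me) qy.
by rewrite (splitr e); exact: ball_triangle xc cy.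
Qed.

Lemma continuous_measurable_rV (R : realType) n (f : 'rV[R]_n -> R) :
  continuous f -> measurable_fun setT f.
Proof.
move=> cf; apply: (measurability _ (RGenOpens.measurableE R)).
move=> _ [_ [a [b ->]] <-]; rewrite setTI; apply: open_measurable_rV.
by apply: open_comp => [x _|]; [exact: cf|exact: interval_open].
Qed.

Lemma measurable_rV_cons (R : realType) n :
  measurable_fun setT (@rV_cons R n).
Proof.
apply: (@measurability _ _ _ _ _ _ (@open 'rV[R]_n.+1)) => //.
move=> _ [B oB <-]; rewrite setTI (rV_open_bigcup oB) preimage_bigcup.
apply: countable_bigcupT_measurable; first exact: countableP.
move=> -[q m]; case: ifPn => _; last by rewrite preimage_set0.
set r : R := m.+1%:R^-1; set c : 'rV[R]_n.+1 := map_mx _ _.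
have r0 : 0 < r by rewrite invr_gt0.
have -> : @rV_cons R n @^-1` ball c r =
    ball (c ord0 ord0) r `*` ball (\row_i c ord0 (lift ord0 i)) r.
  apply/seteqP; split => -[x v] /=.
    move=> /(rV_ballE _ _ r0) h; split => /=.
      by have := h ord0; rewrite rV_cons_ord0.
    by apply/rV_ballE => // i; rewrite mxE; have := h (lift ord0 i); rewrite rV_cons_lift.
  move=> [/= h1 /(rV_ballE _ _ r0) h2]; apply/rV_ballE => // i.
  have [->|[j ->]] : i = ord0 \/ exists j, i = lift ord0 j.
    by case: (unliftP ord0 i) => [j|] ->; [right; exists j|left].
  - by rewrite rV_cons_ord0.
  - by rewrite rV_cons_lift; have := h2 j; rewrite mxE.
apply: measurableX; first exact: measurable_ball.
by apply: open_measurable_rV; exact: ball_open.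
Qed.

Lemma measurable_rV_tail (R : realType) n :
  measurable_fun setT (fun v : 'rV[R]_n.+1 => \row_i v ord0 (lift ord0 i) : 'rV[R]_n).
Proof.
apply: (@measurability _ _ _ _ _ _ (@open 'rV[R]_n)) => //.
move=> _ [B oB <-]; rewrite setTI; apply: open_measurable_rV.
rewrite openE => v Bv; have /nbhs_ballP[e /= e0 eB] :
  nbhs (\row_i v ord0 (lift ord0 i) : 'rV[R]_n) B by exact: open_nbhs_nbhs.
apply/nbhs_ballP; exists e => // w /(rV_ballE _ _ e0) vw; apply: eB.
by apply/rV_ballE => // i; rewrite !mxE.
Qed.

Section leb_cons.
Context (R : realType) (n : nat).
Variable mu : {sigma_finite_measure set 'rV[R]_n -> \bar R}.

(** The image of [lebesgue_measure \x mu] under the identification of R x R^n with R^n.+1. *)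
Definition leb_cons : set 'rV[R]_n.+1 -> \bar R :=
  pushforward (lebesgue_measure \x mu)%E (@rV_cons R n).

Let leb_cons0 : leb_cons set0 = 0%E.
Proof. by rewrite /leb_cons /pushforward preimage_set0 measure0. Qed.

Let leb_cons_ge0 A : (0 <= leb_cons A)%E.
Proof. by rewrite /leb_cons /pushforward measure_ge0. Qed.

Let leb_cons_additive : semi_sigma_additive leb_cons.
Proof.
have mf := @measurable_rV_cons R n.
move=> F mF tF mUF; rewrite /leb_cons /pushforward preimage_bigcup.
apply: measure_semi_sigma_additive.
- by move=> k; rewrite -[X in measurable X]setTI; exact: mf.
- apply/trivIsetP => /= i j _ _ ij; rewrite -preimage_setI.
  by move/trivIsetP : tF => /(_ _ _ _ _ ij) ->//; rewrite preimage_set0.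
- by rewrite -preimage_bigcup -[X in measurable X]setTI; exact: mf.
Qed.

HB.instance Definition _ := isMeasure.Build _ _ _ leb_cons
  leb_cons0 leb_cons_ge0 leb_cons_additive.

Let leb_cons_sigma_finite : sigma_finite setT leb_cons.
Proof.
have [F1 F1T F1P] := sigma_finiteT (@lebesgue_measure R).
have [F2 F2T F2P] := sigma_finiteT mu.
pose G (ij : nat * nat) := [set v : 'rV[R]_n.+1 | F1 ij.1 (v ord0 ord0) /\
  F2 ij.2 (\row_i v ord0 (lift ord0 i))].
have GE ij : @rV_cons R n @^-1` G ij = F1 ij.1 `*` F2 ij.2.
  apply/seteqP; split=> -[x v]; rewrite /G /= rV_cons_ord0/=;
    by rewrite (_ : \row_i _ = v)//; apply/rowP => i; rewrite mxE rV_cons_lift.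
exists (fun k => if unpickle k is Some ij then G ij else set0).
  apply/esym; rewrite -subTset => v _.
  have : setT (v ord0 ord0) by [].
  rewrite F1T => -[i _ Fi].
  have : setT (\row_i v ord0 (lift ord0 i)) by [].
  rewrite F2T => -[j _ Fj].
  by exists (pickle (i, j)) => //; rewrite pickleK.
move=> k; case: (unpickle k) => [[i j]|]; last by rewrite measure0.
have [[mF1 F1oo] [mF2 F2oo]] := (F1P i, F2P j); split.
  apply: measurableI; rewrite -[X in measurable X]setTI.
    apply: continuous_measurable_rV => //; exact: coord_continuous.
  exact: measurable_rV_tail.
rewrite /leb_cons /pushforward GE /= product_measure1E//.
by rewrite lte_mul_pinfty// ge0_fin_numE.
Qed.

HB.instance Definition _ := @Measure_isSigmaFinite.Build _ _ _ leb_cons leb_cons_sigma_finite.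

End leb_cons.

(** n-dimensional Lebesgue measure, on the Borel sets of R^n. *)
Fixpoint leb (R : realType) (n : nat) : {sigma_finite_measure set 'rV[R]_n -> \bar R} :=
  match n with
  | 0 => \d_(0 : 'rV[R]_0)
  | m.+1 => leb_cons (leb R m)
  end.

Lemma leb_box (R : realType) (n : nat) (a b : 'I_n -> R) : (forall i, a i <= b i) ->
  leb R n [set v | forall i, a i <= v ord0 i <= b i] = (\prod_(i < n) (b i - a i))%:E.
Proof.
elim: n a b => [|n IH] a b ab.
  by rewrite big_ord0 /= diracE mem_set// => -[].
rewrite /= /leb_cons /pushforward.
rewrite (_ : _ @^-1` _ = `[a ord0, b ord0]%classic `*`
    [set v : 'rV[R]_n | forall i, a (lift ord0 i) <= v ord0 i <= b (lift ord0 i)]).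
  rewrite product_measure1E//=; last first.
    rewrite (_ : [set v | _] = \bigcap_(i in [set: 'I_n])
        ((fun v : 'rV[R]_n => v ord0 i) @^-1` `[a (lift ord0 i), b (lift ord0 i)])).
      apply: fin_bigcap_measurable; first exact: finite_finset.
      move=> i _; rewrite -[X in measurable X]setTI.
      by apply: continuous_measurable_rV => //; exact: coord_continuous.
    apply/seteqP; split => v /= h i; first by move=> _; rewrite /= in_itv/= h.
    by have := h i I; rewrite /= in_itv.
  transitivity ((b ord0 - a ord0)%:E * (\prod_(i < n) (b (lift ord0 i) - a (lift ord0 i)))%:E)%E.
    congr (_ * _)%E; last by rewrite IH.
    rewrite lebesgue_measure_itv/= lte_fin; case: ltgtP (ab ord0) => // -> _.
    by rewrite subrr.
  by rewrite big_ord_recl -EFinM.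
apply/seteqP; split => -[x v] /=.
  move=> h; split => [|i]; first by have := h ord0; rewrite rV_cons_ord0 /= in_itv.
  by have := h (lift ord0 i); rewrite rV_cons_lift.
rewrite in_itv/= => -[h0 h] i.
case: (unliftP ord0 i) => [j|] ->; first by rewrite rV_cons_lift; exact: h.
by rewrite rV_cons_ord0.
Qed.

Definition average (R : realType) (n : nat) (B : set 'rV[R]_n)
    (f : 'rV[R]_n -> \bar R) : \bar R :=
  ((leb R n B)^-1 * \int[leb R n]_(z in B) f z)%E.

(** w^(-1/(r-1)); in the library [0 `^ p = 0] for every [p != 0]. *)
Definition dual_weight (R : realType) (n : nat) (r : R) (w : 'rV[R]_n -> R)
    (x : 'rV[R]_n) : \bar R :=
  if w x == 0 then +oo%E else (w x `^ (- (r - 1)^-1))%:E.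

(** In [\bar R], [0 * +oo = 0]: the positivity a.e. excludes functions that vanish
    a.e. on some ball, for which the product of the averages is of the form 0 * +oo. *)
Definition muckenhoupt (R : realType) (n : nat) (r : R) (V : set 'rV[R]_n)
    (w : 'rV[R]_n -> R) : Prop :=
  [/\ forall x, V x -> 0 <= w x,
      measurable_fun V w,
      {ae leb R n, forall x, V x -> 0 < w x} &
      (ereal_sup
        [set average (eball p.1 p.2) (EFin \o w)
               * poweR (average (eball p.1 p.2) (dual_weight r w)) (r - 1)%R
         | p in [set p : 'rV[R]_n * R | (0 < p.2)%R /\ eball p.1 p.2 `<=` V]]
       < +oo)%E].

(* Main.v *)
Require Import Defs.
From HB Require Import structures.
From mathcomp Require Import all_boot all_order all_algebra.
From mathcomp Require Import all_classical all_reals all_analysis.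
From mathcomp Require Import measurable_realfun ring lra.

Set Implicit Arguments.
Unset Strict Implicit.
Unset Printing Implicit Defensive.

Import Order.TTheory GRing.Theory Num.Theory.
Import numFieldNormedType.Exports.

Local Open Scope classical_set_scope.
Local Open Scope ring_scope.

(* Put kap = k + alpha. Let rho(x) be the sum over finitely many directions e and over j <= k
   of |D_e^j a(x) / L|^(1/(kap-j)), where L is the Hoelder constant: by Taylor's formula rho
   is comparable at any two points at distance at most rho, so that sigma = L rho^kap belongs
   to Z^kap, and a <= sigma gives omega = a / sigma <= 1. On a line, some D_e^j a is of size
   rho^(kap-j) on an interval of length comparable to rho, where a is therefore bounded below
   like a polynomial of degree j < kap with simple roots; hence (a / L)^(-1/kap) has integral
   O(1) there, i.e. mean O(1/rho). Covering by such intervals and integrating over the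
   parallel lines (Fubini) bounds the integral of rho (a / L)^(-1/kap) = omega^(-1/kap) over a
   ball of radius r by C r^N as soon as rho = O(r) on it, and omega <= 1 settles these balls.
   On a ball with r much smaller than rho, rho is almost constant; replacing L by a larger
   lam for which the scale of a is comparable to r reduces to the previous case, because the
   Muckenhoupt quotient does not change when a is multiplied by a constant. *)

(** The obstacle is a small ball near a zero of [a] at which some derivative is large: there omega
    is tiny on the whole ball, so omega <= 1 is too weak against the mean of omega^(-1/kap), and
    both have to be measured with the same local unit lam. Enlarging lam only weakens the Hölder
    condition on a / lam; this is why the scale comparison and the integral bounds are proved for
    all lam >= L with constants independent of lam. The exponent 1/kap is the dual exponent of the
    class A_(kap+1), and al > 0 enters through j <= k < kap, which makes |t|^(-j/kap) integrable at
    0. A line in direction e only sees the summand of rho that belongs to e, so the integral is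
    split over e and each part is integrated along its own direction. No direction has to be
    selected point by point. *)

(** * Jets of functions of one variable and Taylor's formula *)

Section real_jets.
Context {R : realType}.
Implicit Types (p q s t x al : R) (F : nat -> R -> R).

Lemma mvt_between (f df : R -> R) p q x t :
  (forall s, s \in `[p, q] -> is_derive s 1 f (df s)) ->
  x \in `[p, q] -> t \in `[p, q] ->
  exists c, [/\ c \in `[p, q], Num.min x t <= c <= Num.max x t &
                f t - f x = df c * (t - x)].
Proof.
move=> Df; wlog xt : x t / x <= t.
  move=> h xI tI; case/orP: (le_total x t) => [xt|tx]; first exact: h.
  have [c [cI cb e]] := h _ _ tx tI xI; exists c; split => //.
    by rewrite minC maxC.
  by rewrite -opprB e -mulrN opprB.
rewrite !in_itv/= => /andP[px xq] /andP[pt tq].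
have sI s : x <= s <= t -> s \in `[p, q].
  by move=> /andP[xs st]; rewrite in_itv/= (le_trans px xs) (le_trans st tq).
have D1 s : s \in `]x, t[ -> is_derive s 1 f (df s).
  by rewrite in_itv/= => /andP[/ltW xs /ltW st]; apply: Df; apply: sI; rewrite xs st.
have D2 : {within `[x, t], continuous f}.
  apply: derivable_within_continuous => s; rewrite in_itv/= => /sI /Df sD.
  exact: ex_derive.
have [c cI e] := MVT_segment xt D1 D2.
exists c; move: cI; rewrite in_itv/= => cI; split => //; first exact: sI.
by rewrite (min_idPl xt) (max_idPr xt).
Qed.

(** [F j] stands for the j-th derivative. The Hölder constant is normalised to 1, so that the
    constants found below depend on [k] and [al] only; functions are divided by [lam] beforehand. *)
Definition jet (k : nat) (al p q : R) (F : nat -> R -> R) :=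
  (forall j t, (j < k)%N -> t \in `[p, q] -> is_derive t 1 (F j) (F j.+1 t)) /\
  (forall s t, s \in `[p, q] -> t \in `[p, q] ->
     `|F k s - F k t| <= `|s - t| `^ al).

Lemma jetS k al p q F : jet k.+1 al p q F -> jet k al p q (fun j => F j.+1).
Proof. by move=> [h1 h2]; split => [j t jk|]; [exact: h1|exact: h2]. Qed.

Lemma jet_shift i k al p q F : jet (i + k)%N al p q F -> jet k al p q (fun j => F (i + j)%N).
Proof.
elim: i F => [//|i IH] F /jetS /IH [h1 h2]; split => [j t jk tI|s t sI tI] /=.
  by rewrite !addSn; exact: h1.
by rewrite addSn; exact: h2.
Qed.

Lemma jet_sub k al p q p' q' F : p <= p' -> q' <= q -> jet k al p q F -> jet k al p' q' F.
Proof.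
move=> pp qq [h1 h2]; have sub t : t \in `[p', q'] -> t \in `[p, q].
  by rewrite !in_itv/= => /andP[a b]; rewrite (le_trans pp a) (le_trans b qq).
by split => [j t jk /sub|s t /sub sI /sub tI]; [exact: h1|exact: h2].
Qed.

Lemma jet_continuous k al p q F j : 0 < al -> jet k al p q F -> (j <= k)%N ->
  {within `[p, q], continuous (F j)}.
Proof.
move=> al0 [h1 h2]; rewrite leq_eqVlt => /orP[/eqP ->|jk].
  apply/subspace_continuousP => x xI; apply/cvgrPdist_lt => e e0.
  rewrite near_withinE; near=> s => sI.
  apply: le_lt_trans (h2 _ _ xI sI) _.
  have -> : e = (e `^ al^-1) `^ al by rewrite -powRrM mulVf ?gt_eqF// powRr1// ltW.
  apply: gt0_ltr_powR => //; rewrite ?nnegrE ?powR_ge0//.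
  near: s; apply: (@nbhsx_ballx _ _ x (e `^ al^-1)); exact: powR_gt0.
apply: derivable_within_continuous => s sI; have sD := h1 _ _ jk sI.
exact: ex_derive.
Unshelve. all: by end_near. Qed.

Definition tpoly F (x : R) (k : nat) : {poly R} := \poly_(l < k.+1) (F l x / l`!%:R).

Lemma size_tpoly F x k : (size (tpoly F x k) <= k.+1)%N.
Proof. exact: size_poly. Qed.

Lemma tpoly0 F x k : (tpoly F x k).[0] = F 0 x.
Proof. by rewrite horner_coef0 coef_poly/= fact0 divr1. Qed.

Lemma is_derive_tpoly F x k t :
  is_derive t 1 (fun s => (tpoly F x k.+1).[s - x])
                (tpoly (fun j => F j.+1) x k).[t - x].
Proof.
have -> : (fun s => (tpoly F x k.+1).[s - x]) = horner (tpoly F x k.+1 \Po ('X - x%:P)).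
  by apply/funext => s; rewrite horner_comp !hornerE.
apply: is_derive_eq; rewrite deriv_comp derivB derivX derivC subr0 mulr1.
rewrite horner_comp !hornerE; congr horner.
apply/polyP => i; rewrite coef_deriv !coef_poly ltnS.
case: ifP => // _; last by rewrite mul0rn.
rewrite factS natrM -mulr_natr; field.
by rewrite nat1r !pnatr_eq0 -!lt0n fact_gt0.
Qed.

(** Induction on [k]: the remainder vanishes at [x] and its derivative is the remainder of the
    shifted jet, so the mean value theorem gains one factor |t - x| and keeps the constant 1. *)
Lemma jet_taylor k al p q F x t : 0 < al -> jet k al p q F ->
  x \in `[p, q] -> t \in `[p, q] ->
  `|F 0 t - (tpoly F x k).[t - x]| <= `|t - x| `^ (k%:R + al).
Proof.
move=> al0; elim: k F t => [|k IH] F t jF xI tI.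
  rewrite horner_poly big_ord_recl big_ord0/= expr0 mulr1 divr1 addr0 add0r.
  exact: jF.2.
have D s : s \in `[p, q] -> is_derive s 1 (fun t => F 0 t - (tpoly F x k.+1).[t - x])
    (F 1 s - (tpoly (fun j => F j.+1) x k).[s - x]).
  move=> sI; apply: is_deriveB; first exact: jF.1.
  exact: is_derive_tpoly.
have [c [cI cb e]] := mvt_between D xI tI.
move: e; rewrite subrr tpoly0 subrr subr0 => ->; rewrite normrM.
have -> : `|t - x| `^ (k.+1%:R + al) = `|t - x| `^ (k%:R + al) * `|t - x|.
  rewrite -natr1 -addrA (addrC 1) addrA powRD ?powRr1//.
  apply/implyP => /eqP h; exfalso; have : 0 <= k%:R :> R by [].
  by lra.
apply: ler_wpM2r => //.
apply: (le_trans (IH _ _ (jetS jF) xI cI)).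
rewrite ge0_ler_powR ?nnegrE ?addr_ge0 ?(ltW al0)//.
case: (leP x t) cb => xt /andP[c1 c2].
  by rewrite !ger0_norm ?subr_ge0// lerB.
by rewrite !ler0_norm ?subr_le0 ?(ltW xt)// lerN2 lerB.
Qed.

End real_jets.

(** * Lower bounds for a function with a large derivative of order j *)

Section lower_bound.
Context {R : realType}.
Implicit Types (p q s t x : R) (F : nat -> R -> R).

Lemma seq_argmin (f : R -> R) (s : seq R) x : x \in s ->
  exists2 y, y \in s & forall z, z \in s -> f y <= f z.
Proof.
elim: s x => // a s IH x _; case: s IH => [_|b s IH].
  by exists a; rewrite ?mem_head// => z; rewrite inE => /eqP ->.
have [y ys h] := IH b (mem_head _ _).
case: (leP (f a) (f y)) => ay.
  exists a; rewrite ?mem_head// => z; rewrite inE => /predU1P[->//|/h].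
  exact: le_trans.
exists y; first by rewrite inE ys orbT.
by move=> z; rewrite inE => /predU1P[->|/h//]; rewrite ltW.
Qed.

(** A strict change of sign would produce a zero inside ]u, v[. The inequality is weak because [a]
    and [b] may be endpoints, where [g] is allowed to vanish. *)
Lemma same_sign_between (g : R -> R) p q u v a b :
  {within `[p, q], continuous g} -> u \in `[p, q] -> v \in `[p, q] ->
  (forall s, u < s < v -> g s != 0) ->
  u <= a <= v -> u <= b <= v -> 0 <= g a * g b.
Proof.
wlog ab : a b / a <= b.
  move=> h cg uI vI g0 ua ub; case/orP: (le_total a b) => ab; first exact: h.
  by rewrite mulrC; apply: h.
move=> cg uI vI g0 /andP[ua av] /andP[ub bv].
rewrite leNgt; apply/negP => gab.
have cab : {within `[a, b], continuous g}.
  apply: continuous_subspaceW cg => s /=; rewrite !in_itv/= => /andP[s1 s2].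
  move: uI vI; rewrite !in_itv/= => /andP[pu _] /andP[_ vq].
  by rewrite (le_trans pu (le_trans ua s1)) (le_trans s2 (le_trans bv vq)).
have [|c cI gc] := @IVT _ g a b 0 ab cab.
  by case: (leP (g a) (g b)) => h; nra.
have ca : c != a by apply/eqP => e; move: gab; rewrite -e gc mul0r ltxx.
have cb : c != b by apply/eqP => e; move: gab; rewrite -e gc mulr0 ltxx.
move: cI; rewrite in_itv/= !le_eqVlt (eq_sym a) (negPf ca) (negPf cb)/= => /andP[ac cb'].
by have := g0 c; rewrite gc eqxx (le_lt_trans ua ac) (lt_le_trans cb' bv) => /(_ isT).
Qed.

Lemma itv_convex u v t z (th : R) : u <= t <= v -> u <= z <= v -> 0 <= th <= 1 ->
  u <= t + th * (z - t) <= v.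
Proof.
move=> /andP[h1 h2] /andP[h3 h4] /andP[h5 h6].
rewrite (_ : t + _ = (1 - th) * t + th * z); last by ring.
apply/andP; split.
  rewrite (_ : u = (1 - th) * u + th * u); last by ring.
  by rewrite lerD ?ler_wpM2l ?subr_ge0.
rewrite (_ : v = (1 - th) * v + th * v); last by ring.
by rewrite lerD ?ler_wpM2l ?subr_ge0.
Qed.

Lemma between_itv u v a b x : u <= a <= v -> u <= b <= v ->
  Num.min a b <= x <= Num.max a b -> u <= x <= v.
Proof.
move=> /andP[h1 h2] /andP[h3 h4]; rewrite ge_min le_max.
by move=> /andP[/orP[h5|h5] /orP[h6|h6]];
  rewrite (le_trans _ h5)// (le_trans h6).
Qed.

(* Near a point where |F j| >= mu, the function F 0 behaves at worst like a
   polynomial of degree j with j simple real roots. *)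
Lemma root_distance_lower_bound (j : nat) : exists (n : nat) (c : R), 0 < c /\
  forall p q mu F, p <= q -> 0 < mu ->
    (forall i t, (i < j)%N -> t \in `[p, q] -> is_derive t 1 (F i) (F i.+1 t)) ->
    {within `[p, q], continuous (F j)} ->
    (forall t, t \in `[p, q] -> mu <= `|F j t|) ->
  exists T : seq R, (size T <= n)%N /\
    forall t, t \in `[p, q] -> exists2 r, r \in T & c * mu * `|t - r| ^+ j <= `|F 0 t|.
Proof.
elim: j => [|j [n [c [c0 IH]]]].
  exists 1%N, 1; split => // p q mu F pq mu0 _ _ Fmu.
  exists [:: p]; split => // t /Fmu h; exists p; first exact: mem_head.
  by rewrite expr0 mul1r mulr1.
(* At most n + 2 cut points and one further point for each pair of them. In the constant, one 2
   comes from |F 0 t - F 0 z0| <= 2 |F 0 t| and j + 1 of them from replacing d by d / 2. *)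
exists (n.+2 + n.+2 * n.+2)%N, (c / 2 ^+ j.+2).
split; first by rewrite divr_gt0.
move=> p q mu F pq mu0 dF cF Fmu.
have cFi i : (i <= j.+1)%N -> {within `[p, q], continuous (F i)}.
  rewrite leq_eqVlt => /predU1P[->//|ij]; apply: derivable_within_continuous => s sI.
  by have sD := dF _ _ ij sI; exact: ex_derive.
have [T' [T'n T'P]] := IH p q mu (fun i => F i.+1) pq mu0
  (fun i t ij tI => dF i.+1 t ij tI) cF Fmu.
pose S := p :: q :: T'.
have zP (uv : R * R) : exists z, (p <= uv.1 -> uv.1 <= uv.2 -> uv.2 <= q ->
    uv.1 <= z <= uv.2 /\ forall t, uv.1 <= t <= uv.2 -> `|F 0 z| <= `|F 0 t|).
  case: uv => u v /=.
  have [/and3P[pu uv vq]|n1] := boolP [&& p <= u, u <= v & v <= q]; last first.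
    by exists 0 => h1 h2 h3; move: n1; rewrite h1 h2 h3.
  have cn : {within `[u, v], continuous (fun t => `|F 0 t|)}.
    move=> x; apply: continuous_comp; last exact: norm_continuous.
    apply: continuous_subspaceW (cFi 0%N isT) _ => s /=; rewrite !in_itv/= => /andP[s1 s2].
    by rewrite (le_trans pu s1) (le_trans s2 vq).
  have [z zI zmin] := EVT_min uv cn.
  by exists z => _ _ _; move: zI; rewrite in_itv/=; split.
have [z zminP] := choice zP.
exists (S ++ [seq z (u, v) | u <- S, v <- S]); split.
  rewrite size_cat size_allpairs /S /=.
  by rewrite leq_add// leq_mul.
move=> t tI.
set T := S ++ _.
have pT : p \in T by rewrite mem_cat mem_head.
have [r rT rmin] := @seq_argmin (fun r => `|t - r|) T p pT.
exists r => //; set d := `|t - r|.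
have [d0|dn0] := eqVneq d 0.
  by rewrite d0 expr0n/= mulr0.
have d0 : 0 < d by rewrite lt_def dn0 normr_ge0.
have nT s : s \in T -> s != t.
  by move=> /rmin h; apply/eqP => e; move: h; rewrite e subrr normr0 leNgt d0.
have ST s : s \in S -> s \in T by rewrite mem_cat => ->.
have [p_t q_t] : p < t /\ t < q.
  move: tI; rewrite in_itv/= !le_eqVlt => /andP[/predU1P[e|->] /predU1P[e'|->]] //;
    [have := nT p pT | have := nT p pT | have := nT q (ST q _)]; rewrite ?e ?e' ?eqxx//;
    by rewrite !inE ?eqxx ?orbT => /(_ isT).
have [u uS' umax] : exists2 u, u \in [seq s <- S | s < t] &
    forall s, s \in [seq s <- S | s < t] -> - u <= - s.
  by apply: (@seq_argmin (fun s => - s) _ p); rewrite mem_filter p_t mem_head.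
have [v vS' vmin] : exists2 v, v \in [seq s <- S | t < s] &
    forall s, s \in [seq s <- S | t < s] -> v <= s.
  by apply: (@seq_argmin id _ q); rewrite mem_filter q_t !inE eqxx orbT.
move: uS' vS'; rewrite !mem_filter => /andP[ut uS] /andP[tv vS].
have pu : p <= u.
  by rewrite -lerN2 umax ?mem_filter ?p_t ?mem_head//.
have vq : v <= q.
  by rewrite vmin ?mem_filter ?q_t ?inE ?eqxx ?orbT.
have uv : u <= v by exact/ltW/(lt_trans ut tv).
have F1nz s : u < s < v -> F 1 s != 0.
  move=> /andP[us sv].
  have sI : s \in `[p, q] by rewrite in_itv/= (le_trans pu (ltW us)) (le_trans (ltW sv) vq).
  have [r' r'T' h] := T'P s sI.
  have sr : s != r'.
    apply/eqP => e; have r'S : r' \in S by rewrite !inE r'T' !orbT.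
    have : r' != t by exact/nT/ST.
    rewrite neq_lt -e => /orP[st|ts].
      by have := umax s; rewrite mem_filter st e r'S => /(_ isT); rewrite -e lerN2 leNgt us.
    by have := vmin s; rewrite mem_filter ts e r'S => /(_ isT); rewrite -e leNgt sv.
  rewrite -normr_gt0; apply: lt_le_trans h.
  by rewrite !mulr_gt0// exprn_gt0// normr_gt0 subr_eq0.
have [/= zI zmin] := zminP (u, v) pu uv vq.
set z0 := z (u, v) in zI zmin.
have zT : z0 \in T by rewrite mem_cat; apply/orP; right; apply/allpairsP; exists (u, v).
have dz : d <= `|t - z0| by exact: rmin.
have tz0 : 0 < `|t - z0| by exact: lt_le_trans dz.
pose th := d / (2 * `|t - z0|).
have th0 : 0 < th by rewrite divr_gt0// mulr_gt0.
have th1 : th <= 1 / 2.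
  by rewrite /th ler_pdivrMr ?mulr_gt0//; move: dz; clear; lra.
have [uzt uzv] := andP zI.
have utv : u <= t <= v by rewrite !ltW.
(* The point at distance d / 2 from [t] towards the minimiser. By monotonicity |F 0 t - F 0 w| <= |F
   0 t - F 0 z0|, while the mean value point [x1] between [w] and [t] keeps a distance of at least d
   / 2 from [T'], where the induction hypothesis applies to [F 1]. *)
pose w := t + th * (z0 - t).
have wI : u <= w <= v.
  by apply: itv_convex => //; rewrite (ltW th0)/=; move: th1; clear; lra.
have tw : t - w = th * (t - z0) by rewrite /w; ring.
have wz : w - z0 = (1 - th) * (t - z0) by rewrite /w; ring.
have uvI s : u <= s <= v -> s \in `[p, q].
  by move=> /andP[us sv]; rewrite in_itv/= (le_trans pu us) (le_trans sv vq).
have [x1 [_ x1b e1]] := mvt_between (fun s sI => dF 0%N s isT sI) (uvI _ wI) (uvI _ utv).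
have [x2 [_ x2b e2]] := mvt_between (fun s sI => dF 0%N s isT sI) (uvI _ zI) (uvI _ wI).
have x1I : u <= x1 <= v.
  exact: between_itv x1b.
have x2I : u <= x2 <= v.
  exact: between_itv x2b.
have ss := same_sign_between (cFi 1%N isT) (uvI _ (_ : u <= u <= v)) (uvI _ (_ : u <= v <= v))
  F1nz x1I x2I.
have {}ss : 0 <= F 1 x1 * F 1 x2 by apply: ss; rewrite ?lexx ?uv.
have dth : d / 2 = th * `|t - z0| by rewrite /th; field; rewrite gt_eqF.
have F0t : d / 2 * `|F 1 x1| <= 2 * `|F 0 t|.
  have -> : d / 2 * `|F 1 x1| = `|F 0 t - F 0 w|.
    rewrite e1 normrM dth [RHS]mulrC; congr (_ * _).
    by rewrite tw normrM gtr0_norm.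
  apply: (@le_trans _ _ `|F 0 t - F 0 z0|); last first.
    by rewrite mulr2n mulrDl mul1r (le_trans (ler_normB _ _))// lerD2l zmin.
  rewrite -[F 0 t - F 0 z0](subrKA (F 0 w)).
  have AB : 0 <= (F 0 t - F 0 w) * (F 0 w - F 0 z0).
    rewrite e1 e2 tw wz.
    rewrite (_ : _ * _ = (F 1 x1 * F 1 x2) * ((th * (1 - th)) * (t - z0) ^+ 2)); last by ring.
    by rewrite mulr_ge0// mulr_ge0 ?sqr_ge0// mulr_ge0 ?(ltW th0)// subr_ge0; move: th1; clear; lra.
  rewrite -ler_sqr ?nnegrE// !real_normK ?num_real//.
  by rewrite [leRHS]sqrrD -addrA lerDl addr_ge0 ?sqr_ge0// mulrn_wge0.
have [r' r'T' h] := T'P x1 (uvI _ x1I).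
have dr' : d <= `|t - r'| by apply: rmin; apply: ST; rewrite !inE r'T' !orbT.
have dx1 : d / 2 <= `|x1 - r'|.
  have : `|t - x1| <= d / 2.
    rewrite dth (_ : th * _ = `|t - w|); last first.
      by rewrite tw normrM gtr0_norm.
    case: (leP w t) x1b => wt /andP[h1 h2].
      by rewrite !ger0_norm ?subr_ge0// lerB.
    by rewrite !ler0_norm ?subr_le0 ?(ltW wt)// lerN2 lerB.
  have := ler_distD x1 t r'.
  by move: dr'; clear; lra.
have cmd : c * mu * (d / 2) ^+ j <= `|F 1 x1|.
  apply: le_trans h; apply: ler_wpM2l; first by rewrite mulr_ge0// ltW.
  by rewrite lerXn2r ?nnegrE ?divr_ge0// ltW.
have -> : c / 2 ^+ j.+2 * mu * d ^+ j.+1 = (c * mu * (d / 2) ^+ j) * (d / 2) / 2.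
  rewrite expr_div_n !exprS; field; by rewrite expf_neq0.
rewrite ler_pdivrMr// [leRHS]mulrC; apply: le_trans F0t.
by rewrite mulrC ler_wpM2l// divr_ge0// ltW.
Qed.

End lower_bound.

(** * Integrals of negative powers of |t - t0| *)

Section negative_powers.
Context {R : realType}.
Local Notation mu := (@lebesgue_measure R).
Implicit Types (p q s t x g d L : R).

Lemma lebesgue_pushforward (f : R -> R) : measurable_fun setT f ->
  (forall a b, a <= b -> lebesgue_measure (f @^-1` `]a, b]) = (b - a)%:E) ->
  forall A, measurable A -> mu (f @^-1` A) = mu A.
Proof.
move=> mf fE A mA.
pose mfun : {mfun measurableTypeR R >-> measurableTypeR R} :=
  HB.pack f (isMeasurableFun.Build _ _ (measurableTypeR R) (measurableTypeR R) f mf).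
have -> : mu (f @^-1` A) = pushforward mu mfun A by [].
apply/esym/lebesgue_measure_unique => // _ [[a b] _ <-] /=.
rewrite /pushforward/=.
have [ab|ba] := leP a b; last first.
  by rewrite set_itv_ge ?preimage_set0 ?measure0// bnd_simp -leNgt ltW.
by rewrite fE// lebesgue_measure_itv/= lte_fin; case: ltgtP ab => // -> _; rewrite subrr.
Qed.

Lemma ge0_integral_lebesgue_map (f : R -> R) (h : R -> \bar R) : measurable_fun setT f ->
  (forall a b, a <= b -> lebesgue_measure (f @^-1` `]a, b]) = (b - a)%:E) ->
  measurable_fun setT h -> (forall x, 0 <= h x)%E ->
  (\int[mu]_x h (f x) = \int[mu]_x h x)%E.
Proof.
move=> mf fE mh h0.
pose mfun : {mfun measurableTypeR R >-> measurableTypeR R} :=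
  HB.pack f (isMeasurableFun.Build _ _ (measurableTypeR R) (measurableTypeR R) f mf).
transitivity (\int[pushforward mu mfun]_x h x)%E.
  by rewrite ge0_integral_pushforward// => x _; exact: h0.
by apply: eq_measure_integral => A mA _; exact: (lebesgue_pushforward mf fE).
Qed.

Lemma ge0_integral_shift (h : R -> \bar R) c : measurable_fun setT h ->
  (forall x, 0 <= h x)%E -> (\int[mu]_x h (x + c)%R = \int[mu]_x h x)%E.
Proof.
move=> mh h0; apply: (@ge0_integral_lebesgue_map (fun x => x + c)) => //.
  exact: measurable_funD.
move=> a b ab; rewrite (_ : _ @^-1` _ = `]a - c, b - c]%classic).
  rewrite lebesgue_measure_itv/= lte_fin ltrD2r; case: ltgtP ab => // [ab _|-> _].
    by rewrite -EFinD; congr EFin; ring.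
  by rewrite subrr.
by apply/seteqP; split => x /=; rewrite !in_itv/= lerBrDr ltrBlDr.
Qed.

Lemma ge0_integral_opp (h : R -> \bar R) : measurable_fun setT h ->
  (forall x, 0 <= h x)%E -> (\int[mu]_x h (- x)%R = \int[mu]_x h x)%E.
Proof.
move=> mh h0; apply: (@ge0_integral_lebesgue_map -%R) => //.
move=> a b ab; rewrite (_ : _ @^-1` _ = `[- b, - a[%classic).
  rewrite lebesgue_measure_itv/= lte_fin ltrN2; case: ltgtP ab => // [ab _|-> _].
    by rewrite -EFinD opprK addrC.
  by rewrite subrr.
by apply/seteqP; split => x /=; rewrite !in_itv/= lerNl ltrNr andbC.
Qed.

(** |u|^(-d) with the value +oo at u = 0, where [powR] would give 0 for d != 0; the same convention
    as in [dual_weight]. *)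
Definition inv_pow d (u : R) : \bar R :=
  if u == 0 then +oo%E else (`|u| `^ (- d))%:E.

Lemma inv_pow_ge0 d u : (0 <= inv_pow d u)%E.
Proof. by rewrite /inv_pow; case: ifP => // _; rewrite lee_fin powR_ge0. Qed.

Lemma measurable_inv_pow d : measurable_fun setT (inv_pow d).
Proof.
apply: measurable_fun_ifT => //.
  exact: measurable_fun_eqr.
rewrite (_ : (fun u => _) = EFin \o ((@powR R)^~ (- d) \o Num.norm))//.
apply/measurable_EFinP.
exact: (measurableT_comp (measurable_powR _)).
Qed.

Lemma inv_pow_le d u v : 0 <= d -> `|u| <= `|v| -> (inv_pow d v <= inv_pow d u)%E.
Proof.
move=> d0 uv; rewrite /inv_pow; have [_|u0] := eqVneq u 0; first by rewrite leey.
have [v0|v0] := eqVneq v 0.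
  by move: uv; rewrite v0 normr0 normr_le0 (negPf u0).
rewrite lee_fin !powRN lef_pV2 ?posrE ?powR_gt0 ?normr_gt0//.
by apply: ge0_ler_powR; rewrite ?nnegrE.
Qed.

Lemma integral_inv_pow0 g L : 0 <= g -> g < 1 -> 0 < L ->
  (\int[mu]_(t in `[0%R, L]) inv_pow g t <= (L `^ (1 - g) / (1 - g))%:E)%E.
Proof.
move=> g0 g1 L0.
have m A : measurable_fun A (inv_pow g) by exact: measurable_funTS (measurable_inv_pow _).
rewrite -integral_itv_obnd_cbnd//.
(* The exhaustion stays away from the singularity, so the fundamental theorem of calculus applies on
   each interval; [n.+2] keeps even the first one nondegenerate. *)
have -> : [set` `]0, L]] = \bigcup_n (`[L / n.+2%:R, L]%classic).
  apply/seteqP; split => x /=; rewrite in_itv/=.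
    move=> /andP[x0 xL].
    have [n] := @near_infty_natSinv_lt R (PosNum (divr_gt0 x0 L0)).
    move=> _ /(_ n.+1 (leqnSn _)) /= h; exists n => //=; rewrite in_itv/= xL andbT.
    by rewrite -[leRHS](divfK (lt0r_neq0 L0)) mulrC ler_wpM2r// ltW.
  move=> [n _] /=; rewrite in_itv/= => /andP[h ->]; rewrite andbT.
  by apply: lt_le_trans h; rewrite divr_gt0.
set F := fun n => _.
have ndF : nondecreasing_seq F.
  move=> i j ij; rewrite subsetEset => x; rewrite /F/= !in_itv/= => /andP[h ->].
  rewrite andbT; apply: le_trans h.
  by rewrite ler_pM2l// lef_pV2 ?posrE// ler_nat !ltnS.
have := @ge0_nondecreasing_set_cvg_integral _ (measurableTypeR R) R F (inv_pow g) mu ndF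
  (fun i => measurable_itv _) (fun i => m _) (fun i x _ => inv_pow_ge0 g x).
move=> /cvg_lim <-//.
apply: lime_le.
  apply: ereal_nondecreasing_is_cvgn => i j ij.
  apply: ge0_subset_integral.
  - exact: measurable_itv.
  - exact: measurable_itv.
  - exact: m.
  - by move=> x _; exact: inv_pow_ge0.
  - by rewrite -subsetEset; exact: ndF.
apply: nearW => n.
have en0 : 0 < L / n.+2%:R by rewrite divr_gt0.
have enL : L / n.+2%:R < L by rewrite ltr_pdivrMr// ltr_pMr// ltr1n.
pose G t : R := t `^ (1 - g) / (1 - g).
have g1' : 1 - g != 0 by rewrite subr_eq0 eq_sym lt_eqF.
have dG t : 0 < t -> is_derive t 1 G (t `^ (- g)).
  move=> t0; rewrite /G.
  rewrite (_ : (fun t => _) = (1 - g)^-1 \*: ((@powR R)^~ (1 - g))); last first.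
    by apply/funext => s /=; rewrite mulrC.
  have D := is_derive1_powR (1 - g) t0.
  apply: is_derive_eq; rewrite /GRing.scale/= mulrA mulVf// mul1r.
  by congr powR; ring.
have cG t : 0 < t -> {for t, continuous G}.
  move=> t0; apply/differentiable_continuous/derivable1_diffP.
  by have D := dG t t0; exact: ex_derive.
rewrite (_ : integral _ _ _ = (\int[mu]_(t in F n) (t `^ (- g))%:E)%E); last first.
  apply: eq_integral => t; rewrite inE /F/= in_itv/= => /andP[h _].
  have t0 : 0 < t by exact: lt_le_trans h.
  by rewrite /inv_pow gt_eqF// gtr0_norm.
rewrite (@continuous_FTC2 R _ G)//.
- by rewrite -EFinB lee_fin /G gerBl// divr_ge0 ?powR_ge0// subr_ge0 ltW.
- apply: derivable_within_continuous => t; rewrite in_itv/= => /andP[h _].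
  have D := is_derive1_powR (- g) (lt_le_trans en0 h); exact: ex_derive.
- split.
  + move=> t; rewrite in_itv/= => /andP[h _].
    have D := dG _ (lt_trans en0 h); exact: ex_derive.
  + by apply: cvg_at_right_filter; exact: cG.
  + by apply: cvg_at_left_filter; exact: cG.
- move=> t; rewrite in_itv/= => /andP[h _].
  rewrite derive1E; have D := dG _ (lt_trans en0 h); exact: derive_val.
Qed.

(** The bound is uniform in the position of the singularity. Points with |x - t0| <= q - p are
    covered by the integral over a symmetric interval around [t0], which gives 2 / (1 - g);
    elsewhere the integrand is at most (q - p)^(-g), which gives the 1. *)
Lemma integral_inv_pow g : 0 <= g -> g < 1 -> exists2 C : R, 0 < C &
  forall p q t0, p < q ->
  (\int[mu]_(t in `[p, q]) inv_pow g (t - t0)%R <= (C * (q - p) `^ (1 - g))%:E)%E.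
Proof.
move=> g0 g1; exists (2 / (1 - g) + 1).
  by rewrite addr_gt0// divr_gt0// subr_gt0.
move=> p q t0 pq; set L := q - p; have L0 : 0 < L by rewrite subr_gt0.
have m A : measurable_fun A (inv_pow g) by exact: measurable_funTS (measurable_inv_pow _).
pose h := inv_pow g \_ (`[0, L]%classic).
have h0 x : (0 <= h x)%E by rewrite /h patchE; case: ifP => // _; exact: inv_pow_ge0.
have mh : measurable_fun setT h by apply/(measurable_restrictT _ _).1 => //.
have mhN : measurable_fun setT (fun x => h (- x)) by exact: measurableT_comp.
pose k x := (h x + h (- x)%R)%E.
have mk : measurable_fun setT k by exact: emeasurable_funD.
have k0 x : (0 <= k x)%E by exact: adde_ge0.
have mks : measurable_fun setT (fun x => k (x - t0)%R).
  by apply: measurableT_comp => //; exact: measurable_funB.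
have intk : (\int[mu]_x k (x - t0)%R <= (2 / (1 - g) * L `^ (1 - g))%:E)%E.
  rewrite ge0_integral_shift// /k ge0_integralD// ge0_integral_opp//.
  rewrite /h -integral_mkcond.
  rewrite (_ : 2 / (1 - g) * _ = (L `^ (1 - g) / (1 - g)) + (L `^ (1 - g) / (1 - g))); last by ring.
  by rewrite EFinD leeD// integral_inv_pow0.
have cL : (\int[mu]_(t in `[p, q]) (L `^ (- g))%:E)%E = (L `^ (1 - g))%:E.
  rewrite integral_cst//= lebesgue_measure_itv/= lte_fin pq -EFinB -EFinM.
  by rewrite powRD ?powRr1 ?(mulrC L) ?(ltW L0)//; apply/implyP; rewrite (gt_eqF L0).
rewrite mulrDl mul1r EFinD -cL.
apply: (@le_trans _ _ (\int[mu]_(t in `[p, q]) (k (t - t0)%R + (L `^ (- g))%:E))%E).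
  apply: ge0_le_integral => //.
  - by move=> x _; exact: inv_pow_ge0.
  - apply: measurable_funTS; apply: measurableT_comp (measurable_inv_pow _) _.
    exact: measurable_funB.
  - by apply: emeasurable_funD => //; exact: measurable_funTS mks.
  move=> x _; have [xL|Lx] := leP `|x - t0| L.
    apply: (@le_trans _ _ (k (x - t0)%R)); last by rewrite leeDl// lee_fin powR_ge0.
    rewrite /k /h !patchE !mem_setE/= !in_itv/= !oppr_ge0.
    have [x0|x0] := leP 0 (x - t0).
      rewrite (le_trans (ler_norm _) xL)/= leeDl//.
      by case: ifP => // _; exact: inv_pow_ge0.
    have xL' : - (x - t0) <= L by rewrite -(ltr0_norm x0).
    by rewrite (ltW x0) xL'/= add0e /inv_pow oppr_eq0 normrN.
  apply: (@le_trans _ _ (L `^ (- g))%:E); last by rewrite leeDr.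
  rewrite /inv_pow -normr_eq0 gt_eqF ?(lt_trans L0 Lx)// lee_fin !powRN.
  rewrite lef_pV2 ?posrE ?powR_gt0 ?(lt_trans L0 Lx)//.
  by rewrite ge0_ler_powR ?nnegrE ?(ltW L0) ?(ltW Lx).
rewrite ge0_integralD//=; [|exact: measurable_funTS mks|by move=> *; rewrite lee_fin powR_ge0].
rewrite leeD2r//; apply: le_trans intk.
by apply: ge0_subset_integral.
Qed.

End negative_powers.

(** * Negative powers of a function with a large derivative of order j *)

Section sublevel.
Context {R : realType}.
Local Notation mu := (@lebesgue_measure R).
Implicit Types (p q s t x al : R) (F : nat -> R -> R).

(** Only an inequality: for j = 0 and s = 0 the left side is finite, whereas the right side is
    +oo. *)
Lemma inv_pow_monomial (d A s : R) (j : nat) : 0 < A ->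
  (inv_pow d (A * `|s| ^+ j)%R <= (A `^ (- d))%:E * inv_pow (j%:R * d)%R s)%E.
Proof.
move=> A0; have [->|s0] := eqVneq s 0.
  by rewrite [X in (_ <= _ * X)%E]/inv_pow eqxx mulry gtr0_sg ?powR_gt0// mul1e leey.
rewrite /inv_pow (negPf s0) mulf_eq0 gt_eqF//= expf_eq0 normr_eq0 (negPf s0) andbF.
rewrite -EFinM lee_fin ger0_norm ?mulr_ge0 ?exprn_ge0 ?(ltW A0)//.
rewrite powRM ?exprn_ge0 ?(ltW A0)// -powR_mulrn// -powRrM.
by rewrite mulrN.
Qed.

(** [root_distance_lower_bound] bounds the integrand by (c m)^(-d) |t - r|^(-j d) for some r of a
    finite list, integrable as j d < 1. Summing over the whole list removes the dependence of r on
    t, at the price of a factor bounded by the length. *)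
Lemma integral_inv_pow_jet (j : nat) (d : R) : 0 <= d -> j%:R * d < 1 ->
  exists2 C : R, 0 < C & forall p q m F, p < q -> 0 < m ->
    (forall i t, (i < j)%N -> t \in `[p, q] -> is_derive t 1 (F i) (F i.+1 t)) ->
    {within `[p, q], continuous (F j)} ->
    (forall t, t \in `[p, q] -> m <= `|F j t|) ->
  (\int[mu]_(t in `[p, q]) inv_pow d (F 0%N t) <=
     (C * m `^ (- d) * (q - p) `^ (1 - j%:R * d))%:E)%E.
Proof.
move=> d0 jd1.
have jd0 : 0 <= j%:R * d by rewrite mulr_ge0.
have [n [c [c0 nP]]] := @root_distance_lower_bound R j.
have [C C0 CP] := integral_inv_pow jd0 jd1.
exists (n.+1%:R * c `^ (- d) * C); first by rewrite !mulr_gt0 ?powR_gt0.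
move=> p q m F pq m0 dF cF Fm.
have [T [Tn TP]] := nP p q m F (ltW pq) m0 dF cF Fm.
have cF0 : {within `[p, q], continuous (F 0%N)}.
  case: j dF {cF Fm jd1 jd0 CP nP TP} (cF) => // j dF _; apply: derivable_within_continuous => s sI.
  by have sD := dF 0%N _ isT sI; exact: ex_derive.
have mF0 : measurable_fun `[p, q] (fun t => inv_pow d (F 0%N t)).
  apply: (measurableT_comp (measurable_inv_pow d)).
  by apply: subspace_continuous_measurable_fun.
have mi r : measurable_fun `[p, q] (fun t => inv_pow (j%:R * d) (t - r)).
  apply: measurable_funTS; apply: measurableT_comp (measurable_inv_pow _) _.
  exact: measurable_funB.
pose cm := (c * m) `^ (- d).
apply: (@le_trans _ _
  (\int[mu]_(t in `[p, q]) \sum_(r <- T) (cm%:E * inv_pow (j%:R * d) (t - r)%R))%E).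
  apply: ge0_le_integral => //.
  - by move=> x _; exact: inv_pow_ge0.
  - apply: emeasurable_sum => r; apply: measurable_funeM; exact: mi.
  - move=> x xI; have [r rT h] := TP x xI.
    apply: (@le_trans _ _ (cm%:E * inv_pow (j%:R * d) (x - r)%R)%E).
      apply: le_trans (inv_pow_monomial _ _ _ (mulr_gt0 c0 m0)).
      apply: inv_pow_le => //.
      by rewrite [leLHS]ger0_norm// !mulr_ge0 ?exprn_ge0 ?(ltW c0) ?(ltW m0).
    rewrite (big_rem r)//= leeDl// sume_ge0// => r' _.
    by rewrite mule_ge0 ?inv_pow_ge0// lee_fin powR_ge0.
rewrite ge0_integral_sum//; last 2 first.
- by move=> r; apply: measurable_funeM; exact: mi.
- by move=> r x _; rewrite mule_ge0 ?inv_pow_ge0// lee_fin powR_ge0.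
apply: (@le_trans _ _ (\sum_(r <- T) (cm * (C * (q - p) `^ (1 - j%:R * d)))%:E)%E).
  apply: lee_sum => r _.
  rewrite ge0_integralZl_EFin ?powR_ge0//; [|by move=> x _; exact: inv_pow_ge0|exact: mi].
  by rewrite EFinM lee_wpmul2l ?CP// lee_fin powR_ge0.
rewrite sumEFin lee_fin big_const_seq count_predT iter_addr_0.
rewrite /cm powRM ?(ltW c0) ?(ltW m0)// -[leLHS]mulr_natr.
pose X := c `^ (- d) * C * m `^ (- d) * (q - p) `^ (1 - j%:R * d).
rewrite [leLHS](_ : _ = X * (size T)%:R); last by rewrite /X; ring.
rewrite [leRHS](_ : _ = X * n.+1%:R); last by rewrite /X; ring.
by rewrite ler_wpM2l ?ler_nat ?(leq_trans Tn)// !mulr_ge0 ?powR_ge0// ltW.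
Qed.

End sublevel.

(** * Real powers *)

Section powers.
Context {R : realType}.
Implicit Types (u s e : R).

Lemma powR_inv_le u s e : 0 < e -> 0 <= u -> 0 <= s ->
  (u `^ e^-1 <= s) = (u <= s `^ e).
Proof.
move=> e0 u0 s0; have uE : u = (u `^ e^-1) `^ e by rewrite -powRrM mulVf ?gt_eqF// powRr1.
apply/idP/idP => h; first by rewrite uE ge0_ler_powR ?nnegrE ?powR_ge0// ltW.
rewrite leNgt; apply/negP => h'; move: h; rewrite leNgt => /negP; apply.
by rewrite [ltRHS]uE gt0_ltr_powR ?nnegrE ?powR_ge0.
Qed.

Lemma powR_inv_ge u s e : 0 < e -> 0 <= u -> 0 <= s ->
  (s <= u `^ e^-1) = (s `^ e <= u).
Proof.
move=> e0 u0 s0; have sE : s = (s `^ e) `^ e^-1 by rewrite -powRrM mulfV ?gt_eqF// powRr1.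
apply/idP/idP => h; last first.
  by rewrite sE ge0_ler_powR ?nnegrE ?powR_ge0// invr_ge0 ltW.
rewrite leNgt; apply/negP => h'; move: h; rewrite leNgt => /negP; apply.
by rewrite [ltRHS]sE gt0_ltr_powR ?nnegrE ?powR_ge0// invr_gt0.
Qed.

Lemma powRV u e : 0 <= u -> u^-1 `^ e = (u `^ e)^-1.
Proof. by move=> u0; rewrite -powR_inv1// -powRrM mulN1r powRN. Qed.

Lemma ler_powR_le1 u s e : 0 <= u -> u <= 1 -> 0 <= s -> s <= e -> u `^ e <= u `^ s.
Proof.
move=> u0 u1 s0 se; have [->|un0] := eqVneq u 0; last first.
  by rewrite ger_powR// lt_def un0 u0.
have [->|sn0] := eqVneq s 0.
  by rewrite powRr0; have [->|en0] := eqVneq e 0; rewrite ?powRr0 ?powR0.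
rewrite !powR0//; apply: contra sn0 => /eqP e0.
by rewrite eq_le s0 -e0 se.
Qed.

End powers.

(** * The scale of a jet and its local comparability *)

Section jet_scale.
Context {R : realType}.
Implicit Types (p q s t x al : R) (F : nat -> R -> R).

(* The scale rho at which the jet of order k of F, which is C^(k,al), becomes
   visible: |F j| <= rho^(k+al-j) for all j, with equality for some j up to a constant. *)
Definition jet_scale (k : nat) al F t : R :=
  \sum_(j < k.+1) `|F j t| `^ (k%:R + al - j%:R)^-1.

Lemma jet_scale_ge0 k al F t : 0 <= jet_scale k al F t.
Proof. by apply: sumr_ge0 => j _; exact: powR_ge0. Qed.

Lemma expo_ge k al j : (j <= k)%N -> al <= k%:R + al - j%:R.
Proof. by move=> jk; rewrite addrAC lerDr subr_ge0 ler_nat. Qed.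

Lemma expo_gt0 k al j : 0 < al -> (j <= k)%N -> 0 < k%:R + al - j%:R.
Proof. by move=> al0 jk; apply: lt_le_trans al0 (expo_ge _ jk). Qed.

Lemma jet_le_scale k al F t j : 0 < al -> (j <= k)%N ->
  `|F j t| <= jet_scale k al F t `^ (k%:R + al - j%:R).
Proof.
move=> al0 jk; rewrite -powR_inv_le ?jet_scale_ge0 ?expo_gt0//.
rewrite /jet_scale (bigD1 (Ordinal (jk : (j < k.+1)%N)))//= lerDl.
by apply: sumr_ge0 => i _; exact: powR_ge0.
Qed.

(** The exponents 1 / (k + al - j) are at most 1 / al, so each term pays at most A^(1/al) for the
    factor A >= 1. *)
Lemma jet_scale_le k al F t (A s : R) : 0 < al -> 1 <= A -> 0 <= s ->
  (forall j, (j <= k)%N -> `|F j t| <= A * s `^ (k%:R + al - j%:R)) ->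
  jet_scale k al F t <= k.+1%:R * A `^ al^-1 * s.
Proof.
move=> al0 A1 s0 h.
have A0 : 0 <= A by exact: le_trans A1.
apply: (@le_trans _ _ (\sum_(j < k.+1) (A `^ al^-1 * s))); last first.
  by rewrite sumr_const card_ord -[leLHS]mulr_natr mulrC mulrA.
apply: ler_sum => j _; have jk : (j <= k)%N by rewrite -ltnS.
have e0 := expo_gt0 al0 jk.
rewrite powR_inv_le ?mulr_ge0 ?powR_ge0//.
rewrite powRM ?powR_ge0// -powRrM.
apply: (le_trans (h j jk)); rewrite ler_wpM2r ?powR_ge0//.
rewrite -[leLHS]powRr1// ler_powR// ler_pdivlMl// mulr1.
exact: expo_ge.
Qed.

(** Pigeonhole: one of the [k.+1] terms is at least their mean. *)
Lemma jet_scale_witness k al F t : 0 < al -> exists2 j, (j <= k)%N &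
  (jet_scale k al F t / k.+1%:R) `^ (k%:R + al - j%:R) <= `|F j t|.
Proof.
move=> al0.
have [[j jk] /= h] : exists j : 'I_k.+1, jet_scale k al F t / k.+1%:R <=
    `|F j t| `^ (k%:R + al - j%:R)^-1.
  apply/existsP; apply: contraT; rewrite negb_exists => /forallP h.
  have : jet_scale k al F t < \sum_(j < k.+1) (jet_scale k al F t / k.+1%:R).
    apply: ltr_sum => [|j _]; last by rewrite ltNge; exact: h.
    by apply/hasP; exists ord0; rewrite ?mem_index_enum.
  by rewrite sumr_const card_ord -[X in _ < X]mulr_natr divfK ?pnatr_eq0// ltxx.
exists j; first by rewrite -ltnS.
by rewrite -powR_inv_ge ?expo_gt0 ?divr_ge0 ?jet_scale_ge0.
Qed.

Section local.
Variables (k : nat) (al : R).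
Hypotheses (al0 : 0 < al) (al1 : al <= 1).
Let K : R := k.+1%:R.
Let kap : R := k%:R + al.
(** [jet_scale_witness] yields a derivative of size at least K^(-kap) r^(kap - j) = 2 c1 r^(kap -
    j), so an error of c1 r^(kap - j) leaves half of it. [c0] solves c0^al = c1 / K: the Taylor
    terms and the remainder, at most K of them, each get a share c1 / K. *)
Let c1 : R := K `^ (- kap) / 2.
Let c0 : R := (c1 / K) `^ al^-1.

Let K1 : 1 <= K. Proof. by rewrite /K ler1n. Qed.
Let K0 : 0 < K. Proof. exact: lt_le_trans K1. Qed.
Let c1_gt0 : 0 < c1. Proof. by rewrite /c1 divr_gt0// powR_gt0. Qed.
Let kap_gt0 : 0 < kap. Proof. by rewrite /kap ltr_wpDl. Qed.

Let c1_le1 : c1 <= 1.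
Proof.
rewrite /c1 ler_pdivrMr// mul1r powRN (@le_trans _ _ 1) ?ler1n//.
rewrite invf_le1 ?powR_gt0// -[leLHS](powRr0 K).
by apply: ler_powR => //; exact: ltW.
Qed.

Let c0_gt0 : 0 < c0. Proof. by rewrite powR_gt0// divr_gt0. Qed.

Let c0_le1 : c0 <= 1.
Proof.
rewrite /c0 powR_inv_le ?powR1 ?divr_ge0 ?powR_ge0 ?(ltW K0)//.
by rewrite ler_pdivrMr// mul1r (le_trans c1_le1).
Qed.

(** Taylor expansion of [F j] at [x]: the term of order l >= 1 is at most r^(kap - j - l) (c0 r)^l
    <= c0^al r^(kap - j), because c0 <= 1 and al <= 1 <= l. The remainder satisfies the same bound
    since kap - j >= al. *)
Lemma jet_close p q F x t j : jet k al p q F -> x \in `[p, q] -> t \in `[p, q] ->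
  `|t - x| <= c0 * jet_scale k al F x -> (j <= k)%N ->
  `|F j t - F j x| <= c1 * jet_scale k al F x `^ (kap - j%:R).
Proof.
move=> jF xI tI; set r := jet_scale k al F x => tx jk.
have r0 : 0 <= r by exact: jet_scale_ge0.
have jF' : jet (k - j) al p q (fun i => F (j + i)%N).
  by apply: jet_shift; rewrite subnKC.
have := jet_taylor al0 jF' xI tI; rewrite addn0.
set T := tpoly _ _ _ => h.
have eE : (k - j)%:R + al = kap - j%:R :> R by rewrite natrB// /kap; ring.
rewrite eE in h.
have e0 : al <= kap - j%:R by exact: expo_ge.
have c0al : c0 `^ al = c1 / K.
  by rewrite /c0 -powRrM mulVf ?gt_eqF// powRr1// divr_ge0 ?ltW.
have rem : `|t - x| `^ (kap - j%:R) <= c1 / K * r `^ (kap - j%:R).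
  apply: (@le_trans _ _ ((c0 * r) `^ (kap - j%:R))).
    by rewrite ge0_ler_powR ?nnegrE ?mulr_ge0 ?(ltW c0_gt0)// (le_trans _ e0)// ltW.
  rewrite powRM ?(ltW c0_gt0)// ler_wpM2r ?powR_ge0// -c0al.
  by apply: ler_powR_le1 => //; rewrite ltW.
have term (l : nat) : (l < k - j)%N ->
    `|F (j + l.+1)%N x * (t - x) ^+ l.+1 / (l.+1)`!%:R| <= c1 / K * r `^ (kap - j%:R).
  move=> lk; rewrite normrM normfV [`|_%:R|]ger0_norm//.
  have f1 : 1 <= (l.+1)`!%:R :> R by rewrite ler1n fact_gt0.
  rewrite ler_pdivrMr ?(lt_le_trans _ f1)// -[leLHS]mulr1 ler_pM// normrM normrX.
  have jlk : (j + l.+1 <= k)%N by rewrite addnS -ltn_subRL.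
  apply: (@le_trans _ _ (r `^ (k%:R + al - (j + l.+1)%:R) * (c0 * r) ^+ l.+1)).
    by rewrite ler_pM ?exprn_ge0 ?jet_le_scale// lerXn2r ?nnegrE ?mulr_ge0 ?(ltW c0_gt0).
  rewrite exprMn mulrCA; apply: ler_pM; rewrite ?exprn_ge0 ?(ltW c0_gt0)//.
  - by rewrite mulr_ge0 ?powR_ge0// exprn_ge0.
  - rewrite -c0al -powR_mulrn ?(ltW c0_gt0)//.
    apply: ler_powR_le1; rewrite ?(ltW c0_gt0) ?(ltW al0)//.
    by rewrite (le_trans al1)// ler1n.
  rewrite -powR_mulrn// -powRD.
    by rewrite le_eqVlt; apply/orP; left; apply/eqP; congr powR; rewrite /kap natrD; ring.
  apply/implyP => /eqP z; exfalso; move: z (expo_gt0 al0 jk).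
  by rewrite natrD; move=> z; rewrite (_ : k%:R + al - j%:R = 0) ?ltxx// -z; ring.
have -> : F j t - F j x = (F j t - T.[t - x]) + (T.[t - x] - F j x) by ring.
apply: (le_trans (ler_normD _ _)).
have TE : T.[t - x] - F j x = \sum_(l < k - j) (F (j + l.+1)%N x * (t - x) ^+ l.+1 / (l.+1)`!%:R).
  rewrite /T horner_poly big_ord_recl/= addn0 fact0 divr1 expr0 mulr1 addrAC subrr add0r.
  by apply: eq_bigr => l _ /=; rewrite /bump/= add1n mulrAC.
apply: (@le_trans _ _ (c1 / K * r `^ (kap - j%:R) + \sum_(l < k - j) (c1 / K * r `^ (kap - j%:R)))).
  rewrite lerD ?(le_trans h)// TE (le_trans (ler_norm_sum _ _ _))//.
  by apply: ler_sum => l _; exact: term.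
rewrite sumr_const card_ord -[X in _ + X]mulr_natr -[X in X + _]mulr1 -mulrDr.
apply: (@le_trans _ _ (c1 / K * r `^ (kap - j%:R) * K)).
  rewrite ler_wpM2l//; first by rewrite mulr_ge0 ?powR_ge0// divr_ge0 ?ltW.
  by rewrite /K -natr1 addrC lerD2r ler_nat leq_subr.
by rewrite le_eqVlt; apply/orP; left; apply/eqP; field; rewrite gt_eqF.
Qed.

(** The derivative given by [jet_scale_witness] at [x] survives nearby by [jet_close], and it bounds
    the scale at [t] from below. From above, no derivative exceeds twice r^(kap - i) there. *)
Lemma jet_scale_local : exists c A b : R,
  [/\ 0 < c, c <= 1, 1 <= A, 0 < b &
  forall p q F x, jet k al p q F -> x \in `[p, q] ->
   (exists2 j, (j <= k)%N & forall t, t \in `[p, q] -> `|t - x| <= c * jet_scale k al F x ->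
      b * jet_scale k al F x `^ (k%:R + al - j%:R) <= `|F j t|) /\
   (forall t, t \in `[p, q] -> `|t - x| <= c * jet_scale k al F x ->
      jet_scale k al F t <= A * jet_scale k al F x /\
      jet_scale k al F x <= A * jet_scale k al F t)].
Proof.
have c1i : 1 <= c1^-1 by rewrite invf_ge1.
have i0 : 0 <= al^-1 by rewrite invr_ge0 ltW.
(* The first entry serves the upper bound for the scale at [t], the second one the lower bound. *)
pose A := Num.max (k.+1%:R * 2 `^ al^-1) (c1^-1 `^ al^-1).
have A1 : 1 <= A.
  by rewrite le_max; apply/orP; right; rewrite -[leLHS](powRr0 c1^-1) ler_powR.
exists c0, A, c1; split => // p q F x jF xI; set r := jet_scale k al F x.
have r0 : 0 <= r by exact: jet_scale_ge0.
have [j jk hj] := jet_scale_witness k F x al0.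
have hjt t : t \in `[p, q] -> `|t - x| <= c0 * r ->
    c1 * r `^ (k%:R + al - j%:R) <= `|F j t|.
  move=> tI tx; have := jet_close jF xI tI tx jk; rewrite -/r => h.
  have h2 : 2 * c1 * r `^ (kap - j%:R) <= `|F j x|.
    apply: le_trans hj; rewrite -/r [leLHS]mulrC powRM ?invr_ge0 ?(ltW K0)//.
    apply: ler_wpM2l; first exact: powR_ge0.
    rewrite /c1 mulrC divfK// -powR_inv1 ?(ltW K0)// -powRrM ler_powR//.
    by rewrite mulN1r lerN2 gerBl.
  have := ler_distD (F j t) (F j x) 0; rewrite !subr0 distrC => h3.
  by move: h h2 h3; rewrite /kap; set z := r `^ _; lra.
split; first by exists j.
move=> t tI tx; split.
  apply: le_trans (_ : k.+1%:R * 2 `^ al^-1 * r <= _); last first.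
    by rewrite ler_wpM2r// le_max lexx.
  apply: jet_scale_le => //; first by rewrite ler1n.
  move=> i ik; have := jet_close jF xI tI tx ik; rewrite -/r => h.
  have h2 := jet_le_scale F x al0 ik.
  have := ler_distD (F i x) (F i t) 0; rewrite !subr0 => h3.
  have : c1 * r `^ (kap - i%:R) <= r `^ (kap - i%:R) by rewrite ler_piMl ?powR_ge0.
  by move: h h2 h3; rewrite -/r -/kap; set z := r `^ _; lra.
have := hjt t tI tx; set e := k%:R + al - j%:R => h.
have e0 : 0 < e by exact: expo_gt0.
have rt0 := jet_scale_ge0 k al F t.
rewrite -ler_pdivrMl ?(lt_le_trans _ A1)//.
apply: (@le_trans _ _ (c1 `^ al^-1 * r)).
  rewrite ler_wpM2r// invf_ple ?posrE ?powR_gt0 ?(lt_le_trans _ A1)//.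
  by rewrite le_max -powRN -[c1^-1]powR_inv1 ?(ltW c1_gt0)// -powRrM mulN1r lexx orbT.
rewrite -[leRHS]powRr1// -(mulfV (lt0r_neq0 e0)) powRrM.
rewrite powR_inv_ge ?mulr_ge0 ?powR_ge0//.
rewrite (le_trans _ (le_trans h (jet_le_scale F t al0 jk)))//.
rewrite powRM ?powR_ge0// ler_wpM2r ?powR_ge0// -powRrM.
rewrite -[leRHS]powRr1 ?(ltW c1_gt0)//; apply: ler_powR_le1 => //; first exact: ltW.
by rewrite ler_pdivlMl// mulr1 expo_ge.
Qed.

End local.
End jet_scale.

(** * The one-dimensional integral over an interval of the length of the scale *)

Section jet_integral.
Context {R : realType}.
Local Notation mu := (@lebesgue_measure R).
Implicit Types (p q s t x al : R) (F : nat -> R -> R).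

Variables (k : nat) (al : R).
Hypotheses (al0 : 0 < al) (al1 : al <= 1).
Let kap : R := k%:R + al.
Let kap_gt0 : 0 < kap. Proof. by rewrite /kap ltr_wpDl. Qed.

Lemma measurable_jet_scale p q F : jet k al p q F ->
  measurable_fun `[p, q] (jet_scale k al F).
Proof.
move=> jF; apply: measurable_sum => j.
apply: (measurableT_comp (measurable_powR _)).
apply: measurableT_comp => //.
apply: subspace_continuous_measurable_fun => //.
by apply: jet_continuous jF _ => //; rewrite -ltnS.
Qed.

Lemma measurable_inv_pow_jet p q F d : jet k al p q F ->
  measurable_fun `[p, q] (fun t => inv_pow d (F 0%N t)).
Proof.
move=> jF; apply: (measurableT_comp (measurable_inv_pow d)).
apply: subspace_continuous_measurable_fun => //.
exact: jet_continuous jF _.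
Qed.

(** With r the scale at [x], [integral_inv_pow_jet] for m = b r^(kap - j) and length at most 2 c r
    gives r^(-(kap - j)/kap) r^(1 - j/kap) = 1 up to constants: the powers of r cancel for every j.
    The factor [jet_scale] then contributes r. *)
Lemma jet_integral_local c A b : 0 < c -> 1 <= A -> 0 < b -> exists2 C, 0 < C &
  forall p q F x, p < q -> jet k al p q F -> x \in `[p, q] -> 0 < jet_scale k al F x ->
   (exists2 j, (j <= k)%N & forall t, t \in `[p, q] -> `|t - x| <= c * jet_scale k al F x ->
      b * jet_scale k al F x `^ (kap - j%:R) <= `|F j t|) ->
   (forall t, t \in `[p, q] -> `|t - x| <= c * jet_scale k al F x ->
      jet_scale k al F t <= A * jet_scale k al F x) ->
  (\int[mu]_(t in `[p, q] `&` [set t | (`|t - x| <= c * jet_scale k al F x)%R])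
     ((jet_scale k al F t)%:E * inv_pow kap^-1 (F 0%N t)) <=
   (C * jet_scale k al F x)%:E)%E.
Proof.
move=> c0 A1 b0.
have A0 : 0 < A by exact: lt_le_trans A1.
have jd (j : 'I_k.+1) : j%:R * kap^-1 < 1.
  rewrite ltr_pdivrMr// mul1r -subr_gt0; apply: expo_gt0 => //; rewrite -ltnS; exact: ltn_ord.
have kd : 0 <= kap^-1 by rewrite invr_ge0 ltW.
have /choice [C0 C0P] : forall j : 'I_k.+1, exists C : R, 0 < C /\
    forall p q m F, p < q -> 0 < m ->
    (forall i t, (i < j)%N -> t \in `[p, q] -> is_derive t 1 (F i) (F i.+1 t)) ->
    {within `[p, q], continuous (F j)} ->
    (forall t, t \in `[p, q] -> m <= `|F j t|) ->
    (\int[mu]_(t in `[p, q]) inv_pow kap^-1 (F 0%N t) <=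
       (C * m `^ (- kap^-1) * (q - p) `^ (1 - j%:R * kap^-1))%:E)%E.
  by move=> j; have [C C0 CP] := integral_inv_pow_jet kd (jd j); exists C; split.
pose D (j : 'I_k.+1) := A * C0 j * b `^ (- kap^-1) * (2 * c) `^ (1 - j%:R * kap^-1).
have D0 j : 0 < D j by rewrite /D !mulr_gt0 ?powR_gt0 ?mulr_gt0//; exact: (C0P j).1.
(* The order j depends on [F] and [x], so the constants of all orders are added. *)
exists (\sum_j D j).
  by rewrite (bigD1 ord0)//= ltr_wpDr// sumr_ge0// => j _; exact: ltW.
move=> p q F x pq jF xI; set r := jet_scale k al F x => r0 [j jk hj] hA.
pose u := Num.max p (x - c * r); pose v := Num.min q (x + c * r).
have cr : 0 < c * r by rewrite mulr_gt0.
have [px xq] : p <= x /\ x <= q by move: xI; rewrite in_itv/= => /andP.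
have uv : u < v.
  rewrite /u /v lt_min !gt_max pq/=; apply/andP; split; last by apply/andP; split; lra.
  by lra.
have uvl : v - u <= 2 * c * r.
  have : v <= x + c * r by rewrite /v ge_min lexx orbT.
  have : x - c * r <= u by rewrite /u le_max lexx orbT.
  by lra.
have uvI : `[p, q] `&` [set t | `|t - x| <= c * r] = `[u, v]%classic.
  apply/seteqP; split => t /=; rewrite !in_itv/= /u /v ge_max le_min.
    by move=> [/andP[-> ->]]; rewrite ler_distl => /andP[-> ->].
  by move=> /andP[/andP[-> h1] /andP[-> h2]]; rewrite ler_distl h1 h2.
rewrite uvI.
have inuv t : t \in `[u, v] -> t \in `[p, q] /\ `|t - x| <= c * r.
  move=> tI; have : (`[p, q] `&` [set t | `|t - x| <= c * r]) t by rewrite uvI.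
  by case.
have jF' : jet k al u v F.
  by apply: jet_sub jF; rewrite ?le_max ?ge_min lexx.
set jj := Ordinal (jk : (j < k.+1)%N).
have m0 : 0 < b * r `^ (kap - j%:R) by rewrite mulr_gt0 ?powR_gt0.
have := (C0P jj).2 u v _ F uv m0.
move=> /(_ (fun i t ij tI => jF'.1 i t (leq_trans ij jk) tI)).
move=> /(_ (jet_continuous al0 jF' jk)).
move=> /(_ (fun t tI => hj t (inuv t tI).1 (inuv t tI).2)) hint.
apply: (@le_trans _ _ (\int[mu]_(t in `[u, v]) ((A * r)%:E * inv_pow kap^-1 (F 0%N t)))%E).
  apply: ge0_le_integral => //.
  - by move=> t _; rewrite mule_ge0 ?inv_pow_ge0// lee_fin jet_scale_ge0.
  - apply: emeasurable_funM; last exact: measurable_inv_pow_jet jF'.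
    by apply/measurable_EFinP; exact: measurable_jet_scale jF'.
  - by apply: measurable_funeM; exact: measurable_inv_pow_jet jF'.
  - move=> t /inuv [tI tx]; rewrite lee_wpmul2r ?inv_pow_ge0// lee_fin.
    exact: hA.
rewrite ge0_integralZl_EFin ?mulr_ge0 ?(ltW A0) ?(ltW r0)//; last 2 first.
- by move=> t _; exact: inv_pow_ge0.
- exact: measurable_inv_pow_jet jF'.
apply: (@le_trans _ _ (D jj * r)%:E); last first.
  rewrite lee_fin ler_wpM2r ?(ltW r0)// (bigD1 jj)//= lerDl.
  by rewrite sumr_ge0// => i _; exact: ltW.
apply: (le_trans (lee_wpmul2l _ hint)); first by rewrite lee_fin mulr_ge0 ?(ltW A0) ?(ltW r0).
rewrite -EFinM lee_fin.
have e1 : (v - u) `^ (1 - jj%:R * kap^-1) <=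
    (2 * c) `^ (1 - jj%:R * kap^-1) * r `^ (1 - jj%:R * kap^-1).
  rewrite -powRM ?mulr_ge0 ?(ltW c0) ?(ltW r0)//.
  rewrite ge0_ler_powR ?nnegrE ?mulr_ge0 ?(ltW c0) ?(ltW r0) ?subr_ge0 ?(ltW uv)//.
  by rewrite ltW.
have e2 : (b * r `^ (kap - j%:R)) `^ (- kap^-1) = b `^ (- kap^-1) * (r `^ (1 - jj%:R * kap^-1))^-1.
  rewrite powRM ?powR_ge0 ?(ltW b0)// -powRrM -powRN; congr (_ * _ `^ _).
  by rewrite /=; field; rewrite gt_eqF.
have z0 : 0 < r `^ (1 - jj%:R * kap^-1) by rewrite powR_gt0.
rewrite e2 /D; move: e1 z0; set Z := r `^ _; set Y := (v - u) `^ _; set X := (2 * c) `^ _ => e1 z0.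
have C00 := (C0P jj).1.
rewrite [leLHS](_ : _ = (A * r * C0 jj * b `^ (- kap^-1) * Z^-1) * Y); last by ring.
rewrite [leRHS](_ : _ = (A * r * C0 jj * b `^ (- kap^-1) * Z^-1) * (X * Z)); last first.
  by field; rewrite gt_eqF.
by rewrite ler_wpM2l// !mulr_ge0 ?powR_ge0 ?invr_ge0// ltW.
Qed.

End jet_integral.

(** * The one-dimensional integral over an arbitrary interval *)

Section jet_integral_covering.
Context {R : realType}.
Local Notation mu := (@lebesgue_measure R).
Implicit Types (p q s t x al : R) (F : nat -> R -> R).

(* A covering argument by intervals of length comparable to the scale, carried out by
   averaging: Tonelli is applied to 1_{|y - x| <= c rho(x)} G(y) / rho(x). *)
Lemma jet_integral (k : nat) (al C1 : R) : 0 < al -> al <= 1 -> 0 < C1 ->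
  exists2 C, 0 < C & forall p q F, p < q -> jet k al p q F ->
   (forall t, t \in `[p, q] -> jet_scale k al F t <= C1 * (q - p)) ->
  (\int[mu]_(t in `[p, q]) ((jet_scale k al F t)%:E * inv_pow (k%:R + al)^-1 (F 0%N t)) <=
   (C * (q - p))%:E)%E.
Proof.
move=> al0 al1 C10.
have [c [A [b [c0 c1 A1 b0 locP]]]] := @jet_scale_local R k al al0 al1.
have [C C0 CP] := jet_integral_local k al0 c0 A1 b0.
have A0 : 0 < A by exact: lt_le_trans A1.
(* The first entry makes [y] lie within c r(x) of every [x] with |x - y| <= c3 r(y). The second
   gives c3 r(y) <= (q - p) / 2, so that an interval of length c3 r(y) on one side of [y] fits into
   [p, q]. *)
pose c3 := Num.min (c / A) (2 * C1)^-1.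
have c30 : 0 < c3 by rewrite lt_min divr_gt0//= invr_gt0 mulr_gt0.
exists (C * (A / c3)); first by rewrite mulr_gt0// divr_gt0.
move=> p q F pq jF Fle.
set G := fun t => ((jet_scale k al F t)%:E * inv_pow (k%:R + al)^-1 (F 0%N t))%E.
set I := `[p, q]%classic.
have mI : measurable (I : set R) by exact: measurable_itv.
have mG : measurable_fun I G.
  rewrite /G; apply: emeasurable_funM; last exact: (measurable_inv_pow_jet al0 _ jF).
  by apply/measurable_EFinP; exact: (measurable_jet_scale al0 jF).
have G0 x : (0 <= G x)%E by rewrite mule_ge0 ?inv_pow_ge0// lee_fin jet_scale_ge0.
pose r := jet_scale k al F \_ I.
have r0 x : 0 <= r x by rewrite /r patchE; case: ifP => // _; exact: jet_scale_ge0.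
have mr : measurable_fun setT r.
  exact: ((measurable_restrictT (jet_scale k al F) mI).1 (measurable_jet_scale al0 jF)).
have rin x : x \in `[p, q] -> r x = jet_scale k al F x.
  by move=> xI; rewrite /r patchE mem_set.
have rout x : x \notin I -> r x = 0 by move=> xI; rewrite /r patchE (negPf xI).
clearbody r.
(* 1 / r(x), with the value 0 where r(x) = 0, so that such points contribute nothing to [H]. *)
pose w x := r x `^ (-1).
have wE x : w x = (r x)^-1 by rewrite /w powR_inv1.
have mw : measurable_fun setT w by exact: (measurableT_comp (measurable_powR _)).
have w0 x : 0 <= w x by exact: powR_ge0.
clearbody w.
pose Gr := G \_ I.
have Gr0 x : (0 <= Gr x)%E by rewrite /Gr patchE; case: ifP.
have mGr : measurable_fun setT Gr by exact: ((measurable_restrictT G mI).1 mG).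
have GrE x : Gr x = if x \in I then G x else 0%E by rewrite /Gr patchE.
have intGr : (\int[mu]_(x in I) G x = \int[mu]_x Gr x)%E by rewrite integral_mkcond.
clearbody Gr.
pose H (z : measurableTypeR R * measurableTypeR R) : \bar R :=
  if `|z.2 - z.1| <= c * r z.1 then ((w z.1)%:E * Gr z.2)%E else 0%E.
have H0 z : (0 <= H z)%E.
  by rewrite /H; case: ifP => // _; rewrite mule_ge0// lee_fin w0.
have mH : measurable_fun setT H.
  apply: measurable_fun_ifT => //.
  - apply: measurable_fun_ler.
      apply: measurableT_comp => //; apply: measurable_funB; first exact: measurable_snd.
      exact: measurable_fst.
    apply: measurable_funM => //; exact: measurableT_comp mr measurable_fst.
  - apply: emeasurable_funM.
      apply/measurable_EFinP; exact: measurableT_comp mw measurable_fst.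
    exact: measurableT_comp mGr measurable_snd.
have HE x y : H (x, y) = if `|y - x| <= c * r x then ((w x)%:E * Gr y)%E else 0%E by [].
clearbody H.
have tonelli : (\int[mu]_x \int[mu]_y H (x, y) = \int[mu]_y \int[mu]_x H (x, y))%E.
  exact: (fubini_tonelli H mH H0).
(* Integrating in y first: [jet_integral_local] gives C r(x), and the weight 1 / r(x) cancels the
   scale. *)
have up : (\int[mu]_x \int[mu]_y H (x, y) <= (C * (q - p))%:E)%E.
  pose h (x : R) : \bar R := if x \in I then C%:E else 0%E.
  have mh : measurable_fun setT h.
    rewrite (_ : h = (cst C%:E : R -> \bar R) \_ I).
      exact: ((measurable_restrictT (cst C%:E : R -> \bar R) mI).1 (measurable_cst _)).
    by apply/funext => x; rewrite patchE.
  have hE : (\int[mu]_x h x = (C * (q - p))%:E)%E.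
    transitivity (\int[mu]_(x in I) (cst C%:E) x)%E.
      by rewrite [RHS]integral_mkcond; apply: eq_integral => x _; rewrite patchE.
    rewrite (@integral_cst _ _ _ mu I mI) EFinM; congr (_ * _)%E.
    by apply: etrans (lebesgue_measure_itv `[p, q]) _; rewrite /= lte_fin pq.
  rewrite -hE.
  apply: ge0_le_integral.
  - exact: measurableT.
  - by move=> x _; apply: integral_ge0 => y _; exact: H0.
  - exact: (measurable_fun_fubini_tonelli_F H mH H0).
  - exact: mh.
  move=> x _; rewrite /h; case: ifPn => [/set_mem xI|xI]; last first.
    rewrite integral0_eq ?lexx// => y _; rewrite HE wE rout ?invr0 ?mul0e ?if_same//.
  have xI' : x \in `[p, q] by [].
  have rx := rin _ xI'.
  have [rx0|rx0] := eqVneq (r x) 0.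
    rewrite integral0_eq ?lee_fin ?(ltW C0)// => y _.
    by rewrite HE wE rx0 invr0 mul0e if_same.
  have {}rx0 : 0 < r x by rewrite lt_def rx0 r0.
  have [hj hA] := locP p q F x jF xI'.
  set S := I `&` [set t | `|t - x| <= c * jet_scale k al F x].
  have mS : measurable (S : set (measurableTypeR R)).
    apply: measurableI => //.
    rewrite (_ : [set t | _] = `[x - c * r x, x + c * r x]%classic); first exact: measurable_itv.
    by apply/seteqP; split => t /=; rewrite in_itv/= ler_distl rx.
  have -> : (\int[mu]_y H (x, y) = \int[mu]_(y in S) ((w x)%:E * G y))%E.
    rewrite [RHS]integral_mkcond; apply: eq_integral => y _.
    rewrite HE patchE rx GrE.
    have [yS|yS] := boolP (y \in S).
      by move/set_mem : yS => [yI /= ->]; rewrite (mem_set yI).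
    case: ifPn => yx; last by [].
    case: ifPn => [yI|_]; last by rewrite mule0.
    by case/negP: yS; apply/mem_set; split; [exact: set_mem yI|].
  have mGS : measurable_fun S G by apply: measurable_funS mG => // t [].
  rewrite ge0_integralZl_EFin; [|exact: mS|by move=> *; exact: G0|exact: mGS|exact: w0].
  rewrite rx in rx0.
  have := CP p q F x pq jF xI' rx0 hj (fun t tI tx => (hA t tI tx).1).
  rewrite -/I -/S -/G => hS.
  apply: (le_trans (lee_wpmul2l _ hS)); first by rewrite lee_fin w0.
  rewrite -EFinM lee_fin wE rx le_eqVlt; apply/orP; left; apply/eqP.
  by field; rewrite gt_eqF.
(* Integrating in x first: an interval of length c3 r(y) of points x has weight at least 1 / (A
   r(y)), and again the scale cancels. *)
have low : ((c3 / A)%:E * \int[mu]_y Gr y <= \int[mu]_y \int[mu]_x H (x, y))%E.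
  rewrite -ge0_integralZl_EFin//; last by rewrite divr_ge0 ?ltW.
  apply: ge0_le_integral => //.
  - by move=> y _; rewrite mule_ge0// lee_fin divr_ge0 ?ltW.
  - exact: measurable_funeM.
  - exact: (measurable_fun_fubini_tonelli_G H mH H0).
  move=> y _; have [/set_mem yI|yI] := boolP (y \in I); last first.
    by rewrite GrE (negPf yI) mule0 integral_ge0.
  have yI' : y \in `[p, q] by [].
  have ry := rin _ yI'.
  have [ry0|ry0] := eqVneq (r y) 0.
    (* At scale 0 the function [F 0] vanishes too, but 0 * +oo = 0 makes [G y] zero. *)
    by rewrite {1}GrE mem_set// /G -ry ry0 mul0e mule0 integral_ge0.
  have {}ry0 : 0 < r y by rewrite lt_def ry0 r0.
  have [_ hA] := locP p q F y jF yI'.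
  have [py yq] : p <= y /\ y <= q by move: yI'; rewrite in_itv/= => /andP.
  have m0 : 0 < c3 * r y by rewrite mulr_gt0.
  have mle : c3 * r y <= (q - p) / 2.
    have h1 : r y <= C1 * (q - p) by rewrite ry Fle.
    have h2 : c3 <= (2 * C1)^-1 by rewrite ge_min lexx orbT.
    apply: (le_trans (ler_pM (ltW c30) (r0 y) h2 h1)).
    by rewrite le_eqVlt; apply/orP; left; apply/eqP; field; rewrite gt_eqF.
  have [u [v [uv [pu vq uy yv]]]] : exists u v, v - u = c3 * r y /\ [/\ p <= u, v <= q,
      y - c3 * r y <= u & v <= y + c3 * r y].
    case: (leP y ((p + q) / 2)) => ym.
      exists y, (y + c3 * r y); split; first by ring.
      by split => //; move: ym mle m0 yq; clear; lra.
    exists (y - c3 * r y), y; split; first by ring.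
    by split => //; move: ym mle m0 py; clear; lra.
  have uvI x : x \in `[u, v] -> [/\ x \in `[p, q], `|y - x| <= c * r x & (A * r y)^-1 <= w x].
    rewrite in_itv/= => /andP[ux xv].
    have xI : x \in `[p, q] by rewrite in_itv/= (le_trans pu ux) (le_trans xv vq).
    have rx := rin _ xI.
    have xy : `|x - y| <= c3 * r y by rewrite ler_distl (le_trans uy ux) (le_trans xv yv).
    have c3A : c3 * r y <= c / A * r y by rewrite ler_wpM2r// ge_min lexx.
    have cA : c / A * r y <= c * r y.
      by rewrite ler_wpM2r// ler_pdivrMr// ler_peMr// ltW.
    have [] := hA x xI; first by rewrite -ry (le_trans xy)// (le_trans c3A).
    rewrite -!ry -!rx => h1 h2.
    have rx0 : 0 < r x.
      by rewrite -(pmulr_rgt0 _ A0); exact: lt_le_trans h2.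
    split => //.
      rewrite distrC (le_trans xy)// (le_trans c3A)//.
      by rewrite -mulrA ler_pM2l// ler_pdivrMl.
    by rewrite wE lef_pV2 ?posrE// mulr_gt0.
  apply: (@le_trans _ _ (\int[mu]_(x in `[u, v]) ((A * r y)^-1%:E * Gr y))%E).
    have -> : (\int[mu]_(x in `[u, v]) ((A * r y)^-1%:E * Gr y) =
        (A * r y)^-1%:E * Gr y * (c3 * r y)%:E)%E.
      apply: etrans (@integral_cst _ _ _ mu `[u, v]%classic (measurable_itv _) _) _.
      congr (_ * _)%E; apply: etrans (lebesgue_measure_itv `[u, v]) _.
      by rewrite /= lte_fin -subr_gt0 uv m0 -EFinB uv.
    rewrite muleAC -EFinM lee_wpmul2r// lee_fin le_eqVlt; apply/orP; left; apply/eqP.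
    by field; rewrite !gt_eqF.
  apply: (@le_trans _ _ (\int[mu]_(x in `[u, v]) H (x, y))%E); last first.
    apply: ge0_subset_integral;
      [exact: measurable_itv|exact: measurableT| |by move=> *; exact: H0|by []].
    exact: (measurableT_comp mH (pair2_measurable _)).
  apply: ge0_le_integral; first exact: measurable_itv.
  - by move=> x _; rewrite mule_ge0// lee_fin invr_ge0 mulr_ge0 ?(ltW A0).
  - exact: measurable_cst.
  - by apply: measurable_funTS; exact: measurableT_comp mH (pair2_measurable _).
  - move=> x /uvI [xI xy h]; rewrite HE xy lee_wpmul2r// lee_fin.
rewrite intGr.
rewrite -tonelli in low.
have h := le_trans low up.
rewrite -lee_pdivlMl ?divr_gt0// -?EFinM in h.
apply: (le_trans h); rewrite lee_fin le_eqVlt; apply/orP; left; apply/eqP.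
by field; rewrite !gt_eqF.
Qed.
End jet_integral_covering.

(** * Polynomial interpolation at fixed nodes *)

Section interpolation.
Context {R : realType}.

(** The nodes avoid 0 because [hpoly_bound] divides by them. *)
Definition node (k : nat) (i : 'I_k.+1) : R := i.+1%:R / k.+1%:R.

Lemma node_gt0 k (i : 'I_k.+1) : 0 < node i.
Proof. by rewrite divr_gt0. Qed.

Lemma node_le1 k (i : 'I_k.+1) : node i <= 1.
Proof. by rewrite ler_pdivrMr// mul1r ler_nat. Qed.

Lemma node_ge k (i : 'I_k.+1) : k.+1%:R^-1 <= node i.
Proof. by rewrite ler_peMl// ler1n. Qed.

Lemma node_inj k : injective (@node k).
Proof.
move=> i j /(mulIf (invr_neq0 _)) => /(_ _)/eqP; rewrite pnatr_eq0 => /(_ isT).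
by rewrite eqr_nat => /eqP[] /val_inj.
Qed.

(** The Vandermonde matrix of distinct nodes is invertible. The constant adds up all entries of the
    inverse in absolute value; the extra 1 makes it visibly positive. *)
Lemma poly_coef_bound (k : nat) : exists2 C : R, 0 < C &
  forall (p : {poly R}) (M : R), (size p <= k.+1)%N -> (forall i : 'I_k.+1, `|p.[node i]| <= M) ->
  forall j, `|p`_j| <= C * M.
Proof.
pose a : 'rV[R]_k.+1 := \row_i node i.
pose V := Vandermonde k.+1 a.
have Vu : V \in unitmx.
  rewrite unitmxE unitfE det_Vandermonde; apply/prodf_neq0 => i _.
  apply/prodf_neq0 => j ij; rewrite !mxE subr_eq0; apply/eqP => /node_inj e.
  by move: ij; rewrite e ltnn.
pose C := \sum_i \sum_j `|invmx V i j| + 1.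
have S0 : 0 <= \sum_i \sum_j `|invmx V i j| by rewrite sumr_ge0// => i _; rewrite sumr_ge0.
exists C; first by rewrite ltr_wpDl.
move=> p M sp pM j.
have M0 : 0 <= M by exact: le_trans (pM ord0).
have [jk|jk] := ltnP j k.+1; last first.
  by rewrite nth_default ?normr0 ?(leq_trans sp)// mulr_ge0// addr_ge0.
pose c : 'rV[R]_k.+1 := \row_i p`_i.
have cV : c *m V = \row_i p.[node i].
  apply/rowP => i; rewrite !mxE (horner_coef_wide _ sp).
  by apply: eq_bigr => l _; rewrite !mxE.
have cE : c = (\row_i p.[node i]) *m invmx V by rewrite -cV mulmxK.
have -> : p`_j = c 0 (Ordinal jk) by rewrite mxE.
rewrite cE mxE (le_trans (ler_norm_sum _ _ _))// /C mulrDl mul1r ler_wpDr//.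
rewrite mulr_suml ler_sum// => i _.
rewrite mulr_suml (bigD1 (Ordinal jk))//= ler_wpDr//.
  by rewrite sumr_ge0// => l _; rewrite mulr_ge0.
by rewrite mxE normrM mulrC ler_wpM2l.
Qed.

Lemma poly_eval_bound (k : nat) (L : R) : exists2 C : R, 1 <= C &
  forall (p : {poly R}) (M : R), (size p <= k.+1)%N -> (forall i : 'I_k.+1, `|p.[node i]| <= M) ->
  forall t, `|t| <= L -> `|p.[t]| <= C * M.
Proof.
have [C C0 CP] := poly_coef_bound k.
exists (\sum_(i < k.+1) C * `|L| ^+ i + 1).
  by rewrite lerDr sumr_ge0// => i _; rewrite mulr_ge0 ?exprn_ge0// ltW.
move=> p M sp pM t tL.
have M0 : 0 <= M by exact: le_trans (pM ord0).
rewrite (horner_coef_wide _ sp) (le_trans (ler_norm_sum _ _ _))//.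
rewrite mulrDl mul1r ler_wpDr// mulr_suml ler_sum// => i _.
rewrite normrM normrX mulrAC ler_pM ?exprn_ge0 ?CP//.
by rewrite lerXn2r ?nnegrE// (le_trans tL) ?ler_norm.
Qed.

End interpolation.

(** * Homogeneous forms and finitely many directions *)

Section homogeneous.
Context {R : realType} {m : nat}.
Local Notation N := m.+1.
Implicit Types (D : seq 'I_N -> R) (v : 'rV[R]_N).

Fixpoint words (n : nat) : seq (seq 'I_N) :=
  if n is n'.+1 then [seq i :: w | i <- enum 'I_N, w <- words n'] else [:: [::]].

Lemma size_words n w : w \in words n -> size w = n.
Proof.
by elim: n w => [|n IH] w; [rewrite inE => /eqP ->|move=> /allpairsP[[i w'] /= [_ /IH <- ->]]].
Qed.

(** The n-linear form with coefficients [D w], evaluated on the diagonal; a word records the order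
    of the partial derivatives. *)
Definition hpoly n D v : R := \sum_(w <- words n) (\prod_(i <- w) v ord0 i) * D w.

Lemma hpolyZ n D (c : R) v : hpoly n D (c *: v) = c ^+ n * hpoly n D v.
Proof.
rewrite /hpoly mulr_sumr; apply: eq_big_seq => w /size_words <-.
rewrite mulrA; congr (_ * _); elim: w => [|i w IH]; first by rewrite !big_nil expr0 mulr1.
by rewrite !big_cons IH mxE /= exprS; ring.
Qed.

Definition upd v (i : 'I_N) (t : R) : 'rV[R]_N := \row_j (if j == i then t else v ord0 j).

Lemma upd_id v i : upd v i (v ord0 i) = v.
Proof. by apply/rowP => j; rewrite mxE; case: eqP => [->|]. Qed.

Lemma hpoly_upd n D v i : exists2 p : {poly R}, (size p <= n.+1)%N &
  forall t, hpoly n D (upd v i t) = p.[t].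
Proof.
pose f (j : 'I_N) : {poly R} := if j == i then 'X else (v ord0 j)%:P.
exists (\sum_(w <- words n) (\prod_(j <- w) f j) * (D w)%:P).
  apply: (leq_trans (size_sum _ _ _)); apply/bigmax_leqP_seq => w /size_words <- _.
  have sp : (size (\prod_(j <- w) f j)%R <= (size w).+1)%N.
    elim: w => [|j w IH]; first by rewrite big_nil size_poly1.
    rewrite big_cons (leq_trans (size_polyMleq _ _))//.
    have : (size (f j) <= 2)%N.
      by rewrite /f; case: eqP => _; rewrite ?size_polyX// (leq_trans (size_polyC_leq1 _)).
    by move=> fj; rewrite -subn1 leq_subLR add1n; exact: leq_add fj IH.
  rewrite (leq_trans (size_polyMleq _ _))//.
  have [->|Dn0] := eqVneq (D w) 0.
    by rewrite polyC0 size_poly0 addn0 (leq_trans (leq_pred _)).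
  by rewrite size_polyC Dn0 addn1.
move=> t; rewrite /hpoly horner_sum; apply: eq_bigr => w _.
rewrite hornerM hornerC horner_prod; congr (_ * _); apply: eq_bigr => j _.
by rewrite mxE /f; case: eqP => _; rewrite ?hornerX ?hornerC.
Qed.

(* Finitely many directions suffice: hpoly_bound recovers a form of degree at most k from
   its values on them. All have first coordinate 1, as the shear of
   ge0_integral_leb_lines requires. *)
Definition dir (k : nat) (f : {ffun 'I_N -> 'I_k.+1}) : 'rV[R]_N :=
  \row_i (if i == ord0 then 1 else node (f i)).

(** In each single coordinate the form is a polynomial of degree at most k, so the coordinates are
    freed from the nodes one at a time by interpolation. The first coordinate comes last, by
    homogeneity. *)
Lemma hpoly_bound (k : nat) : exists2 C : R, 0 < C &
  forall n D (M : R), (n <= k)%N ->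
  (forall f : {ffun 'I_N -> 'I_k.+1}, `|hpoly n D (dir f)| <= M) ->
  forall v, (forall i, `|v ord0 i| <= 1) -> `|hpoly n D v| <= C * M.
Proof.
have [C C1 CP] := @poly_eval_bound R k k.+1%:R.
have C0 : 0 < C by exact: lt_le_trans C1.
exists (C ^+ N.+1); first by rewrite exprn_gt0.
move=> n D M nk hM.
have M0 : 0 <= M by exact: le_trans (hM [ffun=> ord0]).
(* Coordinates of index below [s] are free, the others are still at nodes. They range up to [k.+1]
   rather than 1 to leave room for the division by a node below. *)
have stepA (s : nat) : (s <= N)%N -> forall v, v ord0 ord0 = 1 ->
    (forall i : 'I_N, (s <= i)%N -> i != ord0 -> exists j : 'I_k.+1, v ord0 i = node j) ->
    (forall i, `|v ord0 i| <= k.+1%:R) -> `|hpoly n D v| <= C ^+ s * M.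
  elim: s => [_|s IH sN] v v0 vn vL.
    have [g gP] : exists g : 'I_N -> 'I_k.+1, forall i, i != ord0 -> v ord0 i = node (g i).
      have : forall i, exists j : 'I_k.+1, i != ord0 -> v ord0 i = node j.
        move=> i; have [->|i0] := eqVneq i ord0; first by exists ord0.
        by have [j vj] := vn i (leq0n _) i0; exists j.
      by move=> /choice [g gP]; exists g.
    rewrite expr0 mul1r (_ : v = dir [ffun i => g i])//.
    by apply/rowP => i; rewrite mxE ffunE; case: eqP => [->//|/eqP/gP].
  pose i0 := Ordinal sN.
  have [i00|i00] := eqVneq i0 ord0.
    apply: (@le_trans _ _ (C ^+ s * M)).
      2: by rewrite exprS -mulrA ler_peMl// mulr_ge0// exprn_ge0// ltW.
    apply: IH => // [|i si]; first exact: ltnW.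
    rewrite leq_eqVlt in si; case/orP: si => [/eqP e|si]; last exact: vn.
    by move=> /negP[]; rewrite -i00; apply/eqP/val_inj.
  have [p sp pE] := hpoly_upd n D v i0.
  rewrite -(upd_id v i0) pE exprS -mulrA; apply: CP => //.
    by rewrite (leq_trans sp).
  move=> j; rewrite -pE; apply: IH => //; first exact: ltnW.
  - by rewrite mxE eq_sym (negPf i00).
  - move=> i si in0; rewrite mxE; case: eqP => [_|/eqP ii0]; first by exists j.
    apply: vn => //; rewrite ltn_neqAle si andbT.
    by apply: contra ii0 => /eqP e; apply/eqP/val_inj.
  - move=> i; rewrite mxE; case: eqP => // _.
    by rewrite ger0_norm ?(ltW (node_gt0 _))// (le_trans (node_le1 _))// ler1n.
move=> v v1.
have [p sp pE] := hpoly_upd n D v ord0.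
rewrite -(upd_id v ord0) pE exprS -mulrA; apply: CP; last 1 first.
- by rewrite (le_trans (v1 _))// ler1n.
- by rewrite (leq_trans sp).
move=> j; rewrite -pE; have nj := @node_gt0 R k j.
(* Rescaling brings the first coordinate back to 1, as [stepA] wants; since nodes are at least 1 /
   (k + 1), the other coordinates stay within k + 1. *)
have -> : upd v ord0 (node j) = node j *: upd ((node j)^-1 *: v) ord0 1.
  apply/rowP => i; rewrite !mxE; case: eqP => _; first by rewrite mulr1.
  by rewrite mulrA mulfV ?mul1r// gt_eqF.
rewrite hpolyZ normrM normrX gtr0_norm//.
apply: (@le_trans _ _ (1 * (C ^+ N * M))); last by rewrite mul1r.
apply: ler_pM => //; first by rewrite exprn_ge0// ltW.
  by rewrite exprn_ile1 ?node_le1// ltW.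
apply: stepA => //.
- by rewrite mxE eqxx.
- by move=> i; rewrite leqNgt ltn_ord.
- move=> i; rewrite !mxE; case: eqP => _; first by rewrite normr1 ler1n.
  rewrite normrM normfV (gtr0_norm nj) -[leRHS]mulr1.
  apply: ler_pM => //; first by rewrite invr_ge0 ltW.
  by rewrite invf_ple ?posrE// node_ge.
Qed.

End homogeneous.

(** * Sup norm against Euclidean norm *)

Section row_vector_norms.
Context {R : realType} {n : nat}.
Implicit Types (v x y : 'rV[R]_n).

Lemma rV_norm_leP v (r : R) : 0 <= r -> `|v| <= r <-> forall i, `|v ord0 i| <= r.
Proof.
move=> r0; have -> : `|v| = mx_norm v by []; rewrite mx_normrE; split=> [/bigmax_leP[_ h] i|h].
  exact: (h (ord0, i)).
by apply/bigmax_leP; split => // -[i j] _ /=; rewrite ord1.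
Qed.

Lemma rV_coord_le v i : `|v ord0 i| <= `|v|.
Proof. by have [h _] := rV_norm_leP v (normr_ge0 v); exact: h. Qed.

Lemma rV_norm_le_enorm v : `|v| <= enorm v.
Proof.
apply/rV_norm_leP => [|i]; first exact: sqrtr_ge0.
rewrite -sqrtr_sqr ler_wsqrtr// (bigD1 i)//= lerDl.
by rewrite sumr_ge0// => j _; exact: sqr_ge0.
Qed.

Lemma enorm_le_norm v : enorm v <= n%:R * `|v|.
Proof.
rewrite -[leRHS]ger0_norm ?mulr_ge0// -sqrtr_sqr ler_wsqrtr//.
apply: (@le_trans _ _ (\sum_(i < n) `|v| ^+ 2)).
  apply: ler_sum => i _; rewrite -[leLHS]real_normK ?num_real//.
  by rewrite lerXn2r ?nnegrE// rV_coord_le.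
rewrite sumr_const card_ord exprMn -[leLHS]mulr_natr mulrC ler_wpM2r ?sqr_ge0//.
by rewrite -natrX ler_nat; case: (n) => // k; rewrite -[X in (X <= _)%N]expn1 leq_pexp2l.
Qed.

End row_vector_norms.

(** * Directional derivatives and the Hölder condition *)

Section derivatives.
Context {R : realType} {m : nat}.
Local Notation N := m.+1.
Implicit Types (x y v : 'rV[R]_N) (a : 'rV[R]_N -> R).

Lemma is_derive_lincomb (T : eqType) (ws : seq T) (c : T -> R) (f : T -> 'rV[R]_N -> R) x v :
  (forall w, w \in ws -> derivable (f w) x v) ->
  is_derive x v (fun y => \sum_(w <- ws) c w * f w y) (\sum_(w <- ws) c w * 'D_v (f w) x).
Proof.
elim: ws => [|w ws IH] df.
  rewrite big_nil (_ : (fun y => _) = cst 0); first exact: is_derive_cst.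
  by apply/funext => y; rewrite big_nil.
rewrite big_cons (_ : (fun y => _) =
    (c w \*: f w) + (fun y => \sum_(w <- ws) c w * f w y)).
  apply: is_deriveD; last by apply: IH => u uw; apply: df; rewrite inE uw orbT.
  by apply: is_deriveZ; apply: derivableP; apply: df; rewrite mem_head.
by apply/funext => y; rewrite big_cons.
Qed.

Lemma derive_coord (f : 'rV[R]_N -> R) x v : differentiable f x ->
  'D_v f x = \sum_(i <- enum 'I_N) v ord0 i * 'D_(delta_mx ord0 i) f x.
Proof.
move=> df; rewrite deriveE// {1}(row_sum_delta v) linear_sum/= big_enum/=.
by apply: eq_bigr => i _; rewrite linearZ/= deriveE.
Qed.

Lemma is_derive_line (f : 'rV[R]_N -> R) x v (t : R) : differentiable f (x + t *: v) ->
  is_derive t 1 (fun s => f (x + s *: v)) ('D_v f (x + t *: v)).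
Proof.
move=> df0; have df : derivable f (x + t *: v) v by exact: diff_derivable.
have E : (fun h : R =>
    h^-1 *: (((fun s => f (x + s *: v)) \o shift t) (h *: (1 : R)) - f (x + t *: v))) =
   (fun h : R => h^-1 *: ((f \o shift (x + t *: v)) (h *: v) - f (x + t *: v))).
  apply/funext => h; congr (_ *: (_ - _)); rewrite /=.
  by congr f; rewrite /shift/= [h *: 1]mulr1 scalerDl addrCA.
apply: DeriveDef; first by rewrite /derivable E.
by rewrite /derive E.
Qed.

Section holder.
Variables (k : nat) (al : R) (U : set 'rV[R]_N) (a : 'rV[R]_N -> R).
Hypotheses (al0 : 0 < al) (oU : open U) (aH : holder_class k al U a).

Definition monomial_deriv x (w : seq 'I_N) : R := derivs a [seq delta_mx ord0 i | i <- w] x.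

(** Induction on [n]: since [U] is open, the identity holds near [x] and may be differentiated along
    [v]. Differentiability of the partial derivatives of order below k splits the new derivative
    into coordinates. *)
Lemma derivs_hpoly n v x : (n <= k)%N -> U x ->
  derivs a (nseq n v) x = hpoly n (monomial_deriv x) v.
Proof.
elim: n x => [|n IH] x nk Ux; first by rewrite /hpoly/= big_seq1 big_nil mul1r.
rewrite /= (@near_eq_derive _ _ _ _ (fun y => \sum_(w <- words n)
   (\prod_(i <- w) v ord0 i) * monomial_deriv y w)); last first.
  have : nbhs x U by exact: open_nbhs_nbhs.
  apply: filterS => y Uy; exact: IH (ltnW nk) Uy.
have dmon w : w \in words n -> differentiable (monomial_deriv^~ w) x.
  move=> /size_words wn; apply: aH.1 => //; by rewrite size_map wn.
have D := @is_derive_lincomb _ (words n) (fun w => \prod_(i <- w) v ord0 i)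
  (fun w y => monomial_deriv y w) x v (fun w wn => diff_derivable (dmon w wn)).
rewrite derive_val /hpoly /= big_allpairs_dep /= exchange_big/=.
apply: eq_big_seq => w wn; rewrite derive_coord; last exact: dmon.
by rewrite mulr_sumr; apply: eq_bigr => i _; rewrite big_cons /monomial_deriv/=; ring.
Qed.

Lemma derivsZ n (c : R) v x : (n <= k)%N -> U x ->
  derivs a (nseq n (c *: v)) x = c ^+ n * derivs a (nseq n v) x.
Proof. by move=> nk Ux; rewrite !derivs_hpoly// hpolyZ. Qed.

Lemma is_derive_derivs_line j x v t : (j < k)%N -> U (x + t *: v) ->
  is_derive t 1 (fun s => derivs a (nseq j v) (x + s *: v))
                (derivs a (nseq j.+1 v) (x + t *: v)).
Proof. by move=> jk Ux; apply: is_derive_line; apply: aH.1 => //; rewrite size_nseq. Qed.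

(** Passage from the Euclidean norm to the sup norm: v = N u with [enorm u <= 1] costs N^k by
    homogeneity, and [enorm (x - y)] costs N^al. *)
Lemma holder_bound : exists2 L : R, 0 < L & forall x y v, U x -> U y -> `|v| <= 1 ->
  `|derivs a (nseq k v) x - derivs a (nseq k v) y| <= L * `|x - y| `^ al.
Proof.
have := aH.2; set S := ereal_sup _ => Soo.
(* The maximum with 1 gives positivity and covers S = -oo, the supremum over no pairs at all. *)
pose H : R := Num.max 1 (fine S).
have H0 : 0 < H by rewrite lt_max ltr01.
have SH : (S <= H%:E)%E.
  case: S Soo @H H0 => [s| |] //= _; last by rewrite leNye.
  by move=> _; rewrite lee_fin le_max lexx orbT.
have key x y v : U x -> U y -> enorm v <= 1 ->
    `|derivs a (nseq k v) x - derivs a (nseq k v) y| <= H * enorm (x - y) `^ al.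
  move=> Ux Uy v1; have [->|xy] := eqVneq x y.
    by rewrite subrr normr0 mulr_ge0 ?powR_ge0// ltW.
  have exy : 0 < enorm (x - y).
    by rewrite (lt_le_trans _ (rV_norm_le_enorm _))// normr_gt0 subr_eq0.
  have e0 : 0 < enorm (x - y) `^ al by rewrite powR_gt0.
  rewrite -ler_pdivrMr// -lee_fin; apply: le_trans SH.
  apply: le_trans (ereal_sup_ubound _); last by exists (x, y).
  rewrite EFinM lee_wpmul2r ?lee_fin ?invr_ge0 ?(ltW e0)//.
  apply: ereal_sup_ubound; exists (nseq_tuple k v) => //=.
  by move=> u; rewrite mem_nseq => /andP[_ /eqP ->].
exists (H * N%:R `^ al * N%:R ^+ k).
  by rewrite !mulr_gt0 ?powR_gt0 ?exprn_gt0.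
move=> x y v Ux Uy v1.
have [u [-> u1]] : exists u, v = N%:R *: u /\ enorm u <= 1.
  exists (N%:R^-1 *: v); split; first by rewrite scalerA mulfV ?scale1r.
  apply: (le_trans (enorm_le_norm _)).
  by rewrite normrZ gtr0_norm// mulrA mulfV// mul1r.
rewrite !derivsZ// -mulrBr normrM [`|_ ^+ _|]ger0_norm ?exprn_ge0//.
rewrite [leRHS](_ : _ = N%:R ^+ k * (H * (N%:R `^ al * `|x - y| `^ al))); last by ring.
rewrite ler_wpM2l ?exprn_ge0//; apply: (le_trans (key _ _ _ Ux Uy u1)).
rewrite ler_wpM2l ?(ltW H0)// -powRM// ge0_ler_powR ?nnegrE ?(ltW al0) ?mulr_ge0//.
  exact: sqrtr_ge0.
exact: enorm_le_norm.
Qed.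

End holder.
End derivatives.

(** * The scale in R^N and the size of the jet at a given radius *)

Section full_scale.
Context {R : realType} {m : nat}.
Local Notation N := m.+1.
Implicit Types (x y z v : 'rV[R]_N) (a : 'rV[R]_N -> R) (lam r s : R).
Variables (k : nat) (al : R) (U : set 'rV[R]_N) (a : 'rV[R]_N -> R) (L : R).
Hypotheses (al0 : 0 < al) (al1 : al <= 1) (oU : open U) (aH : holder_class k al U a).
Hypotheses (L0 : 0 < L) (aL : forall x y v, U x -> U y -> `|v| <= 1 ->
  `|derivs a (nseq k v) x - derivs a (nseq k v) y| <= L * `|x - y| `^ al).
Local Notation kap := (k%:R + al).
Local Notation E := {ffun 'I_N -> 'I_k.+1}.

Lemma dir_norm (f : E) : `|dir f : 'rV[R]_N| <= 1.
Proof.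
apply/rV_norm_leP => // i; rewrite mxE; case: eqP => _; first by rewrite normr1.
by rewrite ger0_norm ?node_le1// ltW// node_gt0.
Qed.

Definition line_jet lam v x (j : nat) (t : R) : R := derivs a (nseq j v) (x + t *: v) / lam.

Definition dir_scale lam (f : E) x : R := jet_scale k al (line_jet lam (dir f) x) 0.

Definition full_scale lam x : R := \sum_f dir_scale lam f x.

(** Comparable to the maximum of the Taylor polynomial at [x] over a ball of radius r. It linearises
    the scale: up to constants, [full_scale lam x <= r] means [jet_size x r] <= lam r^kap, see
    [scale_le_jet_size] and [jet_size_le_scale]. *)
Definition jet_size x r : R :=
  \sum_(f : E) \sum_(j < k.+1) `|derivs a (nseq j (dir f)) x| * r ^+ j.

Lemma line_jet0 lam v x j : line_jet lam v x j 0 = derivs a (nseq j v) x / lam.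
Proof. by rewrite /line_jet scale0r addr0. Qed.

Lemma jet_scale_line lam (f : E) x t :
  jet_scale k al (line_jet lam (dir f) x) t = dir_scale lam f (x + t *: dir f).
Proof. by apply: eq_bigr => j _; rewrite /line_jet scale0r addr0. Qed.

Lemma dir_scale_ge0 lam f x : 0 <= dir_scale lam f x.
Proof. exact: jet_scale_ge0. Qed.

Lemma full_scale_ge0 lam x : 0 <= full_scale lam x.
Proof. by apply: sumr_ge0 => f _; exact: dir_scale_ge0. Qed.

Lemma dir_scale_le_scale lam f x : dir_scale lam f x <= full_scale lam x.
Proof.
by rewrite /full_scale (bigD1 f)//= lerDl sumr_ge0// => g _; exact: dir_scale_ge0.
Qed.

Lemma jet_line lam v x p q : L <= lam -> `|v| <= 1 ->
  (forall t, t \in `[p, q] -> U (x + t *: v)) -> jet k al p q (line_jet lam v x).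
Proof.
move=> Llam v1 xU; have lam0 : 0 < lam by exact: lt_le_trans Llam.
split=> [j t jk tI|s t sI tI].
  have D := is_derive_derivs_line aH jk (xU t tI).
  rewrite /line_jet (_ : (fun t => _) =
    lam^-1 \*: (fun s => derivs a (nseq j v) (x + s *: v))); last first.
    by apply/funext => s /=; rewrite mulrC.
  by apply: is_derive_eq; rewrite mulrC.
rewrite /line_jet -mulrBl normrM normfV (gtr0_norm lam0) ler_pdivrMr//.
apply: (le_trans (aL (xU s sI) (xU t tI) v1)).
rewrite opprD addrACA subrr add0r -scalerBl normrZ mulrC.
apply: ler_pM; rewrite ?powR_ge0 ?(ltW L0)//.
rewrite ge0_ler_powR ?nnegrE ?(ltW al0) ?mulr_ge0//.
by rewrite ler_piMr.
Qed.

Lemma derivs_bound_dirs : exists2 C : R, 0 < C & forall x v j, (j <= k)%N -> U x -> `|v| <= 1 ->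
  `|derivs a (nseq j v) x| <= C * \sum_(f : E) `|derivs a (nseq j (dir f)) x|.
Proof.
have [C C0 CP] := @hpoly_bound R m k.
exists C => // x v j jk Ux v1; rewrite (derivs_hpoly oU aH)//.
apply: CP => // [f|i]; last by rewrite (le_trans (rV_coord_le _ _)).
rewrite -(derivs_hpoly oU aH)// (bigD1 f)//= lerDl.
by rewrite sumr_ge0.
Qed.

Lemma jet_size_ge0 x r : 0 <= r -> 0 <= jet_size x r.
Proof.
by move=> r0; apply: sumr_ge0 => f _; apply: sumr_ge0 => j _; rewrite mulr_ge0 ?exprn_ge0.
Qed.

Lemma jet_sizeE x r :
  jet_size x r = \sum_(j < k.+1) (\sum_(f : E) `|derivs a (nseq j (dir f)) x|) * r ^+ j.
Proof. by rewrite /jet_size exchange_big; apply: eq_bigr => j _; rewrite mulr_suml. Qed.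

Lemma jet_size_term x r (f : E) j : 0 <= r -> (j <= k)%N ->
  `|derivs a (nseq j (dir f)) x| * r ^+ j <= jet_size x r.
Proof.
move=> r0 jk; rewrite /jet_size (bigD1 f)//= (bigD1 (Ordinal (jk : (j < k.+1)%N)))//=.
rewrite -addrA lerDl addr_ge0// sumr_ge0// => [i _|g _].
  by rewrite mulr_ge0 ?exprn_ge0.
by apply: sumr_ge0 => i _; rewrite mulr_ge0 ?exprn_ge0.
Qed.

Lemma exp_kap_gt0 : 0 < kap :> R.
Proof. by rewrite ltr_wpDl. Qed.

Lemma function_bound : exists2 C : R, 1 <= C & forall y z r, 0 < r ->
  (forall w, `|w - y| <= 2 * r -> U w) -> `|z - y| <= 2 * r ->
  `|a z| <= C * (jet_size y r + L * r `^ kap).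
Proof.
have [C C0 CP] := derivs_bound_dirs.
exists (C * 2 ^+ k + 2 `^ kap + 1).
  by rewrite lerDr addr_ge0 ?powR_ge0// mulr_ge0 ?exprn_ge0// ltW.
move=> y z r r0 yU zy.
have r20 : 0 < 2 * r by rewrite mulr_gt0.
(* Dividing by 2 r instead of |z - y| gives |v| <= 1 and includes z = y. *)
pose v := (2 * r)^-1 *: (z - y).
have v1 : `|v| <= 1 by rewrite normrZ normfV gtr0_norm// ler_pdivrMl// mulr1.
have zE : z = y + (2 * r) *: v by rewrite /v scalerA mulfV ?gt_eqF// scale1r addrC subrK.
have lU t : t \in `[0, 2 * r] -> U (y + t *: v).
  rewrite in_itv/= => /andP[t0 tr]; apply: yU; rewrite addrAC subrr add0r normrZ ger0_norm//.
  by rewrite -[leRHS]mulr1 ler_pM.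
have jF := jet_line (lexx L) v1 lU.
have I0 : 0 \in `[0, 2 * r] by rewrite in_itv/= lexx ltW.
have I2 : 2 * r \in `[0, 2 * r] by rewrite in_itv/= lexx ltW.
have := jet_taylor al0 jF I0 I2; rewrite subr0 (gtr0_norm r20).
rewrite {1}/line_jet -zE/= horner_poly => h.
set T := \sum_(i < _) _ in h.
have TE : `|L * T| <= C * 2 ^+ k * jet_size y r.
  rewrite /T mulr_sumr (le_trans (ler_norm_sum _ _ _))// jet_sizeE mulr_sumr.
  apply: ler_sum => -[j jk] _ /=.
  rewrite line_jet0 (_ : L * _ = derivs a (nseq j v) y * (2 * r) ^+ j / j`!%:R); last first.
    by field; rewrite pnatr_eq0 -lt0n fact_gt0 gt_eqF.
  have f1 : 1 <= j`!%:R :> R by rewrite ler1n fact_gt0.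
  rewrite normrM normfV [`|j`!%:R|]ger0_norm// ler_pdivrMr ?(lt_le_trans _ f1)//.
  rewrite -[leLHS]mulr1; apply: ler_pM => //.
  rewrite normrM normrX (gtr0_norm r20) exprMn.
  rewrite [leRHS](_ : _ = (C * \sum_(f : E) `|derivs a (nseq j (dir f)) y|) *
    (2 ^+ k * r ^+ j)); last by ring.
  apply: ler_pM; rewrite ?mulr_ge0 ?exprn_ge0 ?(ltW r0)//.
    by apply: CP => //; apply: yU; rewrite subrr normr0 ltW.
  by rewrite ler_wpM2r ?exprn_ge0 ?(ltW r0)// ler_weXn2l ?ler1n.
have aE : a z = L * (a z / L - T) + L * T by field; rewrite gt_eqF.
rewrite aE (le_trans (ler_normD _ _))//.
have h1 : `|L * (a z / L - T)| <= 2 `^ kap * (L * r `^ kap).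
  rewrite normrM (gtr0_norm L0) mulrCA ler_wpM2l ?(ltW L0)//.
  by rewrite -powRM ?(ltW r0).
have Lr0 : 0 <= L * r `^ kap by rewrite mulr_ge0 ?powR_ge0 ?(ltW L0).
have s0 := jet_size_ge0 y (ltW r0).
have p0 : 0 <= 2 `^ kap :> R by exact: powR_ge0.
have c0 : 0 <= C * 2 ^+ k by rewrite mulr_ge0 ?exprn_ge0// ltW.
have h2 : 0 <= C * 2 ^+ k * (L * r `^ kap) by rewrite mulr_ge0.
have h3 : 0 <= 2 `^ kap * jet_size y r by rewrite mulr_ge0.
by move: h1 TE s0 Lr0 h2 h3; rewrite !mulrDl !mulrDr mul1r; clear; lra.
Qed.

(** The derivatives at [x] are recovered from values of [a] alone. [function_bound] at [y] controls
    [a] on the segments of parameter length r issuing from [x], which stay within 2 r of [y];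
    Taylor's formula at [x] carries this over to the Taylor polynomial, and interpolation bounds its
    coefficients. *)
Lemma jet_size_compare : exists2 C : R, 1 <= C & forall x y r, 0 < r ->
  (forall w, `|w - y| <= 2 * r -> U w) -> `|x - y| <= r ->
  jet_size x r <= C * (jet_size y r + L * r `^ kap).
Proof.
have [C C1 CP] := function_bound.
have [D D0 DP] := @poly_coef_bound R k.
have C0 : 0 < C by exact: lt_le_trans C1.
pose K : R := #|{: E}|%:R * k.+1%:R.
exists (1 + K * (k`!%:R * D * (C + 1))).
  by rewrite lerDl !mulr_ge0 ?addr_ge0 ?(ltW D0) ?(ltW C0).
move=> x y r r0 yU xy.
set A := jet_size y r + L * r `^ kap.
have s0 := jet_size_ge0 y (ltW r0).
have Lr0 : 0 <= L * r `^ kap by rewrite mulr_ge0 ?powR_ge0 ?(ltW L0).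
have A0 : 0 <= A by rewrite addr_ge0.
apply: (@le_trans _ _ (K * (k`!%:R * D * (C + 1) * A))); last first.
  by rewrite mulrDl mul1r mulrA lerDr.
suff bnd (f : E) (j : 'I_k.+1) :
    `|derivs a (nseq j (dir f)) x| * r ^+ j <= k`!%:R * D * (C + 1) * A.
  apply: (@le_trans _ _ (\sum_(f : E) \sum_(j < k.+1) (k`!%:R * D * (C + 1) * A))).
    by apply: ler_sum => f _; apply: ler_sum.
  rewrite !sumr_const card_ord -[leLHS]mulr_natl -[X in _ * X <= _]mulr_natl.
  by rewrite /K -[leRHS]mulrA.
case: j => j jk' /=; have jk : (j <= k)%N by [].
have xU t : t \in `[0, r] -> U (x + t *: dir f) /\ `|a (x + t *: dir f)| <= C * A.
  rewrite in_itv/= => /andP[t0 tr].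
  have h : `|x + t *: dir f - y| <= 2 * r.
    rewrite addrAC (le_trans (ler_normD _ _))// mulr_natl mulr2n lerD// normrZ ger0_norm//.
    by rewrite -[leRHS]mulr1 ler_pM// dir_norm.
  by split; [exact: yU|exact: CP].
have jF := jet_line (lexx L) (dir_norm f) (fun t tI => (xU t tI).1).
have I0 : 0 \in `[0, r] by rewrite in_itv/= lexx ltW.
pose P := tpoly (line_jet L (dir f) x) 0 k.
(* The Taylor polynomial rescaled from [0, r] to [0, 1], where the nodes are; its coefficients then
   carry the factors r^i of [jet_size]. *)
pose Q : {poly R} := \poly_(i < k.+1) (P`_i * r ^+ i).
have QE s : Q.[s] = P.[r * s].
  rewrite horner_poly (horner_coef_wide _ (size_tpoly _ _ _)).
  by apply: eq_bigr => i _; rewrite exprMn; ring.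
have Qb (i : 'I_k.+1) : `|Q.[node i]| <= (C * A + L * r `^ kap) / L.
  rewrite QE; have tI : r * node i \in `[0, r].
    by rewrite in_itv/= mulr_ge0 ?(ltW r0) ?(ltW (node_gt0 _))//= ler_piMr ?node_le1 ?(ltW r0).
  have := jet_taylor al0 jF I0 tI; rewrite subr0 -/P {1}/line_jet/= => h.
  have t0 : 0 <= r * node i by rewrite mulr_ge0 ?(ltW r0) ?(ltW (node_gt0 _)).
  have h2 : `|r * node i| `^ kap <= r `^ kap.
    rewrite ge0_ler_powR ?nnegrE ?(ltW exp_kap_gt0) ?(ltW r0)// ger0_norm//.
    by rewrite ler_piMr ?node_le1 ?(ltW r0).
  have h3 : `|a (x + (r * node i) *: dir f) / L| <= C * A / L.
    rewrite normrM normfV (gtr0_norm L0) ler_wpM2r ?invr_ge0 ?(ltW L0)//.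
    exact: (xU _ tI).2.
  have -> : P.[r * node i] = a (x + (r * node i) *: dir f) / L -
     (a (x + (r * node i) *: dir f) / L - P.[r * node i]) by ring.
  rewrite (le_trans (ler_normB _ _))// mulrDl lerD//.
  by rewrite mulrAC mulfV ?gt_eqF// mul1r (le_trans h).
have := DP Q _ (size_poly _ _) Qb j.
rewrite !coef_poly jk' line_jet0 => h.
have f1 : 0 < j`!%:R :> R by rewrite ltr0n fact_gt0.
have -> : `|derivs a (nseq j (dir f)) x| * r ^+ j =
   j`!%:R * L * `|derivs a (nseq j (dir f)) x / L / j`!%:R * r ^+ j|.
  rewrite !normrM !normfV (gtr0_norm f1) (gtr0_norm L0) [`|r ^+ j|]ger0_norm ?exprn_ge0 ?(ltW r0)//.
  by field; rewrite !gt_eqF.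
apply: (le_trans (ler_wpM2l _ h)); first by rewrite mulr_ge0 ?(ltW L0).
rewrite [leLHS](_ : _ = j`!%:R * (D * (C * A + L * r `^ kap))); last by field; rewrite gt_eqF.
rewrite [leRHS](_ : _ = k`!%:R * (D * ((C + 1) * A))); last by ring.
apply: ler_pM => //.
- by rewrite mulr_ge0 ?(ltW D0)// addr_ge0// mulr_ge0// ltW.
- by rewrite ler_nat leq_fact.
rewrite ler_wpM2l ?(ltW D0)// mulrDl mul1r lerD2l.
by rewrite /A lerDr.
Qed.

End full_scale.

(** * Comparing scales at nearby points *)

Section scale_comparison.
Context {R : realType} {m : nat}.
Local Notation N := m.+1.
Implicit Types (x y z v : 'rV[R]_N) (a : 'rV[R]_N -> R) (lam r s : R).
Variables (k : nat) (al : R) (U : set 'rV[R]_N) (a : 'rV[R]_N -> R) (L : R).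
Hypotheses (al0 : 0 < al) (al1 : al <= 1) (oU : open U) (aH : holder_class k al U a).
Hypotheses (L0 : 0 < L) (aL : forall x y v, U x -> U y -> `|v| <= 1 ->
  `|derivs a (nseq k v) x - derivs a (nseq k v) y| <= L * `|x - y| `^ al).
Local Notation kap := (k%:R + al).
Local Notation E := {ffun 'I_N -> 'I_k.+1}.
Local Notation full_scale := (full_scale k al a).
Local Notation jet_size := (jet_size k a).

Definition nterms : R := #|{: E}|%:R * k.+1%:R.

Lemma card_dirs_gt0 : (0 < #|{: E}|)%N.
Proof. by apply/card_gt0P; exists [ffun=> ord0]. Qed.

Lemma nterms_ge1 : 1 <= nterms.
Proof. by rewrite /nterms -natrM ler1n muln_gt0 card_dirs_gt0. Qed.

Lemma powR_split s j : 0 < s -> s `^ kap = s `^ (kap - j%:R) * s ^+ j.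
Proof.
move=> s0; rewrite -powR_mulrn ?(ltW s0)// -powRD ?subrK//.
by apply/implyP => _; rewrite gt_eqF.
Qed.

Lemma abs_le_scale lam x : 0 < lam -> `|a x| <= lam * full_scale lam x `^ kap.
Proof.
move=> lam0; pose f : E := [ffun=> ord0].
have := jet_le_scale (line_jet a lam (dir f) x) 0 al0 (leq0n k).
rewrite line_jet0/= subr0 normrM normfV (gtr0_norm lam0) ler_pdivrMr// mulrC => h.
apply: (le_trans h); rewrite ler_wpM2l ?(ltW lam0)//.
rewrite ge0_ler_powR ?nnegrE ?dir_scale_ge0 ?full_scale_ge0 ?(ltW (exp_kap_gt0 _ al0))//.
exact: dir_scale_le_scale.
Qed.

Lemma scale_le_jet_size lam x s B : 0 < lam -> 0 < s -> 1 <= B ->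
  jet_size x s <= B * lam * s `^ kap -> full_scale lam x <= nterms * B `^ al^-1 * s.
Proof.
move=> lam0 s0 B1 h; rewrite /nterms.
apply: (@le_trans _ _ (\sum_(f : E) (k.+1%:R * B `^ al^-1 * s))); last first.
  rewrite sumr_const -[leLHS]mulr_natl; by rewrite !mulrA.
apply: ler_sum => f _; apply: jet_scale_le => // [|j jk]; first exact: ltW.
rewrite line_jet0 normrM normfV (gtr0_norm lam0) ler_pdivrMr//.
have sj : 0 < s ^+ j by rewrite exprn_gt0.
rewrite -(ler_pM2r sj) (le_trans (jet_size_term _ _ _ (ltW s0) jk))// (le_trans h)//.
by rewrite (powR_split j s0) le_eqVlt; apply/orP; left; apply/eqP; ring.
Qed.

Lemma jet_size_le_scale lam x r c : 0 < lam -> 0 < r -> 0 < c -> c <= 1 ->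
  full_scale lam x <= c * r -> jet_size x r <= nterms * c `^ al * lam * r `^ kap.
Proof.
move=> lam0 r0 c0 c1 h.
have cr0 : 0 < c * r by rewrite mulr_gt0.
apply: (@le_trans _ _ (\sum_(f : E) \sum_(j < k.+1) (c `^ al * lam * r `^ kap))); last first.
  rewrite !sumr_const card_ord -[leLHS]mulr_natl -[X in _ * X <= _]mulr_natl.
  by rewrite /nterms !mulrA.
apply: ler_sum => f _; apply: ler_sum => -[j jk'] _ /=; have jk : (j <= k)%N by [].
have := jet_le_scale (line_jet a lam (dir f) x) 0 al0 jk.
rewrite line_jet0/= normrM normfV (gtr0_norm lam0) ler_pdivrMr// => h1.
have h2 : `|derivs a (nseq j (dir f)) x| <= lam * (c `^ al * r `^ (kap - j%:R)).
  apply: (le_trans h1); rewrite mulrC ler_wpM2l ?(ltW lam0)//.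
  apply: (@le_trans _ _ ((c * r) `^ (kap - j%:R))).
    rewrite ge0_ler_powR ?nnegrE ?dir_scale_ge0 ?(ltW cr0) ?(ltW (expo_gt0 al0 jk))//.
    by apply: le_trans h; exact: dir_scale_le_scale.
  rewrite powRM ?(ltW c0) ?(ltW r0)// ler_wpM2r ?powR_ge0//.
  by apply: ler_powR_le1; rewrite ?(ltW c0) ?(ltW al0) ?expo_ge.
rewrite (powR_split j r0).
rewrite [leRHS](_ : _ = lam * (c `^ al * r `^ (kap - j%:R)) * r ^+ j); last by ring.
by rewrite ler_wpM2r ?exprn_ge0 ?(ltW r0).
Qed.

Lemma jet_size_rescale x r s : 0 < r -> r <= s -> jet_size x s <= (s / r) ^+ k * jet_size x r.
Proof.
move=> r0 rs; rewrite mulr_sumr; apply: ler_sum => f _.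
rewrite mulr_sumr; apply: ler_sum => -[j jk] _ /=.
rewrite mulrCA ler_wpM2l//.
have -> : s ^+ j = (s / r) ^+ j * r ^+ j by rewrite -exprMn divfK ?gt_eqF.
rewrite ler_wpM2r ?exprn_ge0 ?(ltW r0)//.
by rewrite ler_weXn2l// ler_pdivlMr// mul1r.
Qed.

(** Descending from a radius s comparable to the scale to r <= s costs the jet at most (s/r)^k,
    whereas s^kap exceeds r^kap by (s/r)^(k + al). The surplus (s/r)^al lets the jet dominate the
    Hölder term on small balls. *)
Lemma jet_size_ge_scale lam x r A : 0 < lam -> 0 < r -> 2 * nterms <= A ->
  A * r <= full_scale lam x -> lam * (A / (2 * nterms)) `^ al * r `^ kap <= jet_size x r.
Proof.
move=> lam0 r0 KA h.
have K0 : 0 < nterms by exact: lt_le_trans nterms_ge1.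
have K20 : 0 < 2 * nterms by rewrite mulr_gt0.
pose s := full_scale lam x / (2 * nterms).
have A1 : 1 <= A / (2 * nterms) by rewrite ler_pdivlMr// mul1r.
have As : A / (2 * nterms) * r <= s by rewrite /s mulrAC ler_wpM2r// invr_ge0 ltW.
have rs : r <= s by apply: le_trans As; rewrite ler_peMl// ltW.
have s0 : 0 < s by exact: lt_le_trans rs.
(* Otherwise [scale_le_jet_size] would bound the scale by nterms s, which is half of it. *)
have big : lam * s `^ kap <= jet_size x s.
  rewrite leNgt; apply/negP => /ltW.
  rewrite -[X in _ <= X * _]mul1r => /(scale_le_jet_size lam0 s0 (lexx 1)).
  rewrite powR1 mulr1 (_ : full_scale lam x = 2 * nterms * s); last first.
    by rewrite /s mulrC divfK// gt_eqF.
  by rewrite -mulrA -subr_ge0 (_ : _ - _ = - (nterms * s)); [rewrite oppr_ge0 leNgt mulr_gt0|ring].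
have := le_trans big (jet_size_rescale x r0 rs).
have sr0 : 0 < (s / r) ^+ k by rewrite exprn_gt0// divr_gt0.
rewrite -ler_pdivrMl//; apply: le_trans.
rewrite -mulrA [leRHS]mulrCA ler_wpM2l ?(ltW lam0)//.
rewrite ler_pdivlMl//.
have -> : s `^ kap = (s / r) ^+ k * (s / r) `^ al * r `^ kap.
  have sr : 0 <= s / r by rewrite divr_ge0 ?(ltW s0) ?(ltW r0).
  rewrite -(powR_mulrn k sr) -powRD.
    by rewrite -(powRM _ sr (ltW r0)) divfK// gt_eqF.
  by apply/implyP => _; rewrite gt_eqF// divr_gt0.
rewrite -[leRHS]mulrA ler_wpM2l ?(ltW sr0)// ler_wpM2r ?powR_ge0//.
have A0 : 0 <= A / (2 * nterms) by exact: le_trans A1.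
have Asr : A / (2 * nterms) <= s / r by rewrite ler_pdivlMr.
by rewrite ge0_ler_powR ?nnegrE ?(ltW al0)// (le_trans A0).
Qed.

(** [jet_size_compare], translated from and back to scales; L <= lam absorbs its Hölder term L s^kap
    into lam s^kap. *)
Lemma scale_compare : exists2 C : R, 1 <= C & forall lam x y s, L <= lam -> 0 < s ->
  (forall w, `|w - y| <= 2 * s -> U w) -> full_scale lam y <= s -> `|x - y| <= s ->
  full_scale lam x <= C * s.
Proof.
have [C C1 CP] := jet_size_compare al0 oU aH L0 aL.
have C0 : 0 < C by exact: lt_le_trans C1.
have K1 := nterms_ge1.
have CK : 1 <= C * (nterms + 1).
  by rewrite -[leLHS]mul1r ler_pM// (le_trans K1)// lerDl.
exists (nterms * (C * (nterms + 1)) `^ al^-1).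
  rewrite -[leLHS]mul1r ler_pM// -[leLHS](powRr0 (C * (nterms + 1))) ler_powR//.
  by rewrite invr_ge0 ltW.
move=> lam x y s Llam s0 yU ys xy.
have lam0 : 0 < lam by exact: lt_le_trans Llam.
apply: scale_le_jet_size => //.
apply: (le_trans (CP x y s s0 yU xy)).
have := @jet_size_le_scale lam y s 1 lam0 s0 ltr01 (lexx 1); rewrite mul1r => /(_ ys).
rewrite powR1 mulr1 => h.
rewrite -!mulrA ler_wpM2l ?(ltW C0)// mulrDl mul1r !mulrA lerD//.
by rewrite ler_wpM2r ?powR_ge0.
Qed.

Lemma derivs_continuous v j x : (j <= k)%N -> `|v| <= 1 -> U x ->
  {for x, continuous (derivs a (nseq j v))}.
Proof.
move=> jk v1 Ux; rewrite leq_eqVlt in jk; case/orP: jk => [/eqP ->|jk]; last first.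
  by apply: differentiable_continuous; apply: aH.1 => //; rewrite size_nseq.
apply/(@cvgrPdist_lt _ _ _ (nbhs x) (nbhs_filter x)) => e e0.
have nU : nbhs x U by exact: open_nbhs_nbhs.
have eL0 : 0 < (e / L) `^ al^-1 by rewrite powR_gt0// divr_gt0.
have nB : nbhs x (ball x ((e / L) `^ al^-1)) by exact: nbhsx_ballx.
apply: filterS (filterI nU nB) => y [Uy]; rewrite -ball_normE /= => xy.
apply: (@le_lt_trans _ _ (L * `|x - y| `^ al)); first exact: aL.
rewrite mulrC -ltr_pdivlMr//.
have -> : e / L = ((e / L) `^ al^-1) `^ al.
  by rewrite -powRrM mulVf ?gt_eqF// powRr1// divr_ge0 ?ltW.
by rewrite gt0_ltr_powR ?nnegrE ?powR_ge0.
Qed.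

Lemma jet_size_continuous r x : U x -> {for x, continuous (jet_size ^~ r)}.
Proof.
move=> Ux; have FF : Filter (nbhs x) := nbhs_filter x.
rewrite /continuous_at /jet_size.
apply: (cvg_big add_continuous) => f _; apply: (cvg_big add_continuous) => j _.
have jk : (j <= k)%N by rewrite -ltnS.
apply: cvgM; last exact: cvg_cst.
apply: cvg_norm; exact: derivs_continuous jk (dir_norm f) Ux.
Qed.

End scale_comparison.

(** * Lebesgue measure on R^n: translations, shears and cubes *)

Section lebesgue_rV.
Context {R : realType}.
Local Notation mu := (@lebesgue_measure R).

Lemma continuous_measurable_rV_map n p (f : 'rV[R]_n -> 'rV[R]_p) :
  continuous f -> measurable_fun setT f.
Proof.
move=> cf; apply: (@measurability _ _ _ _ _ _ (@open 'rV[R]_p)) => //.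
move=> _ [B oB <-]; rewrite setTI; apply: open_measurable_rV.
by apply: open_comp => // x _; exact: cf.
Qed.

Lemma integral_lebS n (f : 'rV[R]_n.+1 -> \bar R) : measurable_fun setT f ->
  (forall x, 0 <= f x)%E ->
  (\int[leb R n.+1]_x f x = \int[mu]_t \int[leb R n]_y f (rV_cons (t, y)))%E.
Proof.
move=> mf f0.
have mc : measurable_fun [set: measurableTypeR R * 'rV[R]_n]
    (@rV_cons R n : measurableTypeR R * 'rV[R]_n -> 'rV[R]_n.+1).
  exact: measurable_rV_cons.
pose g : measurableTypeR R * 'rV[R]_n -> \bar R := f \o @rV_cons R n.
have mg : measurable_fun setT g by exact: measurableT_comp mf mc.
have := @ge0_integral_pushforward _ _ (measurableTypeR R * 'rV[R]_n)%type _ R _ mc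
    (lebesgue_measure \x leb R n)%E setT f measurableT mf (fun y _ => f0 y).
rewrite preimage_setT => h; apply: etrans h _.
by apply: etrans (fubini_tonelli1 g mg _) _ => // p; exact: f0.
Qed.

Lemma rV_consD n (t s : R) (x y : 'rV[R]_n) :
  rV_cons (t, x) + rV_cons (s, y) = rV_cons (t + s, x + y).
Proof.
apply/rowP => i; rewrite mxE.
case: (unliftP ord0 i) => [j|] ->; first by rewrite !rV_cons_lift mxE.
by rewrite !rV_cons_ord0.
Qed.

Lemma rV_consK n (x : 'rV[R]_n.+1) :
  rV_cons (x ord0 ord0, \row_i x ord0 (lift ord0 i)) = x.
Proof.
apply/rowP => i.
case: (unliftP ord0 i) => [j|] ->; first by rewrite rV_cons_lift mxE.
by rewrite rV_cons_ord0.
Qed.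

Lemma ge0_integral_leb_shift n (f : 'rV[R]_n -> \bar R) (c : 'rV[R]_n) :
  measurable_fun setT f -> (forall x, 0 <= f x)%E ->
  (\int[leb R n]_x f (x + c)%R = \int[leb R n]_x f x)%E.
Proof.
elim: n f c => [|n IH] f c mf f0.
  by apply: eq_integral => x _; congr f; apply/rowP => -[].
have mfc : measurable_fun setT (f \o @rV_cons R n).
  exact: measurableT_comp mf (@measurable_rV_cons R n).
have fc0 p : (0 <= (f \o @rV_cons R n) p)%E by exact: f0.
have mfs : measurable_fun setT (fun x : 'rV[R]_n.+1 => f (x + c)).
  apply: measurableT_comp mf _; apply: continuous_measurable_rV_map => x.
  by apply: continuousD => //; exact: cst_continuous.
rewrite (integral_lebS mf f0) (integral_lebS mfs (fun x => f0 _)).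
set c0 := c ord0 ord0; set c' := \row_i c ord0 (lift ord0 i).
have mS t : measurable_fun setT (fun y => f (rV_cons (t, y))).
  exact: (measurableT_comp mfc (pair1_measurable t)).
pose h t := (\int[leb R n]_y f (rV_cons (t, y)))%E.
transitivity (\int[mu]_t h (t + c0)%R)%E.
  apply: eq_integral => t _; rewrite /h.
  rewrite -(IH (fun y => f (rV_cons (t + c0, y))) c')//.
  by apply: eq_integral => y _; rewrite -{1}(rV_consK c) rV_consD.
rewrite (ge0_integral_shift c0)//.
- exact: (measurable_fun_fubini_tonelli_F _ mfc fc0).
- by move=> t; apply: integral_ge0 => y _; exact: f0.
Qed.

(** This is the continuous map x |-> x + x_0 (v - e_0) composed with [rV_cons]. *)
Lemma measurable_shear n (v : 'rV[R]_n.+1) :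
  measurable_fun setT (fun p : measurableTypeR R * 'rV[R]_n => rV_cons (0, p.2) + p.1 *: v).
Proof.
pose w := v - delta_mx ord0 ord0.
pose sh (x : 'rV[R]_n.+1) := x + x ord0 ord0 *: w.
have msh : measurable_fun setT sh.
  apply: continuous_measurable_rV_map => x; rewrite /sh.
  apply: (@continuousD _ _ _ id (fun x : 'rV[R]_n.+1 => x ord0 ord0 *: w)); first by [].
  by apply: continuousZ; [exact: coord_continuous|exact: cst_continuous].
rewrite (_ : (fun p => _) = sh \o @rV_cons R n).
  apply: measurableT_comp msh _; exact: measurable_rV_cons.
apply/funext => -[t y] /=.
have e : rV_cons (t, y) = rV_cons (0, y) + t *: delta_mx ord0 ord0.
  apply/rowP => i; rewrite [RHS]mxE.
  case: (unliftP ord0 i) => [j|] ->; rewrite ?rV_cons_lift ?rV_cons_ord0/=.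
    by rewrite !mxE/= mulr0 addr0.
  by rewrite !mxE/= mulr1 add0r.
by rewrite /sh rV_cons_ord0/= {1}e /w scalerBr [t *: v - _]addrC addrA addrK.
Qed.

Lemma measurable_integral_lines n (f : 'rV[R]_n.+1 -> \bar R) (v : 'rV[R]_n.+1) :
  measurable_fun setT f -> (forall x, 0 <= f x)%E ->
  measurable_fun setT (fun y : 'rV[R]_n => \int[mu]_t f (rV_cons (0, y) + t *: v)%R)%E.
Proof.
move=> mf f0.
pose g (p : measurableTypeR R * 'rV[R]_n) := f (rV_cons (0, p.2) + p.1 *: v).
have mg : measurable_fun setT g by exact: measurableT_comp mf (measurable_shear v).
by apply: (measurable_fun_fubini_tonelli_G g mg) => p; exact: f0.
Qed.

(* The hypothesis v ord0 ord0 = 1 makes the shear t e_0 + y |-> t v + y measure preserving. *)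
Lemma ge0_integral_leb_lines n (f : 'rV[R]_n.+1 -> \bar R) (v : 'rV[R]_n.+1) :
  v ord0 ord0 = 1 -> measurable_fun setT f -> (forall x, 0 <= f x)%E ->
  (\int[leb R n.+1]_x f x =
   \int[leb R n]_y \int[mu]_t f (rV_cons (0, y) + t *: v)%R)%E.
Proof.
move=> v1 mf f0.
set v' := \row_i v ord0 (lift ord0 i).
have vE t (y : 'rV[R]_n) : rV_cons (0, y) + t *: v = rV_cons (t, y + t *: v').
  rewrite -(rV_consK v) v1 (_ : t *: rV_cons (1, v') = rV_cons (t, t *: v')).
    by rewrite rV_consD add0r.
  apply/rowP => i; rewrite mxE.
  case: (unliftP ord0 i) => [j|] ->; first by rewrite !rV_cons_lift /= [RHS]mxE.
  by rewrite !rV_cons_ord0 mulr1.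
have mfc : measurable_fun setT (f \o @rV_cons R n).
  exact: measurableT_comp mf (@measurable_rV_cons R n).
have mS t : measurable_fun setT (fun y => f (rV_cons (t, y))).
  exact: (measurableT_comp mfc (pair1_measurable t)).
pose g (p : measurableTypeR R * 'rV[R]_n) := f (rV_cons (0, p.2) + p.1 *: v).
have mg : measurable_fun setT g by exact: measurableT_comp mf (measurable_shear v).
rewrite (integral_lebS mf f0).
transitivity (\int[mu]_t \int[leb R n]_y g (t, y))%E.
  apply: eq_integral => t _.
  rewrite -(ge0_integral_leb_shift (t *: v') (mS t))//.
  by apply: eq_integral => y _; rewrite /g /= vE.
by apply: (fubini_tonelli g mg) => p; exact: f0.
Qed.

Definition cube n (x : 'rV[R]_n) (r : R) : set 'rV[R]_n := [set y | `|y - x| <= r].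

Lemma measurable_cube n (x : 'rV[R]_n) r : measurable (cube x r).
Proof.
rewrite (_ : cube x r = (fun y => `|y - x|) @^-1` `]-oo, r]).
  rewrite -[X in measurable X]setTI.
  apply: continuous_measurable_rV => // y.
  apply: continuous_comp; last exact: norm_continuous.
  by apply: continuousB => //; exact: cst_continuous.
by apply/seteqP; split => y /=; rewrite in_itv.
Qed.

Lemma leb_cube n (x : 'rV[R]_n) r : 0 <= r -> leb R n (cube x r) = ((2 * r) ^+ n)%:E.
Proof.
move=> r0.
have -> : cube x r = [set v | forall i, x ord0 i - r <= v ord0 i <= x ord0 i + r].
  apply/seteqP; split => y /=.
    by move=> /(rV_norm_leP _ r0) h i; have := h i; rewrite !mxE ler_distl.
  by move=> h; apply/rV_norm_leP => // i; rewrite !mxE ler_distl.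
rewrite leb_box => [|i]; last by lra.
congr EFin; rewrite -[n in RHS]card_ord -prodr_const; apply: eq_bigr => i _; ring.
Qed.

End lebesgue_rV.

(** * The integral of rho (a / lam)^(-1/kap) over a cube *)

Section cube_integral.
Context {R : realType} {m : nat}.
Local Notation N := m.+1.
Local Notation mu := (@lebesgue_measure R).
Implicit Types (x y z v : 'rV[R]_N) (lam r s : R).
Variables (k : nat) (al : R) (U : set 'rV[R]_N) (a : 'rV[R]_N -> R) (L : R).
Hypotheses (al0 : 0 < al) (al1 : al <= 1) (oU : open U) (aH : holder_class k al U a).
Hypotheses (L0 : 0 < L) (aL : forall x y v, U x -> U y -> `|v| <= 1 ->
  `|derivs a (nseq k v) x - derivs a (nseq k v) y| <= L * `|x - y| `^ al).
Local Notation kap := (k%:R + al).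
Local Notation E := {ffun 'I_N -> 'I_k.+1}.
Local Notation full_scale := (full_scale k al a).
Local Notation dir_scale := (@dir_scale R m k al a).

Lemma continuous_on_measurable_rV n (V : set 'rV[R]_n) (f : 'rV[R]_n -> R) : open V ->
  (forall z : 'rV[R]_n, V z -> {for z, continuous f}) -> measurable_fun V f.
Proof.
move=> oV cf; apply: (measurability _ (RGenOpens.measurableE R)).
move=> _ [_ [b [c ->]] <-]; apply: open_measurable_rV.
rewrite openE => x [Vx fx]; apply: filterI; first exact: open_nbhs_nbhs.
apply: cf => //; apply: open_nbhs_nbhs; split => //; exact: interval_open.
Qed.

Lemma measurable_derivs j v : (j <= k)%N -> `|v| <= 1 -> measurable_fun U (derivs a (nseq j v)).
Proof.
move=> jk v1; apply: continuous_on_measurable_rV => // x Ux.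
exact: (derivs_continuous al0 oU aH L0 aL jk v1 Ux).
Qed.

Lemma measurable_a : measurable_fun U a.
Proof. by have := @measurable_derivs 0%N 0 isT; rewrite normr0; apply. Qed.

Lemma measurable_dir_scale lam (f : E) : measurable_fun U (dir_scale lam f).
Proof.
apply: measurable_sum => j.
apply: (measurableT_comp (measurable_powR _)).
apply: measurableT_comp => //.
under eq_fun do rewrite line_jet0.
apply: measurable_funM => //; apply: measurable_derivs; last exact: dir_norm.
by rewrite -ltnS.
Qed.

Lemma measurable_scale lam : measurable_fun U (full_scale lam).
Proof. by apply: measurable_sum => f; exact: measurable_dir_scale. Qed.

Lemma measurable_inv_pow_a d lam : measurable_fun U (fun x => inv_pow d (a x / lam)).
Proof.
apply: (measurableT_comp (measurable_inv_pow d)).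
by apply: measurable_funM => //; exact: measurable_a.
Qed.

(** Fubini along the lines in direction [dir f]. The constant is the product of the length 2 r of
    the parameter interval, the volume (4 r)^m of the base, and the one-dimensional constant. *)
Lemma cube_integral_dir (f : E) (C1 : R) : 0 < C1 ->
  exists2 C : R, 0 < C & forall lam x0 r, L <= lam -> 0 < r ->
  cube x0 (3 * r) `<=` U ->
  (forall y, cube x0 (3 * r) y -> full_scale lam y <= C1 * r) ->
  (\int[leb R N]_(y in cube x0 r) ((dir_scale lam f y)%:E * inv_pow kap^-1 (a y / lam)%R) <=
    (C * r ^+ N)%:E)%E.
Proof.
(* The parameter interval has length 2 r, of which C1 r is the multiple C1 / 2. *)
move=> C10; have C12 : 0 < C1 / 2 by rewrite divr_gt0.
have [C C0 CP] := jet_integral k al0 al1 C12.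
exists (C * 2 * 4 ^+ m); first by rewrite !mulr_gt0 ?exprn_gt0.
move=> lam x0 r Llam r0 cU sle.
have lam0 : 0 < lam by exact: lt_le_trans Llam.
set g := fun y => ((dir_scale lam f y)%:E * inv_pow kap^-1 (a y / lam)%R)%E.
have g0 y : (0 <= g y)%E by rewrite mule_ge0 ?inv_pow_ge0// lee_fin dir_scale_ge0.
have mg : measurable_fun U g.
  apply: emeasurable_funM; last exact: measurable_inv_pow_a.
  by apply/measurable_EFinP; exact: measurable_dir_scale.
have [v [vE v1 v0]] : exists v : 'rV[R]_N, [/\ v = dir f, `|v| <= 1 & v ord0 ord0 = 1].
  by exists (dir f); split; rewrite ?dir_norm// mxE eqxx.
pose tail (x : 'rV[R]_N) : 'rV[R]_m := \row_i x ord0 (lift ord0 i).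
pose y0 := tail (x0 - x0 ord0 ord0 *: v).
pose p := x0 ord0 ord0 - r; pose q := x0 ord0 ord0 + r.
have pq : p < q by rewrite /p /q; lra.
(* A slanted box between the cubes of radii r and 3 r: every line in direction [v] either misses it
   or meets it exactly for t in [p, q], so [jet_integral] always sees an interval of full length. *)
pose P : set 'rV[R]_N := [set x : 'rV[R]_N |
  x ord0 ord0 \in `[p, q] /\ cube y0 (2 * r) (tail (x - x ord0 ord0 *: v))].
have mP : measurable P.
  have -> : P = (fun x : 'rV[R]_N => x ord0 ord0) @^-1` `[p, q] `&`
      (tail \o (fun x : 'rV[R]_N => x - x ord0 ord0 *: v)) @^-1` cube y0 (2 * r) by [].
  apply: measurableI.
    rewrite -[X in measurable X]setTI.
    by apply: continuous_measurable_rV => //; exact: coord_continuous.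
  rewrite -[X in measurable X]setTI.
  apply: (measurableT_comp (@measurable_rV_tail R m)) => //; last exact: measurable_cube.
  apply: continuous_measurable_rV_map => x.
  apply: (@continuousB _ _ _ id (fun x : 'rV[R]_N => x ord0 ord0 *: v)); first by [].
  by apply: continuousZ; [exact: coord_continuous|exact: cst_continuous].
have PE (y : 'rV[R]_m) t : P (rV_cons (0, y) + t *: v) <-> t \in `[p, q] /\ cube y0 (2 * r) y.
  have e0 : (rV_cons (0, y) + t *: v) ord0 ord0 = t.
    by rewrite mxE rV_cons_ord0/= add0r [LHS]mxE v0 mulr1.
  rewrite /P /= e0 addrK.
  suff -> : tail (rV_cons (0, y)) = y by [].
  by apply/rowP => i; rewrite mxE rV_cons_lift.
have Psub x : P x -> cube x0 (3 * r) x.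
  rewrite /P /cube /= => -[tI h].
  have t1 : `|x ord0 ord0 - x0 ord0 ord0| <= r.
    by move: tI; rewrite in_itv/= ler_distl.
  apply/rV_norm_leP => [|i]; first by rewrite mulr_ge0// ltW.
  have [j ->|->] := unliftP ord0 i; last first.
    by rewrite !mxE (le_trans t1)// ler_peMl ?(ltW r0)// ler1n.
  have := le_trans (rV_coord_le _ j) h; rewrite !mxE.
  set X := x _ (lift _ _); set X0 := x0 _ (lift _ _).
  set t := x ord0 ord0 in t1 *; set t0 := x0 ord0 ord0 in t1 *.
  move=> hj.
  have tv : `|(t - t0) * v ord0 (lift ord0 j)| <= r.
    rewrite normrM -[leRHS]mulr1 ler_pM//.
    exact: le_trans (rV_coord_le _ _) v1.
  have -> : X - X0 = (X - t * v ord0 (lift ord0 j) - (X0 - t0 * v ord0 (lift ord0 j))) +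
    (t - t0) * v ord0 (lift ord0 j) by ring.
  rewrite (le_trans (ler_normD _ _))// (_ : 3 * r = 2 * r + r); last by ring.
  by rewrite lerD.
have subP : cube x0 r `<=` P.
  move=> x /=; rewrite /cube/= => xr; split.
    have := le_trans (rV_coord_le _ ord0) xr; rewrite !mxE.
    by rewrite in_itv/= ler_distl.
  apply/rV_norm_leP => [|j]; first by rewrite mulr_ge0// ltW.
  have h0 := le_trans (rV_coord_le _ ord0) xr.
  have hj := le_trans (rV_coord_le _ (lift ord0 j)) xr.
  rewrite !mxE in h0 hj *.
  set X := x _ (lift _ _) in hj *; set X0 := x0 _ (lift _ _) in hj *.
  set w := v _ _.
  have w1 : `|w| <= 1 by exact: le_trans (rV_coord_le _ _) v1.
  set t := x ord0 ord0 in h0 *; set t0 := x0 ord0 ord0 in h0 *.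
  have -> : X - t * w - (X0 - t0 * w) = (X - X0) - (t - t0) * w by ring.
  rewrite (le_trans (ler_normB _ _))// mulr_natl mulr2n lerD// normrM -[leRHS]mulr1.
  by rewrite ler_pM.
have PU : P `<=` U by move=> x /Psub/cU.
have mgP : measurable_fun P g.
  by apply: measurable_funS mg => //; exact: open_measurable_rV.
apply: (@le_trans _ _ (\int[leb R N]_(y in P) g y)%E).
  by apply: ge0_subset_integral;
    [exact: measurable_cube|exact: mP|exact: mgP|by move=> y _; exact: g0|exact: subP].
rewrite integral_mkcond.
have h0 y : (0 <= (g \_ P) y)%E by rewrite patchE; case: ifP.
have mh : measurable_fun setT (g \_ P) by exact: ((measurable_restrictT g mP).1 mgP).
rewrite (ge0_integral_leb_lines v0 mh h0).
have inner (y : 'rV[R]_m) : (\int[mu]_t (g \_ P) (rV_cons (0, y) + t *: v)%R <=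
   ((cst (C * (2 * r))%:E) \_ (cube y0 (2 * r))) y)%E.
  rewrite patchE; have [/set_mem yI|yI] := boolP (y \in _); last first.
    rewrite integral0_eq ?lexx// => t _; rewrite patchE ifN//.
    by apply: contra yI => /set_mem/PE[_ h]; exact/mem_set.
  have -> : (\int[mu]_t (g \_ P) (rV_cons (0, y) + t *: v)%R =
     \int[mu]_(t in `[p, q]) ((jet_scale k al (line_jet a lam v (rV_cons (0%R, y))) t)%:E *
        inv_pow kap^-1 (line_jet a lam v (rV_cons (0%R, y)) 0%N t)))%E.
    rewrite [RHS]integral_mkcond; apply: eq_integral => t _; rewrite !patchE.
    have [tI|tI] := boolP (t \in `[p, q]%classic).
      rewrite (mem_set (proj2 (PE y t) (conj (set_mem tI) yI))).
      by rewrite vE jet_scale_line.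
    rewrite ifN//; apply: contra tI => /set_mem/PE[h _]; exact: mem_set.
  have lU t : t \in `[p, q] -> cube x0 (3 * r) (rV_cons (0, y) + t *: v).
    by move=> tI; apply: Psub; apply/PE.
  have jF : jet k al p q (line_jet a lam v (rV_cons (0%R, y))).
    by apply: (jet_line al0 aH L0 aL Llam v1) => t /lU /cU.
  have qp : q - p = 2 * r by rewrite /q /p; ring.
  rewrite -qp; apply: CP => // t /lU h.
  rewrite vE in h *; rewrite jet_scale_line qp mulrA divfK//.
  apply: le_trans (sle _ h); exact: dir_scale_le_scale.
apply: (@le_trans _ _ (\int[leb R m]_y ((cst (C * (2 * r))%:E) \_ (cube y0 (2 * r))) y)%E).
  apply: ge0_le_integral => //.
  - by move=> y _; apply: integral_ge0 => t _; exact: h0.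
  - exact: measurable_integral_lines.
  - exact: ((measurable_restrictT _ (measurable_cube _ _)).1 (measurable_cst _)).
rewrite -integral_mkcond integral_cst; last exact: measurable_cube.
rewrite [X in (_ * X)%E](leb_cube y0) ?mulr_ge0 ?(ltW r0)// -EFinM lee_fin.
rewrite le_eqVlt; apply/orP; left; apply/eqP.
by rewrite (_ : 4 = 2 * 2) ?exprMn ?exprS; ring.
Qed.

(** Each summand of the scale is integrated along its own direction. *)
Lemma cube_integral (C1 : R) : 0 < C1 ->
  exists2 C : R, 0 < C & forall lam x0 r, L <= lam -> 0 < r ->
  cube x0 (3 * r) `<=` U ->
  (forall y, cube x0 (3 * r) y -> full_scale lam y <= C1 * r) ->
  (\int[leb R N]_(y in cube x0 r) ((full_scale lam y)%:E * inv_pow kap^-1 (a y / lam)%R) <=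
    (C * r ^+ N)%:E)%E.
Proof.
move=> C10.
have /choice [D DP] : forall f : E, exists C : R, 0 < C /\ forall lam x0 r, L <= lam -> 0 < r ->
  cube x0 (3 * r) `<=` U ->
  (forall y, cube x0 (3 * r) y -> full_scale lam y <= C1 * r) ->
  (\int[leb R N]_(y in cube x0 r) ((dir_scale lam f y)%:E * inv_pow kap^-1 (a y / lam)%R) <=
    (C * r ^+ N)%:E)%E.
  by move=> f; have [C C0 CP] := cube_integral_dir f C10; exists C.
exists (\sum_f D f).
  rewrite (bigD1 [ffun=> ord0])//= ltr_wpDr ?(DP _).1// sumr_ge0// => f _.
  exact: ltW (DP f).1.
move=> lam x0 r Llam r0 cU sle.
have mU : measurable U by exact: open_measurable_rV.
have cU' : cube x0 r `<=` U.
  apply: subset_trans cU => y; rewrite /cube/= => /le_trans; apply.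
  by rewrite ler_peMl ?(ltW r0)// ler1n.
have -> : (\int[leb R N]_(y in cube x0 r) ((full_scale lam y)%:E * inv_pow kap^-1 (a y / lam)%R) =
  \int[leb R N]_(y in cube x0 r)
    \sum_(f : E) ((dir_scale lam f y)%:E * inv_pow kap^-1 (a y / lam)%R))%E.
  apply: eq_integral => y _; rewrite /full_scale -sumEFin ge0_sume_distrl// => f _.
  by rewrite lee_fin dir_scale_ge0.
rewrite ge0_integral_sum.
- by rewrite mulr_suml -sumEFin; apply: lee_sum => f _; exact: (DP f).2.
- exact: measurable_cube.
- move=> f; apply: emeasurable_funM.
    apply/measurable_EFinP; apply: measurable_funS mU cU' _; exact: measurable_dir_scale.
  apply: measurable_funS mU cU' _; exact: measurable_inv_pow_a.
- by move=> f y _; rewrite mule_ge0 ?inv_pow_ge0// lee_fin dir_scale_ge0.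
Qed.

End cube_integral.

(** * Uniform margins, bounds and finite covers from compactness *)

Section compactness.
Context {R : realType} {n : nat}.
Implicit Types (K U : set 'rV[R]_n) (x y : 'rV[R]_n) (r : R).

Lemma cubeS x r s : r <= s -> cube x r `<=` cube x s.
Proof. by move=> rs y; rewrite /cube/= => /le_trans; exact. Qed.

Lemma compact_margin K U : compact K -> open U -> K `<=` U ->
  exists2 r, 0 < r & forall x, K x -> cube x r `<=` U.
Proof.
move=> cK oU KU.
have : \forall i \near \oo, K `<=` (fun x => cube x (i.+1%:R^-1) `<=` U).
  apply: (proj1 (compact_near_coveringP K) cK) => x Kx.
  have /nbhs_ballP[e /= e0 eU] : nbhs x U by apply: open_nbhs_nbhs; split => //; exact: KU.
  have e20 : 0 < e / 2 by rewrite divr_gt0.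
  exists (ball x (e / 2), [set i : nat | i.+1%:R^-1 < e / 2 :> R]).
    by split; [exact: nbhsx_ballx|exact: (near_infty_natSinv_lt (PosNum e20))].
  move=> -[y i] /= [xy ie] z yz; apply: eU.
  move: xy; rewrite -!ball_normE /= => xy.
  rewrite (splitr e); apply: le_lt_trans (ler_distD y _ _) _.
  by rewrite ltrD// distrC (le_lt_trans yz).
move=> [i _ /(_ i (leqnn i)) h]; exists i.+1%:R^-1; first by rewrite invr_gt0.
by move=> x /h.
Qed.

Lemma compact_continuous_bound K (f : 'rV[R]_n -> R) : compact K ->
  (forall x, K x -> {for x, continuous f}) -> exists2 B, 0 < B & forall x, K x -> f x <= B.
Proof.
move=> cK cf.
have : \forall i \near \oo, K `<=` (fun x => f x <= i%:R).
  apply: (proj1 (compact_near_coveringP K) cK) => x Kx.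
  have fx : nbhs x [set y | f y < f x + 1].
    apply: (cf x Kx [set z | z < f x + 1]); apply: open_nbhs_nbhs.
    by split; [exact: open_lt|rewrite /= ltrDl].
  exists ([set y | f y < f x + 1], [set i : nat | f x + 1 <= i%:R]).
    split => //=; exact: nbhs_infty_ger.
  by move=> -[y i] /= [/ltW]; exact: le_trans.
move=> [i _ /(_ i (leqnn i)) h]; exists (i%:R + 1); first by rewrite ltr_wpDl.
by move=> x /h /le_trans; apply; rewrite lerDl.
Qed.

Lemma compact_finite_cubes K r : compact K -> 0 < r ->
  exists s : seq 'rV[R]_n, (forall x, x \in s -> K x) /\
    (forall y, K y -> exists2 x, x \in s & cube x r y).
Proof.
move=> cK r0; have := cK; rewrite compact_cover => /(_ _ K (fun x => ball x r)).
case=> [x _|x Kx|D DK KD]; first exact: ball_open.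
  by exists x => //; exact: ballxx.
exists (finmap.enum_fset D); split=> [x /DK|y /KD[x /= xD]]; first by rewrite inE.
rewrite -ball_normE /= => xy; exists x => //.
by rewrite /cube/= distrC ltW.
Qed.

End compactness.

(** * The factors sigma and omega, and the class Z *)

Section weight.
Context {R : realType} {m : nat}.
Local Notation N := m.+1.
Implicit Types (x y z v : 'rV[R]_N) (lam r s : R).
Variables (k : nat) (al : R) (U Omega : set 'rV[R]_N) (a : 'rV[R]_N -> R) (L : R).
Hypotheses (al0 : 0 < al) (al1 : al <= 1) (oU : open U) (aH : holder_class k al U a).
Hypotheses (L0 : 0 < L) (aL : forall x y v, U x -> U y -> `|v| <= 1 ->
  `|derivs a (nseq k v) x - derivs a (nseq k v) y| <= L * `|x - y| `^ al).
Hypothesis a_ge0 : forall x, U x -> 0 <= a x.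
Local Notation kap := (k%:R + al).
Local Notation rho := (full_scale k al a L).

Lemma inv_powM (d A u : R) : 0 < A ->
  inv_pow d (A * u) = ((A `^ (- d))%:E * inv_pow d u)%E.
Proof.
move=> A0; rewrite /inv_pow mulf_eq0 gt_eqF//=; case: eqP => _.
  by rewrite gt0_muley// lte_fin powR_gt0.
by rewrite normrM gtr0_norm// powRM ?(ltW A0)// -EFinM.
Qed.

Definition sigma x : R := L * rho x `^ kap.

(** Where rho = 0 both [a] and [sigma] vanish and the quotient is free; the value 1 respects omega
    <= 1 and makes the dual weight 1 there. *)
Definition omega x : R := if rho x == 0 then 1 else a x / L / rho x `^ kap.

Lemma rho_ge0 x : 0 <= rho x.
Proof. exact: full_scale_ge0. Qed.

Lemma abs_le_rho x : `|a x| <= L * rho x `^ kap.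
Proof. exact: abs_le_scale. Qed.

Lemma a_sigma_omega x : U x -> a x = sigma x * omega x.
Proof.
move=> Ux; have := abs_le_rho x.
rewrite /sigma /omega; have [->|rn0] := eqVneq (rho x) 0.
  rewrite powR0 ?gt_eqF ?exp_kap_gt0// mulr0 mul0r normr_le0.
  by move=> /eqP.
move=> _; have r0 : 0 < rho x by rewrite lt_def rn0 rho_ge0.
by field; rewrite !gt_eqF// powR_gt0.
Qed.

Lemma omega_ge0 x : U x -> 0 <= omega x.
Proof.
move=> Ux; rewrite /omega; case: ifP => // _.
by rewrite !divr_ge0 ?powR_ge0 ?a_ge0// ltW.
Qed.

Lemma omega_le1 x : U x -> omega x <= 1.
Proof.
move=> Ux; rewrite /omega; case: eqVneq => // rn0.
have r0 : 0 < rho x by rewrite lt_def rn0 rho_ge0.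
rewrite ler_pdivrMr ?powR_gt0// mul1r ler_pdivrMr// mulrC.
exact: le_trans (ler_norm _) (abs_le_rho x).
Qed.

Lemma measurable_omega : measurable_fun U omega.
Proof.
have mr : measurable_fun U rho by exact: (measurable_scale al0 oU aH L0 aL).
have ma := measurable_a al0 oU aH L0 aL.
have mU : measurable U by exact: open_measurable_rV.
apply: measurable_fun_if => //; first exact: measurable_fun_eqr.
apply: measurable_funS mU (@subIsetl _ _ _) _.
apply: measurable_funM; first exact: measurable_funM.
under eq_fun do rewrite -powRN.
exact: (measurableT_comp (measurable_powR _)).
Qed.

Lemma dual_weightE x : U x -> dual_weight (kap + 1) omega x = inv_pow kap^-1 (omega x).
Proof.
by move=> Ux; rewrite /dual_weight /inv_pow ger0_norm ?omega_ge0// addrK.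
Qed.

Lemma dual_weight_scale x : U x -> 0 < rho x ->
  dual_weight (kap + 1) omega x = ((rho x)%:E * inv_pow kap^-1 (a x / L)%R)%E.
Proof.
move=> Ux r0; rewrite dual_weightE// /omega gt_eqF// mulrC [LHS]inv_powM ?invr_gt0 ?powR_gt0//.
congr (_ * _)%E; congr EFin; rewrite -powRN -powRrM mulrNN mulfV ?powRr1 ?ltW//.
by rewrite gt_eqF// exp_kap_gt0.
Qed.

(** The summand 1 takes care of the points with rho = 0. *)
Lemma dual_weight_le x : U x ->
  (dual_weight (kap + 1) omega x <= 1 + (rho x)%:E * inv_pow kap^-1 (a x / L)%R)%E.
Proof.
move=> Ux; have [r0|rn0] := eqVneq (rho x) 0.
  by rewrite dual_weightE// /omega r0 eqxx /inv_pow oner_eq0 normr1 powR1 mul0e adde0.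
have r0 : 0 < rho x by rewrite lt_def rn0 rho_ge0.
by rewrite dual_weight_scale// leeDr// lee01.
Qed.

Lemma dual_weight_ge0 x : (0 <= dual_weight (kap + 1) omega x)%E.
Proof. by rewrite /dual_weight; case: ifP => // _; rewrite lee_fin powR_ge0. Qed.

Lemma measurable_dual_weight : measurable_fun U (dual_weight (kap + 1) omega).
Proof.
apply: (@eq_measurable_fun _ _ _ _ _ (fun x => inv_pow kap^-1 (omega x))).
  by move=> x /set_mem Ux; rewrite dual_weightE.
exact: measurableT_comp (measurable_inv_pow _) measurable_omega.
Qed.

Hypotheses (cK : compact (closure Omega)) (KU : closure Omega `<=` U).

(** At a fixed radius [jet_size] is continuous, hence bounded on the compact closure of Omega.
    [jet_size_compare] extends the bound to the surrounding cubes, and [scale_le_jet_size] turns it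
    into a bound for rho. *)
Lemma rho_near_bound : exists r1 P : R, [/\ 0 < r1, 0 < P &
  forall x, closure Omega x -> cube x (2 * r1) `<=` U /\ forall z, cube x r1 z -> rho z <= P].
Proof.
have [r0 r00 r0P] := compact_margin cK oU KU.
pose r := r0 / 2; have r_gt0 : 0 < r by rewrite divr_gt0.
have [B B0 BP] := compact_continuous_bound cK
  (fun x Kx => jet_size_continuous (r := r) al0 oU aH L0 aL (KU Kx)).
have [C C1 CP] := jet_size_compare al0 oU aH L0 aL.
have C0 : 0 < C by exact: lt_le_trans C1.
have Lr0 : 0 < L * r `^ kap by rewrite mulr_gt0// powR_gt0.
pose B' := C * (B / (L * r `^ kap) + 1).
have B'1 : 1 <= B'.
  by rewrite -[leLHS]mulr1 ler_pM// lerDr divr_ge0 ?ltW.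
exists r, (nterms (R := R) (m := m) k * B' `^ al^-1 * r); split => //.
  rewrite mulr_gt0// mulr_gt0//; last by rewrite powR_gt0// (lt_le_trans _ B'1).
  by apply: lt_le_trans (nterms_ge1 k).
move=> x Kx; have xU : cube x (2 * r) `<=` U by rewrite mulrC divfK//; exact: r0P.
split => // z xz; apply: (scale_le_jet_size (a := a)) => //.
apply: (le_trans (CP z x r r_gt0 _ xz)); first by move=> w h; exact: xU.
have h : B' * L * r `^ kap = C * (B + L * r `^ kap).
  by rewrite /B'; field; rewrite !gt_eqF// powR_gt0.
by rewrite h ler_wpM2l ?(ltW C0)// lerD2r BP.
Qed.

(** For s <= r this is [scale_compare]. For larger s the cubes may leave [U], but then the global
    bound P <= (P / r) s is enough. *)
Lemma rho_lip : exists2 C : R, 1 <= C & forall x y s, Omega x -> Omega y -> 0 < s ->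
  rho y <= s -> `|x - y| <= s -> rho x <= C * s.
Proof.
have [r [P [r0 P0 rP]]] := rho_near_bound.
have [C C1 CP] := scale_compare al0 oU aH L0 aL.
exists (C + P / r); first by rewrite (le_trans C1)// lerDl divr_ge0 ?ltW.
move=> x y s Ox Oy s0 ys xy.
have [sr|rs] := leP s r.
  apply: (@le_trans _ _ (C * s)); last by rewrite ler_wpM2r ?(ltW s0)// lerDl divr_ge0 ?ltW.
  apply: (CP L x y) => // w wy; apply: (rP y (subset_closure Oy)).1.
  by rewrite /cube/= (le_trans wy)// ler_wpM2l.
have h : rho x <= P.
  by apply: (rP x (subset_closure Ox)).2; rewrite /cube/= subrr normr0 ltW.
apply: (le_trans h); apply: (@le_trans _ _ (P / r * s)); last first.
  by rewrite ler_wpM2r ?(ltW s0)// lerDr (le_trans _ C1).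
by rewrite mulrAC ler_pdivlMr// ler_wpM2l ?ltW.
Qed.

Lemma sigma_Zclass : Zclass kap Omega sigma.
Proof.
split=> [x _|]; first by rewrite mulr_ge0 ?powR_ge0// ltW.
have [C C1 CP] := rho_lip.
have C0 : 0 < C by exact: lt_le_trans C1.
have kap0 := exp_kap_gt0 k al0.
(* With X and Y the powers of rho y and of the distance, sigma y is L X while Y carries no L; the
   factor 1 + L comes from L (X + Y) <= (1 + L) (L X + Y). *)
exists (C `^ kap * (1 + L)) => x y Ox Oy.
pose s := Num.max (rho y) `|x - y|.
have s0 : 0 <= s by rewrite le_max rho_ge0.
have xs : rho x <= C * s.
  (* [rho_lip] wants s > 0; s = 0 means x = y and rho y = 0. *)
  have [sz|sn0] := eqVneq s 0; last first.
    by apply: (CP x y) => //; rewrite ?le_max ?lexx ?orbT// lt_def sn0.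
  have : `|x - y| <= 0 by rewrite -sz le_max lexx orbT.
  rewrite normr_le0 subr_eq0 => /eqP ->.
  have : rho y <= 0 by rewrite -sz le_max lexx.
  by move=> /le_trans; apply; rewrite mulr_ge0// ltW.
have es : s `^ kap <= rho y `^ kap + enorm (x - y) `^ kap.
  have e1 : `|x - y| `^ kap <= enorm (x - y) `^ kap.
    by rewrite ge0_ler_powR ?nnegrE ?(ltW kap0) ?sqrtr_ge0 ?rV_norm_le_enorm.
  rewrite /s; case: (leP (rho y) `|x - y|) => _; first by rewrite (le_trans e1)// lerDr powR_ge0.
  by rewrite lerDl powR_ge0.
have h : rho x `^ kap <= C `^ kap * s `^ kap.
  rewrite -powRM ?(ltW C0)// ge0_ler_powR ?nnegrE ?(ltW kap0) ?rho_ge0//.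
  by rewrite mulr_ge0// ltW.
apply: (@le_trans _ _ (L * (C `^ kap * (rho y `^ kap + enorm (x - y) `^ kap)))).
  by rewrite ler_wpM2l ?(ltW L0)// (le_trans h)// ler_wpM2l ?powR_ge0.
rewrite /sigma mulrCA -[leRHS]mulrA ler_wpM2l ?powR_ge0//.
set X := rho y `^ kap; set Y := enorm (x - y) `^ kap.
have X0 : 0 <= X by exact: powR_ge0.
have Y0 : 0 <= Y by exact: powR_ge0.
rewrite -subr_ge0 (_ : _ - _ = Y + L * (L * X)); last by ring.
by rewrite addr_ge0// mulr_ge0 ?mulr_ge0// ltW.
Qed.

End weight.

(** * Integrals of the dual weight *)

Section ball_integrals.
Context {R : realType} {m : nat}.
Local Notation N := m.+1.
Implicit Types (x y z v : 'rV[R]_N) (lam r s : R).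
Variables (k : nat) (al : R) (U Omega : set 'rV[R]_N) (a : 'rV[R]_N -> R) (L : R).
Hypotheses (al0 : 0 < al) (al1 : al <= 1) (oU : open U) (aH : holder_class k al U a).
Hypotheses (L0 : 0 < L) (aL : forall x y v, U x -> U y -> `|v| <= 1 ->
  `|derivs a (nseq k v) x - derivs a (nseq k v) y| <= L * `|x - y| `^ al).
Hypothesis a_ge0 : forall x, U x -> 0 <= a x.
Hypotheses (oO : open Omega) (cK : compact (closure Omega)) (KU : closure Omega `<=` U).
Local Notation kap := (k%:R + al).
Local Notation rho := (full_scale k al a L).
Local Notation omega := (omega k al a L).
Local Notation dualw := (dual_weight (kap + 1) omega).

Let OU : Omega `<=` U. Proof. by move=> x /subset_closure/KU. Qed.
Let mU : measurable U. Proof. exact: open_measurable_rV. Qed.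
Let mO : measurable Omega. Proof. exact: open_measurable_rV. Qed.
Let mdual : measurable_fun U dualw. Proof. exact: measurable_dual_weight. Qed.
Let kap0 : 0 < kap. Proof. exact: exp_kap_gt0. Qed.

Lemma cube_dual_integral (C1 : R) : 0 < C1 -> exists2 D : R, 0 < D & forall x0 r, 0 < r ->
  cube x0 (3 * r) `<=` U -> (forall y, cube x0 (3 * r) y -> rho y <= C1 * r) ->
  (\int[leb R N]_(y in cube x0 r) dualw y <= (D * r ^+ N)%:E)%E.
Proof.
move=> C10; have [C C0 CP] := cube_integral al0 al1 oU aH L0 aL C10.
exists (2 ^+ N + C); first by rewrite addr_gt0.
move=> x0 r r0 cU rle.
have cU' : cube x0 r `<=` U.
  by apply: subset_trans cU; apply: cubeS; rewrite ler_peMl ?(ltW r0)// ler1n.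
pose G y := ((rho y)%:E * inv_pow kap^-1 (a y / L)%R)%E.
have mG : measurable_fun (cube x0 r) G.
  apply: measurable_funS mU cU' _; apply: emeasurable_funM.
    apply/measurable_EFinP; exact: (measurable_scale al0 oU aH L0 aL).
  exact: (measurable_inv_pow_a al0 oU aH L0 aL).
have G0 y : (0 <= G y)%E by rewrite mule_ge0 ?inv_pow_ge0// lee_fin full_scale_ge0.
have mc : measurable (cube x0 r) by exact: measurable_cube.
apply: (@le_trans _ _ (\int[leb R N]_(y in cube x0 r) (cst 1%E y + G y))%E).
  apply: ge0_le_integral => //.
  - by move=> y _; exact: dual_weight_ge0.
  - exact: measurable_funS mU cU' mdual.
  - exact: emeasurable_funD.
  - by move=> y /cU' Uy; exact: (dual_weight_le k al0 L0 a_ge0 Uy).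
rewrite ge0_integralD//.
rewrite integral_cst// mul1e mulrDl EFinD.
apply: leeD; last exact: CP.
by rewrite -exprMn -(leb_cube x0 (ltW r0)).
Qed.

(** Finitely many cubes of a fixed radius r cover the closure of Omega, and on their threefold
    enlargements rho <= P = (P / r) r, which is all that [cube_dual_integral] asks for. *)
Lemma dual_integral_finite : exists2 T : R, 0 < T &
  (\int[leb R N]_(y in Omega) dualw y <= T%:E)%E.
Proof.
have [r1 [P [r10 P0 rP]]] := rho_near_bound al0 oU aH L0 aL cK KU.
pose r := r1 / 3; have r0 : 0 < r by rewrite divr_gt0.
have r3 : 3 * r = r1 by rewrite mulrC divfK.
have [D D0 DP] := cube_dual_integral (divr_gt0 P0 r0).
have [s [sK sP]] := compact_finite_cubes cK r0.
have cU x : x \in s -> cube x (3 * r) `<=` U.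
  move=> /sK /rP[+ _]; apply: subset_trans; apply: cubeS.
  by rewrite r3 ler_peMl ?(ltW r10)// ler1n.
have cU' x : x \in s -> cube x r `<=` U.
  by move=> /cU; apply: subset_trans; apply: cubeS; rewrite ler_peMl ?(ltW r0)// ler1n.
exists ((size s)%:R * (D * r ^+ N) + 1).
  by rewrite ltr_wpDl// !mulr_ge0 ?exprn_ge0// ltW.
have h0 A y : (0 <= (dualw \_ A) y)%E.
  by rewrite patchE; case: ifP => // _; exact: dual_weight_ge0.
have mdr A : measurable A -> A `<=` U -> measurable_fun setT (dualw \_ A).
  by move=> mA AU; exact: ((measurable_restrictT _ mA).1 (measurable_funS mU AU mdual)).
(* The test [x \in s] makes the summand measurable for every [x], not just for the centres in the
   list. *)
have mcube x : measurable_fun setT (if x \in s then dualw \_ (cube x r) else cst 0%E).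
  by case: ifP => // xs; apply: mdr; [exact: measurable_cube|exact: cU'].
rewrite integral_mkcond.
apply: (@le_trans _ _ (\int[leb R N]_y \sum_(x <- s)
    (if x \in s then dualw \_ (cube x r) else cst 0%E) y)%E).
  apply: ge0_le_integral => //.
  - exact: mdr.
  - exact: emeasurable_sum.
  - move=> y _; have z0 x : (0 <= (if x \in s then dualw \_ (cube x r) else cst 0) y)%E.
      by case: ifP.
    rewrite [X in (X <= _)%E]patchE; case: ifPn => [/set_mem Oy|_]; last exact: sume_ge0.
    have [x xs xy] := sP y (subset_closure Oy).
    rewrite (big_rem x)//= xs patchE mem_set// leeDl//.
    exact: sume_ge0.
rewrite ge0_integral_sum//; last by move=> x y _; case: ifP.
apply: (@le_trans _ _ (\sum_(x <- s) (D * r ^+ N)%:E)%E).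
  rewrite big_seq [X in (_ <= X)%E]big_seq; apply: lee_sum => x xs.
  rewrite xs -integral_mkcond; apply: DP => //; first exact: cU.
  by move=> y; rewrite r3 divfK ?gt_eqF// => xy; apply: (rP x (sK x xs)).2.
rewrite sumEFin lee_fin big_const_seq count_predT iter_addr_0 -[leLHS]mulr_natl.
by rewrite lerDl.
Qed.

Lemma measurable_eball x r : measurable (eball x r).
Proof.
rewrite (_ : eball x r = (fun y => enorm (y - x)) @^-1` `]-oo, r[).
  rewrite -[X in measurable X]setTI.
  apply: continuous_measurable_rV => // y.
  apply: (@continuous_comp _ _ _ (fun y => \sum_(i < N) (y - x) ord0 i ^+ 2) (@Num.sqrt R));
    last exact: sqrt_continuous.
  have FF : Filter (nbhs y) := nbhs_filter y.
  apply: (cvg_big add_continuous) => i _.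
  apply: (@continuous_comp _ _ _ (fun y => (y - x) ord0 i) (fun t : R => t ^+ 2));
    last exact: exprn_continuous.
  have c : {for y, continuous (fun z : 'rV[R]_N => z - x)}.
    by apply: continuousB => //; exact: cst_continuous.
  exact: continuous_comp c (@coord_continuous _ _ _ ord0 i _).
by apply/seteqP; split => y /=; rewrite in_itv.
Qed.

Lemma eball_cube x r : eball x r `<=` cube x r.
Proof. by move=> y /ltW; apply: le_trans; exact: rV_norm_le_enorm. Qed.

Lemma cube_eball x r : 0 < r -> cube x (r / (2 * N%:R)) `<=` eball x r.
Proof.
move=> r0 y h; apply: (le_lt_trans (enorm_le_norm _)).
apply: (@le_lt_trans _ _ (N%:R * (r / (2 * N%:R)))); first by rewrite ler_wpM2l.
rewrite (_ : _ * _ = r / 2); first by rewrite ltr_pdivrMr// ltr_pMr// ltr1n.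
by field; rewrite addrC natr1 pnatr_eq0.
Qed.

End ball_integrals.

(** * Balls that are small compared with rho *)

Section muckenhoupt_weight.
Context {R : realType} {m : nat}.
Local Notation N := m.+1.
Implicit Types (x y z v : 'rV[R]_N) (lam r s : R).
Variables (k : nat) (al : R) (U Omega : set 'rV[R]_N) (a : 'rV[R]_N -> R) (L : R).
Hypotheses (al0 : 0 < al) (al1 : al <= 1) (oU : open U) (aH : holder_class k al U a).
Hypotheses (L0 : 0 < L) (aL : forall x y v, U x -> U y -> `|v| <= 1 ->
  `|derivs a (nseq k v) x - derivs a (nseq k v) y| <= L * `|x - y| `^ al).
Hypothesis a_ge0 : forall x, U x -> 0 <= a x.
Hypotheses (oO : open Omega) (cK : compact (closure Omega)) (KU : closure Omega `<=` U).
Local Notation kap := (k%:R + al).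
Local Notation full_scale := (full_scale k al a).
Local Notation rho := (full_scale L).
Local Notation omega := (omega k al a L).
Local Notation dualw := (dual_weight (kap + 1) omega).
Local Notation jet_size := (jet_size k a).
Local Notation Kn := (nterms (R := R) (m := m) k).

Let OU : Omega `<=` U. Proof. by move=> x /subset_closure/KU. Qed.
Let mU : measurable U. Proof. exact: open_measurable_rV. Qed.
Let mdual : measurable_fun U dualw. Proof. exact: measurable_dual_weight. Qed.
Let kap0 : 0 < kap. Proof. exact: exp_kap_gt0. Qed.

(* On a ball whose radius r is small compared with the scale rho, a / lam with
   lam r^kap = jet_size x0 r has scale comparable to r. *)
Lemma rescaled_scale : exists A C1 c : R, [/\ 0 < A, 0 < C1, 0 < c &
  forall x0 r, 0 < r -> cube x0 (6 * r) `<=` U -> A * r < rho x0 ->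
  let lam := jet_size x0 r / r `^ kap in
  [/\ L <= lam,
      forall y, cube x0 (3 * r) y -> full_scale lam y <= C1 * r &
      forall y, cube x0 r y -> c * r <= full_scale lam y]].
Proof.
have [C C1 CP] := jet_size_compare al0 oU aH L0 aL.
have C0 : 0 < C by exact: lt_le_trans C1.
have Kn1 : 1 <= Kn by exact: nterms_ge1.
have Kn0 : 0 < Kn by exact: lt_le_trans Kn1.
have i0 : 0 <= al^-1 by rewrite invr_ge0 ltW.
have C41 : 1 <= 4 * C by rewrite -[leLHS]mulr1 ler_pM// ler1n.
have C4p : 1 <= (4 * C) `^ al^-1 by rewrite -[leLHS](powRr0 (4 * C)) ler_powR.
(* (A / (2 Kn))^al = 4 C, so by [jet_size_ge_scale] the jet size M at [x0] is at least 4 C L r^kap.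
   Likewise [c] below has c^al Kn = 1 / (4 C): a scale under c r at [y] would lead to M <= M/4 +
   M/4. *)
pose A := 2 * Kn * (4 * C) `^ al^-1.
have A0 : 0 < A by rewrite mulr_gt0 ?(lt_le_trans ltr01 C4p)// mulr_gt0.
have KA : 2 * Kn <= A by rewrite /A ler_peMr// mulr_ge0// ltW.
pose B := C * (3 ^+ k + 3 `^ kap).
have B1 : 1 <= B.
  have h3 : 1 <= 3 ^+ k :> R by rewrite exprn_ege1// ler1n.
  by rewrite /B -[leLHS]mulr1 ler_pM// -[leLHS]addr0 lerD ?powR_ge0.
pose c := (4 * C * Kn)^-1 `^ al^-1.
have CK0 : 0 < 4 * C * Kn by rewrite mulr_gt0// mulr_gt0.
have c0 : 0 < c by rewrite powR_gt0// invr_gt0.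
have c1 : c <= 1.
  rewrite /c powR_inv_le ?powR1 ?invr_ge0 ?(ltW CK0)//.
  by rewrite invf_le1// -[leLHS]mulr1 ler_pM.
have cal : c `^ al = (4 * C * Kn)^-1.
  by rewrite /c -powRrM mulVf ?gt_eqF// powRr1// invr_ge0 ltW.
exists A, (Kn * B `^ al^-1 * 3), c; split => //.
  by rewrite mulr_gt0// mulr_gt0// powR_gt0// (lt_le_trans _ B1).
move=> x0 r r0 cU Ar /=.
set M := jet_size x0 r; set lam := M / r `^ kap.
have rk0 : 0 < r `^ kap by rewrite powR_gt0.
have ML : 4 * C * (L * r `^ kap) <= M.
  have := jet_size_ge_scale al0 L0 r0 KA (ltW Ar).
  rewrite (_ : A / (2 * Kn) = (4 * C) `^ al^-1); last first.
    by rewrite /A mulrAC mulfV ?mul1r// gt_eqF// mulr_gt0.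
  rewrite -powRrM mulVf ?gt_eqF// powRr1 ?(le_trans _ C41)//.
  by apply: le_trans; rewrite le_eqVlt; apply/orP; left; apply/eqP; ring.
have Lr0 : 0 < L * r `^ kap by rewrite mulr_gt0.
have LM : L * r `^ kap <= M by apply: le_trans ML; rewrite ler_peMl// ltW.
have M0 : 0 < M by exact: lt_le_trans LM.
have Llam : L <= lam by rewrite ler_pdivlMr.
have lam0 : 0 < lam by exact: lt_le_trans Llam.
have Mlam : M = lam * r `^ kap by rewrite /lam divfK// gt_eqF.
have r30 : 0 < 3 * r by rewrite mulr_gt0.
have cU3 : cube x0 (3 * r) `<=` U.
  by apply: subset_trans cU; apply: cubeS; rewrite ler_wpM2r ?ler_nat// ltW.
split => // y yx.
  rewrite -mulrA; apply: (scale_le_jet_size (a := a)) => //.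
  (* Comparison at radius 3 r looks at the cube of radius 6 r, which explains the hypothesis on
     [U]. *)
  apply: (le_trans (CP y x0 _ r30 _ yx)) => [w wx|].
    by apply: cU; rewrite /cube/= (le_trans wx)// mulrA ler_wpM2r ?(ltW r0)// -natrM ler_nat.
  have h1 : jet_size x0 (3 * r) <= 3 ^+ k * M.
    have := jet_size_rescale k a x0 r0 (_ : r <= 3 * r).
    by rewrite mulfK ?gt_eqF//; apply; rewrite ler_peMl ?(ltW r0)// ler1n.
  have h2 : L * (3 * r) `^ kap <= 3 `^ kap * M.
    by rewrite powRM ?(ltW r0)// mulrCA ler_wpM2l ?powR_ge0.
  have h3 : M <= lam * (3 * r) `^ kap.
    rewrite Mlam ler_wpM2l ?(ltW lam0)// ge0_ler_powR ?nnegrE ?(ltW r0) ?(ltW kap0) ?(ltW r30)//.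
    by rewrite ler_peMl ?(ltW r0)// ler1n.
  rewrite [leRHS](_ : _ = C * ((3 ^+ k + 3 `^ kap) * (lam * (3 * r) `^ kap))); last first.
    by rewrite /B; ring.
  rewrite ler_wpM2l ?(ltW C0)//.
  apply: (@le_trans _ _ ((3 ^+ k + 3 `^ kap) * M)).
    by rewrite [leRHS]mulrDl lerD.
  have S0 : 0 <= 3 ^+ k + 3 `^ kap :> R by rewrite addr_ge0 ?powR_ge0// exprn_ge0.
  exact: (ler_wpM2l S0 h3).
rewrite leNgt; apply/negP => /ltW ylt.
have := jet_size_le_scale al0 lam0 r0 c0 c1 ylt.
rewrite cal -[_ * lam * _]mulrA -Mlam => h1.
have h2 : M <= C * (jet_size y r + L * r `^ kap).
  apply: CP => // [w wy|]; last by rewrite distrC.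
  apply: cU3; rewrite /cube/= (_ : w - x0 = (w - y) + (y - x0)); last by rewrite subrKA.
  rewrite (le_trans (ler_normD _ _))// (_ : 3 * r = 2 * r + r); last by ring.
  by rewrite lerD.
have h3 : C * jet_size y r <= M / 4.
  apply: (le_trans (ler_wpM2l (ltW C0) h1)).
  by rewrite le_eqVlt; apply/orP; left; apply/eqP; field; rewrite !gt_eqF.
move: h2 h3 ML M0; rewrite mulrDr -mulrA; set X := C * jet_size y r; set Y := C * (L * _).
by lra.
Qed.

(** On the ball, up to constants, omega is at most u = (lam / L) (r / rho0)^kap, and the mean of the
    dual weight is at most v = (rho0 / r) (lam / L)^(-1/kap). In u v^kap the quantities lam, r and
    rho0 all cancel. *)
Lemma large_scale_ball : exists A r1 K : R, [/\ 0 < A, 0 < r1, 0 < K &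
  forall x0 r, 0 < r -> r <= r1 -> eball x0 r `<=` Omega -> A * r < rho x0 ->
  exists u v : R, [/\ 0 <= u, 0 <= v, u * v `^ kap <= K,
    forall z, eball x0 r z -> omega z <= u &
    (\int[leb R N]_(z in eball x0 r) dualw z <= (v * r ^+ N)%:E)%E]].
Proof.
have [A1 [C1 [c [A10 C10 c0 resP]]]] := rescaled_scale.
have [r1 [P [r10 P0 rP]]] := rho_near_bound al0 oU aH L0 aL cK KU.
have [Cf Cf1 CfP] := function_bound al0 oU aH L0 aL.
have [Cl Cl1 ClP] := rho_lip al0 oU aH L0 aL cK KU.
have [CI CI0 CIP] := cube_integral al0 al1 oU aH L0 aL C10.
have Cf0 : 0 < Cf by exact: lt_le_trans Cf1.
have Cl0 : 0 < Cl by exact: lt_le_trans Cl1.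
(* [A1] is what [rescaled_scale] asks for. [Cl] makes rho almost constant on the ball: rho z < r
   would force rho x0 <= Cl r by [rho_lip]. *)
pose A := A1 + Cl.
have A0 : 0 < A by rewrite addr_gt0.
exists A, (r1 / 3), (2 * Cf * Cl `^ kap * Cl `^ kap * CI `^ kap / c `^ kap); split => //.
- by rewrite divr_gt0.
- by rewrite divr_gt0 ?powR_gt0// !mulr_gt0 ?powR_gt0.
move=> x0 r r0 rr1 BO Ar.
have x0B : eball x0 r x0.
  rewrite /eball/= subrr /enorm big1 ?sqrtr0// => i _.
  by rewrite mxE expr0n.
have Ox0 : Omega x0 by exact: BO.
have cU : cube x0 (6 * r) `<=` U.
  apply: subset_trans (rP x0 (subset_closure Ox0)).1; apply: cubeS.
  by move: rr1; rewrite ler_pdivlMr// => h; lra.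
have cU3 : cube x0 (3 * r) `<=` U.
  by apply: subset_trans cU; apply: cubeS; rewrite ler_wpM2r ?ler_nat// ltW.
have cU1 : cube x0 r `<=` U.
  by apply: subset_trans cU3; apply: cubeS; rewrite ler_peMl ?(ltW r0)// ler1n.
have A1r : A1 * r < rho x0 by apply: le_lt_trans Ar; rewrite ler_wpM2r ?(ltW r0)// lerDl ltW.
have Clr : Cl * r < rho x0 by apply: le_lt_trans Ar; rewrite ler_wpM2r ?(ltW r0)// lerDr ltW.
have := resP x0 r r0 cU A1r; set lam := _ / _ => -[Llam up low].
have lam0 : 0 < lam by exact: lt_le_trans Llam.
have rk0 : 0 < r `^ kap by rewrite powR_gt0.
have Mlam : jet_size x0 r = lam * r `^ kap by rewrite /lam divfK// gt_eqF.
clearbody lam.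
set rho0 := rho x0 in Clr *.
have rr0 : r < rho0 by apply: le_lt_trans Clr; rewrite ler_peMl// ltW.
have rho00 : 0 < rho0 by exact: lt_trans rr0.
have zP z : eball x0 r z -> rho0 <= Cl * rho z /\ rho z <= Cl * rho0.
  move=> zB; have zx := eball_cube zB; have Oz := BO z zB; split; last first.
    apply: (ClP z x0) => //; exact: le_trans zx (ltW rr0).
  have [rz|zr] := leP r (rho z).
    apply: (ClP x0 z) => //; first exact: lt_le_trans rz.
    by rewrite distrC (le_trans zx).
  have := ClP x0 z r Ox0 Oz r0 (ltW zr).
  by rewrite distrC => /(_ zx); rewrite leNgt Clr.
(* [function_bound] gives a <= Cf (lam + L) r^kap <= 2 Cf lam r^kap, and rho >= rho0 / Cl. In [W],
   the quotient by c r pays for inserting the factor [full_scale lam z], which is at least c r, so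
   that [cube_integral] applies to a / lam. *)
pose u := 2 * Cf * lam * r `^ kap / L * (Cl / rho0) `^ kap.
pose W := Cl * rho0 * (lam / L) `^ (- kap^-1) / (c * r).
have W0 : 0 <= W.
  by rewrite !mulr_ge0 ?powR_ge0 ?invr_ge0 ?mulr_ge0 ?(ltW Cl0) ?(ltW c0) ?(ltW r0) ?(ltW rho00).
exists u, (W * CI); split.
- by rewrite !mulr_ge0 ?powR_ge0 ?invr_ge0 ?(ltW Cf0) ?(ltW lam0) ?(ltW L0).
- by rewrite mulr_ge0// ltW.
- rewrite /u /W.
  have Lk : ((lam / L) `^ (- kap^-1)) `^ kap = (lam / L)^-1.
    by rewrite -powRrM mulNr mulVf ?gt_eqF// powR_inv1 ?divr_ge0 ?(ltW lam0) ?(ltW L0).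
  have Clr0 : 0 <= Cl * rho0 by rewrite mulr_ge0 ?(ltW Cl0) ?(ltW rho00).
  have cr0 : 0 <= c * r by rewrite mulr_ge0 ?(ltW c0) ?(ltW r0).
  have Q0 : 0 <= (lam / L) `^ (- kap^-1) by exact: powR_ge0.
  have vk : (Cl * rho0 * (lam / L) `^ (- kap^-1) / (c * r) * CI) `^ kap =
      Cl `^ kap * rho0 `^ kap * (lam / L)^-1 / (c `^ kap * r `^ kap) * CI `^ kap.
    have e1 : 0 <= Cl * rho0 * (lam / L) `^ (- kap^-1) by exact: mulr_ge0.
    have e2 : 0 <= (c * r)^-1 by rewrite invr_ge0.
    rewrite (powRM _ W0 (ltW CI0)) (powRM _ e1 e2) (powRM _ Clr0 Q0) Lk.
    by rewrite (powRM _ (ltW Cl0) (ltW rho00)) powRV// (powRM _ (ltW c0) (ltW r0)).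
  have uk : (Cl / rho0) `^ kap = Cl `^ kap / rho0 `^ kap.
    by rewrite powRM ?invr_ge0 ?(ltW Cl0) ?(ltW rho00)// powRV ?(ltW rho00).
  rewrite vk uk le_eqVlt; apply/orP; left; apply/eqP.
  have n1 : rho0 `^ kap != 0 by rewrite gt_eqF// powR_gt0.
  have n2 : c `^ kap != 0 by rewrite gt_eqF// powR_gt0.
  have n3 : r `^ kap != 0 by rewrite gt_eqF.
  by field; rewrite n1 n2 n3 !gt_eqF.
- move=> z zB.
  have Uz : U z by exact/OU/BO.
  have [z1 z2] := zP z zB.
  have rz0 : 0 < rho z by rewrite -(pmulr_rgt0 _ Cl0) (lt_le_trans rho00).
  rewrite /omega gt_eqF//.
  have az : a z <= 2 * Cf * lam * r `^ kap.
    apply: (le_trans (ler_norm _)); apply: (le_trans (CfP x0 z r r0 _ _)).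
    + by move=> w wx; apply: cU; rewrite /cube/= (le_trans wx)// ler_wpM2r ?ler_nat// ltW.
    + by rewrite (le_trans (eball_cube zB))// ler_peMl ?(ltW r0)// ler1n.
    rewrite Mlam -mulrDl [2 * Cf]mulrC -!mulrA ler_wpM2l ?(ltW Cf0)//.
    rewrite mulrA ler_wpM2r ?(ltW rk0)//; lra.
  rewrite /u; apply: ler_pM; rewrite ?mulr_ge0 ?invr_ge0 ?powR_ge0 ?a_ge0 ?(ltW L0)//.
    by rewrite ler_wpM2r ?invr_ge0// ltW.
  rewrite -powRV ?rho_ge0// ge0_ler_powR ?nnegrE ?(ltW kap0) ?invr_ge0 ?(ltW rz0)//.
    by rewrite divr_ge0 ?(ltW Cl0) ?(ltW rho00).
  by rewrite ler_pdivlMr// mulrC ler_pdivrMr.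
have cr0 : 0 < c * r by rewrite mulr_gt0.
have lamL0 : 0 < lam / L by rewrite divr_gt0.
have mB : measurable (eball x0 r) by exact: measurable_eball.
have BU : eball x0 r `<=` U by apply: subset_trans OU.
pose G z := ((full_scale lam z)%:E * inv_pow kap^-1 (a z / lam)%R)%E.
have G0 z : (0 <= G z)%E by rewrite mule_ge0 ?inv_pow_ge0// lee_fin full_scale_ge0.
have mG : measurable_fun U G.
  apply: emeasurable_funM.
    apply/measurable_EFinP; exact: (measurable_scale al0 oU aH L0 aL).
  exact: (measurable_inv_pow_a al0 oU aH L0 aL).
apply: (@le_trans _ _ (\int[leb R N]_(z in eball x0 r) (W%:E * G z))%E).
  apply: ge0_le_integral => //.
  - by move=> z _; exact: dual_weight_ge0.
  - exact: measurable_funS mU BU mdual.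
  - apply: measurable_funeM; exact: measurable_funS mU BU mG.
  move=> z zB; have [z1 z2] := zP z zB; have Uz := BU z zB.
  have rz0 : 0 < rho z by rewrite -(pmulr_rgt0 _ Cl0) (lt_le_trans rho00).
  rewrite (dual_weight_scale al0 L0 a_ge0 Uz rz0).
  have -> : a z / L = lam / L * (a z / lam) by field; rewrite !gt_eqF.
  rewrite inv_powM// /G !muleA -!EFinM lee_wpmul2r ?inv_pow_ge0// lee_fin.
  have lz := low z (eball_cube zB).
  apply: (@le_trans _ _ (Cl * rho0 * (lam / L) `^ (- kap^-1))).
    by rewrite ler_wpM2r ?powR_ge0.
  rewrite /W [leRHS](_ : _ = Cl * rho0 * (lam / L) `^ (- kap^-1) *
    (full_scale lam z / (c * r))); last by ring.
  apply: ler_peMr; first by rewrite mulr_ge0 ?powR_ge0// mulr_ge0 ?(ltW Cl0) ?(ltW rho00).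
  by rewrite ler_pdivlMr// mul1r.
rewrite ge0_integralZl_EFin//; last exact: measurable_funS mU BU mG.
have -> : (W * CI * r ^+ N)%:E = (W%:E * (CI * r ^+ N)%:E)%E by rewrite -EFinM mulrA.
rewrite lee_wpmul2l ?lee_fin//.
apply: le_trans (CIP lam x0 r Llam r0 cU3 up).
apply: ge0_subset_integral => //; first exact: measurable_cube.
  exact: measurable_funS mU cU1 mG.
exact: eball_cube.
Qed.

End muckenhoupt_weight.

(** * The Muckenhoupt condition and the boundedness of omega *)

Section muckenhoupt_class.
Context {R : realType} {m : nat}.
Local Notation N := m.+1.
Implicit Types (x y z v : 'rV[R]_N) (lam r s : R).
Variables (k : nat) (al : R) (U Omega : set 'rV[R]_N) (a : 'rV[R]_N -> R) (L : R).
Hypotheses (al0 : 0 < al) (al1 : al <= 1) (oU : open U) (aH : holder_class k al U a).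
Hypotheses (L0 : 0 < L) (aL : forall x y v, U x -> U y -> `|v| <= 1 ->
  `|derivs a (nseq k v) x - derivs a (nseq k v) y| <= L * `|x - y| `^ al).
Hypothesis a_ge0 : forall x, U x -> 0 <= a x.
Hypotheses (oO : open Omega) (cK : compact (closure Omega)) (KU : closure Omega `<=` U).
Local Notation kap := (k%:R + al).
Local Notation rho := (full_scale k al a L).
Local Notation omega := (omega k al a L).
Local Notation dualw := (dual_weight (kap + 1) omega).

Let OU : Omega `<=` U. Proof. by move=> x /subset_closure/KU. Qed.
Let mU : measurable U. Proof. exact: open_measurable_rV. Qed.
Let mO : measurable Omega. Proof. exact: open_measurable_rV. Qed.
Let mdual : measurable_fun U dualw. Proof. exact: measurable_dual_weight. Qed.
Let momega : measurable_fun U omega. Proof. exact: measurable_omega. Qed.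
Let kap0 : 0 < kap. Proof. exact: exp_kap_gt0. Qed.

(** Besides the two cases of small and large rho there are balls of radius above [r2], for which the
    total integral T of the dual weight and omega <= 1 are enough. *)
Lemma ball_estimate : exists K : R, forall x0 r, 0 < r -> eball x0 r `<=` Omega ->
  exists u v : R, [/\ 0 <= u, 0 <= v, u * v `^ kap <= K,
    forall z, eball x0 r z -> omega z <= u &
    (\int[leb R N]_(z in eball x0 r) dualw z <= (v * r ^+ N)%:E)%E].
Proof.
have [A [r1 [K1 [A0 r10 K10 lsP]]]] := large_scale_ball al0 al1 oU aH L0 aL a_ge0 cK KU.
have [r3 [P [r30 P0 rP]]] := rho_near_bound al0 oU aH L0 aL cK KU.
have [Cs Cs1 CsP] := scale_compare al0 oU aH L0 aL.
have [T T0 TP] := dual_integral_finite al0 al1 oU aH L0 aL a_ge0 oO cK KU.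
have Cs0 : 0 < Cs by exact: lt_le_trans Cs1.
have A30 : 0 < A + 3 by rewrite addr_gt0.
have [D D0 DP] := cube_dual_integral al0 al1 oU aH L0 aL a_ge0 (mulr_gt0 Cs0 A30).
(* With s = (A + 3) r one has both rho x0 <= s and 3 r <= s in the last case, and r <= r3 / (A + 3)
   keeps the cube of radius 2 s inside [U], as [scale_compare] needs. *)
pose r2 := Num.min r1 (r3 / (A + 3)).
have r20 : 0 < r2 by rewrite lt_min r10 divr_gt0.
pose v3 := T / r2 ^+ N.
have v30 : 0 <= v3 by rewrite divr_ge0 ?exprn_ge0 ?ltW.
exists (K1 + D `^ kap + v3 `^ kap) => x0 r r0 BO.
have om1 z : eball x0 r z -> omega z <= 1 by move=> /BO/OU; exact: omega_le1.
have BU : eball x0 r `<=` U by apply: subset_trans OU.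
have mB : measurable (eball x0 r) by exact: measurable_eball.
have [r2r|rr2] := ltP r2 r.
  exists 1, v3; split => //; first by rewrite mul1r lerDr addr_ge0 ?powR_ge0// ltW.
  apply: (@le_trans _ _ T%:E).
    apply: le_trans TP; apply: ge0_subset_integral => //.
      exact: measurable_funS mU OU mdual.
    by move=> z _; exact: dual_weight_ge0.
  rewrite lee_fin /v3 mulrAC ler_pdivlMr ?exprn_gt0// ler_wpM2l ?(ltW T0)//.
  by rewrite lerXn2r ?nnegrE ?(ltW r20) ?(ltW r0) ?(ltW r2r).
have [rr1 rr3] : r <= r1 /\ r <= r3 / (A + 3).
  by move: rr2; rewrite le_min => /andP.
have [rA|Ar] := leP (rho x0) (A * r); last first.
  have [u [v [u0 v0 uv h1 h2]]] := lsP x0 r r0 rr1 BO Ar.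
  exists u, v; split => //; apply: (le_trans uv).
  by rewrite -addrA lerDl addr_ge0 ?powR_ge0.
have Ox0 : Omega x0.
  apply: BO; rewrite /eball/= subrr /enorm big1 ?sqrtr0// => i _.
  by rewrite mxE expr0n.
have s0 : 0 < (A + 3) * r by rewrite mulr_gt0.
have sr : (A + 3) * r <= r3 by rewrite mulrC -ler_pdivlMr.
have xU w : `|w - x0| <= 2 * ((A + 3) * r) -> U w.
  move=> wx; apply: (rP x0 (subset_closure Ox0)).1; rewrite /cube/= (le_trans wx)//.
  by rewrite ler_wpM2l.
exists 1, D; split => //; first exact: ltW.
  by rewrite mul1r -addrA addrCA lerDl addr_ge0 ?powR_ge0// ltW.
have r3s : 3 * r <= (A + 3) * r by rewrite ler_wpM2r ?(ltW r0)// lerDr ltW.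
apply: (@le_trans _ _ (\int[leb R N]_(z in cube x0 r) dualw z)%E).
  apply: ge0_subset_integral => //; first exact: measurable_cube.
  - apply: measurable_funS mU _ mdual => z zx; apply: xU; rewrite (le_trans zx)//.
    apply: le_trans (_ : 2 * (3 * r) <= _); last by rewrite ler_wpM2l.
    by move: (r0); lra.
  - by move=> z _; exact: dual_weight_ge0.
  - exact: eball_cube.
apply: DP => // [y yx|y yx].
  apply: xU; rewrite (le_trans yx)// (le_trans r3s)// ler_peMl ?(ltW s0)// ler1n //.
rewrite -mulrA; apply: (CsP L y x0 _ (lexx L) s0 xU).
  by rewrite (le_trans rA)// ler_wpM2r ?(ltW r0)// lerDl.
exact: le_trans yx r3s.
Qed.

Lemma omega_muckenhoupt : muckenhoupt (kap + 1) Omega omega.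
Proof.
have [T T0 TP] := dual_integral_finite al0 al1 oU aH L0 aL a_ge0 oO cK KU.
split.
- by move=> x /OU Ux; exact: (omega_ge0 k al L0 a_ge0 Ux).
- exact: measurable_funS mU OU momega.
(* The dual weight is +oo on the zero set of omega, and its integral is finite; hence this set is
   null. *)
- pose Z := Omega `&` omega @^-1` [set 0].
  have mZ : measurable Z by exact: (measurable_funS mU OU momega mO (measurable_set1 0)).
  exists Z; split => //; last first.
    move=> x /= /not_implyP[Ox] /negP; rewrite -leNgt => o0; split => //=.
    by apply/eqP; rewrite eq_le o0 (omega_ge0 k al L0 a_ge0 (OU Ox)).
  have : (\int[leb R N]_(x in Z) (cst +oo%E x) <= T%:E)%E.
    apply: le_trans TP.
    rewrite (_ : (\int[leb R N]_(x in Z) _)%E = (\int[leb R N]_(x in Z) dualw x)%E).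
      apply: ge0_subset_integral => //.
      - exact: measurable_funS mU OU mdual.
      - by move=> z _; exact: dual_weight_ge0.
      - by move=> x [].
    by apply: eq_integral => x /set_mem[_ /= o0]; rewrite /dual_weight o0 eqxx.
  rewrite integral_cst//; have [->//|Z0] := eqVneq (leb R N Z) 0%E.
  by rewrite gt0_mulye ?leye_eq// lt0e Z0 measure_ge0.
have [K KP] := ball_estimate.
(* The ball contains the cube of side r / N, so its volume is at least r^N / N^N. *)
pose c : R := N%:R ^+ N.
have c0 : 0 < c by rewrite exprn_gt0.
apply: (@le_lt_trans _ _ (K * c `^ kap)%:E); last exact: ltry.
apply: ge_ereal_sup => _ [[x0 r] /= [r0 BO] <-].
have [u [v [u0 v0 uv uP vP]]] := KP x0 r r0 BO.
have BU : eball x0 r `<=` U by apply: subset_trans OU.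
have mB : measurable (eball x0 r) by exact: measurable_eball.
rewrite addrK.
have rN0 : 0 < r ^+ N by rewrite exprn_gt0.
have low : ((r ^+ N / c)%:E <= leb R N (eball x0 r))%E.
  have h : 0 <= r / (2 * N%:R) by rewrite divr_ge0 ?(ltW r0)// mulr_ge0.
  have <- : leb R N (cube x0 (r / (2 * N%:R))) = (r ^+ N / c)%:E.
    rewrite (leb_cube x0 h); congr EFin; rewrite /c -expr_div_n; congr (_ ^+ _).
    by field; rewrite addrC natr1 pnatr_eq0.
  by apply: le_measure; rewrite ?inE//; [exact: measurable_cube|exact: cube_eball].
have upp : (leb R N (eball x0 r) < +oo)%E.
  apply: (@le_lt_trans _ _ (leb R N (cube x0 r))).
    by apply: le_measure; rewrite ?inE//; [exact: measurable_cube|exact: eball_cube].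
  by rewrite (leb_cube x0 (ltW r0)) ltry.
have [b bE] : exists b, leb R N (eball x0 r) = b%:E.
  exists (fine (leb R N (eball x0 r))); rewrite fineK// ge0_fin_numE//.
rewrite bE lee_fin in low.
have b0 : 0 < b by apply: lt_le_trans low; rewrite divr_gt0.
have avE f : average (eball x0 r) f = (b^-1%:E * \int[leb R N]_(z in eball x0 r) f z)%E.
  by rewrite /average bE inver gt_eqF.
have av1 : (average (eball x0 r) (EFin \o omega) <= u%:E)%E.
  rewrite avE lee_pdivrMl// -EFinM mulrC EFinM -bE -integral_cst//.
  apply: ge0_le_integral => //.
  - by move=> z /BU Uz /=; rewrite lee_fin (omega_ge0 k al L0 a_ge0 Uz).
  - by apply/measurable_EFinP; exact: measurable_funS mU BU momega.
have av2 : (average (eball x0 r) dualw <= (v * c)%:E)%E.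
  rewrite avE lee_pdivrMl// (le_trans vP)// lee_fin mulrCA ler_wpM2l// -ler_pdivrMr//.
have av0 f : (forall z, 0 <= f z)%E -> (0 <= average (eball x0 r) f)%E.
  by move=> f0; rewrite avE mule_ge0 ?lee_fin ?invr_ge0 ?(ltW b0)// integral_ge0.
apply: (@le_trans _ _ (u%:E * ((v * c) `^ kap)%:E)%E).
  apply: lee_pmul => //.
  - rewrite avE mule_ge0 ?lee_fin ?invr_ge0 ?(ltW b0)// integral_ge0// => z /BU Uz.
    by rewrite lee_fin (omega_ge0 k al L0 a_ge0 Uz).
  - exact: poweR_ge0.
  - rewrite -poweR_EFin; apply: gt0_ler_poweR => //; first exact: ltW.
    + rewrite in_itv/= leey andbT; apply: av0 => z; exact: dual_weight_ge0.
    + by rewrite in_itv/= leey andbT lee_fin mulr_ge0// ltW.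
rewrite -EFinM lee_fin powRM ?(ltW c0)// mulrA.
by rewrite ler_wpM2r ?powR_ge0.
Qed.

Lemma omega_Linfty : (omega \_ Omega) \in Lfun (leb R N) +oo%E.
Proof.
rewrite inE/=; apply/andP; split; rewrite inE/=.
  exact: (measurable_restrictT omega mO).1 (measurable_funS mU OU momega).
rewrite /finite_norm unlock.
case: ifP => // _.
apply: (@le_lt_trans _ _ 1%E); last by rewrite ltry.
apply/ess_sup_inf.ess_supP; apply: aeW => x /=; rewrite lee_fin patchE.
case: ifPn => [/set_mem/OU Ux|_]; last by rewrite normr0.
rewrite ger0_norm; first exact: (omega_le1 k a al0 L0 Ux).
exact: (omega_ge0 k al L0 a_ge0 Ux).
Qed.

End muckenhoupt_class.

Theorem theorem3 (R : realType) (N : nat) (Omega U : set 'rV[R]_N) (k : nat)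
    (alpha : R) (a : 'rV[R]_N -> R)
    (N_gt0 : (0 < N)%N)
    (Omega_open : open Omega) (Omega_bounded : bounded_set Omega)
    (U_open : open U) (U_bounded : bounded_set U)
    (Omega_sub_U : compactly_contained Omega U)
    (alpha_gt0 : 0 < alpha) (alpha_le1 : alpha <= 1)
    (a_ge0 : forall x, U x -> 0 <= a x)
    (a_holder : holder_class k alpha U a) :
  exists sigma omega : 'rV[R]_N -> R,
    [/\ Zclass (k%:R + alpha) Omega sigma,
        muckenhoupt (k%:R + alpha + 1) Omega omega,
        (omega \_ Omega) \in Lfun (leb R N) +oo%E &
        forall x, Omega x -> a x = sigma x * omega x].
Proof.
case: N => [//|m] in Omega U a N_gt0 Omega_open Omega_bounded U_open U_bounded
  Omega_sub_U a_ge0 a_holder *.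
case: Omega_sub_U => cK KU.
have [L L0 aL] := holder_bound alpha_gt0 U_open a_holder.
exists (sigma k alpha a L), (omega k alpha a L); split.
- exact: sigma_Zclass alpha_gt0 U_open a_holder L0 aL cK KU.
- exact: omega_muckenhoupt alpha_gt0 alpha_le1 U_open a_holder L0 aL a_ge0
    Omega_open cK KU.
- exact: omega_Linfty alpha_gt0 U_open a_holder L0 aL a_ge0 Omega_open KU.
- by move=> x /subset_closure/KU Ux; exact: (a_sigma_omega k a alpha_gt0 L0 Ux).
Qed.
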